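(* The complexity of the combined algorithm is $n\lg n - 1.41064n$.
   Context: Complexity means the expected number of comparisons over all $n!$ orderings of $n$ distinct inputs; $n$ even, $O(\log n)$ terms ignored. $\lg=\log_2$, $p_x = x/2^{\lceil \lg x\rceil}$. RHBS$(A,T)$, $T=(t_1,\dots,t_i)$ sorted: if $i\le 3\cdot 2^{\lceil\lg(i+1)\rceil-2}-1$ let $d=2^{\lceil\lg(i+1)\rceil-2}$, else $d=i-2^{\lceil\lg(i+1)\rceil-1}+1$; compare $A$ with $t_d$ and recurse on the left or right part. 2Merge$^*(A,B,T)$, $T=(t_1,\dots,t_{i-2})$, $i$ even: compare/swap so $A<B$; for $r=1,2,\dots$ compare $A$ with $t_{\lceil\alpha(r,p_i)i\rceil}$ until $A<t_{\lceil\alpha(r,p_i)i\rceil}$, where for $r=2k-1$: $\alpha=1-2^{-(k-1)}+\frac{1}{p_i2^{k+1}}$ if $p_i\in(3/4,1]$, $\alpha=1-2^{-k}-\frac{1}{p_i2^{k+2}}$ if $p_i\in(1/2,3/4]$; for $r=2k$: $\alpha=1-2^{-k}$; then insert $A$ into the interval between positions $\lceil\alpha(r-1,p_i)i\rceil$ and $\lceil\alpha(r,p_i)i\rceil$ by RHBS, and insert $B$ by RHBS into the part of $T$ to the right of $A$. Combined algorithm on $S=(s_1,\dots,s_n)$: if $p_n\ge 2/3$ let $n'=\frac{2n}{3p_n}$, otherwise $n'=\frac{n}{3p_n}$ (so $n'=\lceil 2^k/3\rceil$, the best case of MergeInsertion); sort $(s_1,\dots,s_{n'})$ by the Ford–Johnson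 MergeInsertion sort; then for $i=n'+2,n'+4,\dots,n$, if $p_i\in[\frac34-\frac{\sqrt6}{12},\frac34+\frac{\sqrt3}{12}]$ insert $s_{i-1},s_i$ by 2Merge$^*$, otherwise insert $s_{i-1}$ and then $s_i$ by RHBS. For $0.638\le p_n\le 2/3$ only MergeInsertion is used.
   Formalization: The complexity is bounded above by n lg n − 1.41064n + O(log n) for every even n: exact equality fails, as the linear constant varies with p_n and 1.41064 is its worst value; and when ⌈2^k/3⌉ is odd, n' is raised by one so that insertion in pairs ends at n. *)

(* Defs.v *)
From HB Require Import structures.
From mathcomp Require Import all_boot all_order all_algebra all_fingroup.
From mathcomp Require Import reals exp.
Set Implicit Arguments. Unset Strict Implicit. Unset Printing Implicit Defensive.
Import Order.TTheory GRing.Theory Num.Theory.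

(* Inputs are sequences of pairwise distinct naturals; comparing two items
   [x] and [y] means evaluating [x < y]; every such evaluation costs 1.
   Each procedure returns its result together with the number of comparisons. *)

Definition clg (i : nat) : nat := up_log 2 i.

(* rhbs fuel a T = (k, c): a belongs between t_k and t_{k+1} (k = #elements
   of T below a), c = #comparisons.  Fuel = size T suffices. *)
Fixpoint rhbs (fuel : nat) (a : nat) (T : seq nat) : nat * nat :=
  match fuel with
  | 0 => (0, 0)
  | f.+1 =>
    let i := size T in
    if i == 0 then (0, 0) else
    let K := clg i.+1 in
    let d := if i <= 3 * 2 ^ (K - 2) - 1 then 2 ^ (K - 2)
             else i - 2 ^ (K - 1) + 1 in
    if a < nth 0 T d.-1 then
      let: (k, c) := rhbs f a (take d.-1 T) in (k, c.+1)
    else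
      let: (k, c) := rhbs f a (drop d T) in (k + d, c.+1)
  end.

Definition RHBS (a : nat) (T : seq nat) : nat * nat := rhbs (size T) a T.

Definition ins_prefix (a : nat) (m : nat) (C : seq nat) : seq nat * nat :=
  let: (k, c) := RHBS a (take m C) in (take k C ++ a :: drop k C, c).

Definition ins (a : nat) (C : seq nat) : seq nat * nat := ins_prefix a (size C) C.

(* Jacobsthal group boundaries t_k = (2^(k+1) + (-1)^k)/3 *)
Definition tJ (k : nat) : nat :=
  if odd k then (2 ^ k.+1 - 1) %/ 3 else (2 ^ k.+1 + 1) %/ 3.

(* order in which b_2, ..., b_nb are inserted (1-indexed):
   b_{t_k}, b_{t_k - 1}, ..., b_{t_{k-1}+1}, for k = 2, 3, ...,
   groups truncated at nb *)
Definition fj_order (nb : nat) : seq nat :=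
  flatten [seq rev (iota (tJ k.-1).+1 (minn (tJ k) nb - tJ k.-1)) | k <- iota 2 nb].

Fixpoint mi (fuel : nat) (s : seq nat) : seq nat * nat :=
  match fuel with
  | 0 => (s, 0)
  | f.+1 =>
    if size s <= 1 then (s, 0) else
    let h := (size s)./2 in
    let bigs := [seq maxn (nth 0 s j.*2) (nth 0 s j.*2.+1) | j <- iota 0 h] in
    let smalls := [seq minn (nth 0 s j.*2) (nth 0 s j.*2.+1) | j <- iota 0 h] in
    let: (as_, c) := mi f bigs in
    (* a_1 < ... < a_h, b_j the partner of a_j, plus the leftover element *)
    let bs := [seq nth 0 smalls (index a bigs) | a <- as_]
              ++ (if odd (size s) then [:: last 0 s] else [::]) in
    let nb := size bs in
    let chain0 := head 0 bs :: as_ in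
    let step (st : seq nat * nat) (j : nat) :=
      let: (C, cc) := st in
      let b := nth 0 bs j.-1 in
      let m := if j <= h then index (nth 0 as_ j.-1) C else size C in
      let: (C', c') := ins_prefix b m C in (C', cc + c') in
    let: (C, ci) := foldl step (chain0, 0) (fj_order nb) in
    (C, h + c + ci)
  end.

Definition MergeInsertion (s : seq nat) : seq nat * nat := mi (size s) s.

Section Real.
Variable R : realType.

Definition pp (x : nat) : R := (x%:R / (2 ^ clg x)%N%:R)%R.

Definition alpha (r : nat) (p : R) : R :=
  (if odd r then
    let k := (r.+1)./2%N in
    if 3%:R / 4%:R < p then 1 - ((2 ^ k.-1)%N%:R)^-1 + (p * (2 ^ k.+1)%N%:R)^-1
    else 1 - ((2 ^ k)%N%:R)^-1 - (p * (2 ^ k.+2)%N%:R)^-1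
  else 1 - ((2 ^ (r./2))%N%:R)^-1)%R.

Definition apos (r i : nat) : nat :=
  if r == 0%N then 0%N else `|Num.ceil (alpha r (pp i) * i%:R)%R|%N.

(* compare A with t_{apos r i}, r = r0, r0+1, ... until A < t_{apos r i};
   a position beyond T (> size T) plays the role of +infinity and is not compared.
   Returns (final r, #comparisons). *)
Fixpoint search (fuel : nat) (r i A : nat) (T : seq nat) : nat * nat :=
  match fuel with
  | 0 => (r, 0)
  | f.+1 =>
    let j := apos r i in
    if size T < j then (r, 0)
    else if A < nth 0 T j.-1 then (r, 1)
    else let: (r', c) := search f r.+1 i A T in (r', c.+1)
  end.

Definition two_merge (a b : nat) (T : seq nat) : seq nat * nat :=
  let i := (size T).+2 in
  let A := minn a b in let B := maxn a b in
  let: (r, cs) := search (i.*2.+2) 1 i A T in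
  let lo := apos r.-1 i in
  let hi := minn (apos r i) (size T).+1 in
  let: (kA, cA) := RHBS A (drop lo (take hi.-1 T)) in
  let gA := lo + kA in
  let: (kB, cB) := RHBS B (drop gA T) in
  let T' := take gA T ++ A :: drop gA T in
  let gB := gA.+1 + kB in
  (take gB T' ++ B :: drop gB T', 1 + cs + cA + cB).

Definition in_2merge_range (p : R) : bool :=
  ((3%:R / 4%:R - Num.sqrt 6%:R / 12%:R <= p) &&
  (p <= 3%:R / 4%:R + Num.sqrt 3%:R / 12%:R))%R.

(* n' = ceil(2^k/3) as in the paper; bumped by one if n - n' is odd *)
Definition nprime (n : nat) : nat :=
  let K := clg n in
  let n0 := if (2%:R / 3%:R <= pp n)%R then (2 ^ K.+1 + 2) %/ 3
            else (2 ^ K + 2) %/ 3 in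
  if odd (n - n0) then n0.+1 else n0.

Definition combined (s : seq nat) : seq nat * nat :=
  let n := size s in
  if ((638%:R / 1000%:R <= pp n) && (pp n <= 2%:R / 3%:R))%R then MergeInsertion s
  else
    let n' := nprime n in
    let: (C0, c0) := MergeInsertion (take n' s) in
    let step (st : seq nat * nat) (t : nat) :=
      let: (C, c) := st in
      let i := n' + t.*2 in
      let x := nth 0 s i.-2 in
      let y := nth 0 s i.-1 in
      if in_2merge_range (pp i) then
        let: (C', c') := two_merge x y C in (C', c + c')
      else
        let: (C1, c1) := ins x C in
        let: (C2, c2) := ins y C1 in (C2, c + c1 + c2) in
    foldl step (C0, c0) (iota 1 ((n - n')./2)).

Definition comparisons (n : nat) (sigma : 'S_n) : nat :=
  (combined [seq nat_of_ord (sigma i) | i <- enum 'I_n]).2.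

Definition avg_complexity (n : nat) : R :=
  ((\sum_(sigma : 'S_n) (comparisons sigma)%:R) / (n`!)%:R)%R.

Definition lg (x : R) : R := (ln x / ln 2%:R)%R.

End Real.

(* Main.v *)
Require Import Defs.
From HB Require Import structures.
From mathcomp Require Import all_boot all_order all_algebra all_fingroup.
From mathcomp Require Import classical_sets functions boolp topology normedtype derive realfun.
From mathcomp Require Import reals exp zify ring lra.
Set Implicit Arguments. Unset Strict Implicit. Unset Printing Implicit Defensive.
Import Order.TTheory GRing.Theory Num.Theory.
Import numFieldNormedType.Exports.

(* Write N = 2^k for the power of two with N/2 < i <= N and p = i/N.  The exact average costs of
   the two ways of inserting the pair (s_{i-1}, s_i) are, up to O(1/i), 2k + q(p) with q an explicit
   rational function of p, and 2Merge is used exactly where its q is the smaller one.  Adding them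
   up is a Riemann sum, so over a range with fixed q the total is N (phi(y/N) - phi(x/N)) + k (y - x)
   + O(1) with phi p = a p - b ln p - d/p.  Starting from the worst case of MergeInsertion at n',
   about 2/3 of a power of two, the claim becomes "offset + phi p <= p lg p - 1.41064 p" on each range, which
   is proved by rational enclosures of the logarithms.  Since the cheaper insertion lies below both
   curves q, the ranges may be cut at the rationals 3/4, 57/64, 35/64 instead of the exact crossovers.
   For 0.638 <= p <= 2/3 the worst case of MergeInsertion is not good enough.  There, exchanging b_j
   with its predecessor in the chain is an injection on orderings, so small insertion positions are
   at least as likely as large ones, and the incomplete last group saves a fixed fraction. *)

(** The error has to stay O(log n) over about n insertions. The logarithm comes only from the
    recursion of MergeInsertion, whose levels each lose O(1) to rounding. The remaining insertions
    run through at most two octaves, since n' is more than half of n, and there an error O(1/i) per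
    step adds up to O(1).

    The probes of 2Merge look irregular, but i / p_i is exactly the power of two 2^K. So an odd
    probe lies an exact power of two away from one of its even neighbours, and one of the two
    intervals it separates is a complete search tree. This makes the depth of A computable up to a
    single indicator.

    The cuts 57/64 and 35/64 approximate the crossovers 3/4 + sqrt 3 / 12 and 3/4 - sqrt 6 / 12.
    Multiples of 1/64 are taken so that the cuts become even integers once 128 divides the power of
    two. This is the origin of the threshold [8 <= clg n]; smaller n go into the constant C.

    The constant 1.41064 is nearly sharp for this potential: at p = 25/27 the slack is below 10^-5.
    Hence logarithms are needed to about eight decimals. *)

Definition rank (a : nat) (T : seq nat) : nat := count (fun x => x < a) T.

(* Cost of RHBS on [m] slots when the item lands in slot [k]: the shallow leaves come first. *)
Definition rcost (m k : nat) : nat := clg m - (k < 2 ^ clg m - m).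

(** * Ranks in sorted sequences and the exact cost of RHBS *)

Lemma nth_lt_rank a T i :
  sorted leq T -> i < size T -> (nth 0 T i < a) = (i < rank a T).
Proof.
rewrite /rank; elim: T i => [|x T IH] i //= srt.
have srtT : sorted leq T by apply: path_sorted srt.
have xT : all (leq x) T.
  by move: srt; rewrite path_sortedE; [case/andP | exact: leq_trans].
case: (ltnP x a) => xa.
  by case: i => [|i] //= iT; rewrite IH.
have -> : count (fun y => y < a) T = 0.
  apply/eqP; rewrite -leqn0 leqNgt -has_count; apply/hasP => -[y yT /= ya].
  by have /= := allP xT _ yT; lia.
case: i => [|i] /= iT; first by lia.
have /= := allP xT _ (mem_nth 0 iT); lia.
Qed.

Lemma rank_size a T : rank a T <= size T.
Proof. exact: count_size. Qed.

Lemma rank_take a T d :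
  sorted leq T -> rank a T <= d -> rank a (take d T) = rank a T.
Proof.
move=> srt rd; rewrite -[in RHS](cat_take_drop d T) /rank count_cat.
rewrite [X in _ = _ + X](_ : _ = 0) ?addn0 //.
apply/eqP; rewrite -leqn0 leqNgt -has_count; apply/(has_nthP 0) => -[i].
rewrite size_drop nth_drop => iT; rewrite nth_lt_rank //; lia.
Qed.

Lemma rank_drop a T d :
  sorted leq T -> d <= rank a T -> rank a (drop d T) = rank a T - d.
Proof.
move=> srt dr; have dT := leq_trans dr (rank_size a T).
rewrite -[in RHS](cat_take_drop d T) /rank count_cat.
have -> : count (fun x => x < a) (take d T) = d.
  rewrite -[RHS](size_takel dT); apply/eqP; rewrite -all_count.
  apply/(all_nthP 0) => i; rewrite size_takel // => id_.
  rewrite nth_take // nth_lt_rank //; lia.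
by rewrite addKn.
Qed.

Lemma clg_eq k m : 2 ^ k < m -> m <= 2 ^ k.+1 -> clg m = k.+1.
Proof. by move=> h1 h2; apply: up_log_eq => //; rewrite h1 h2. Qed.

Lemma clg_bounds m : 1 < m -> 2 ^ (clg m).-1 < m <= 2 ^ clg m.
Proof. by move=> m1; apply: up_log_bounds. Qed.

Lemma leq_clg m : m <= 2 ^ clg m.
Proof. exact: up_logP. Qed.

Lemma clg_min m k : m <= 2 ^ k -> clg m <= k.
Proof. exact: up_log_min. Qed.

Lemma clg_exp k : clg (2 ^ k) = k.
Proof. exact: up_expnK. Qed.

Lemma rcost_exp k j : rcost (2 ^ k) j = k.
Proof. by rewrite /rcost clg_exp subnn ltn0 subn0. Qed.

(** If the tree has height [k] this is the definition; if it is lower, the missing level pays for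
    the indicator. *)
Lemma rcost_le k m j : m <= 2 ^ k -> rcost m j <= k - (j < 2 ^ k - m).
Proof.
move=> mk; rewrite /rcost; have := clg_min mk; rewrite leq_eqVlt => /orP[/eqP->//|].
case: (j < 2 ^ k - m); case: (j < _) => /=; lia.
Qed.

(** The pivot always cuts off a complete tree, on the left while there are few slots and on the
    right otherwise, and leaves the remaining side in the same shape. So shallow leaves stay to the
    left of the deep ones. *)
Lemma rhbsE f a T : sorted leq T -> size T <= f -> a \notin T ->
  rhbs f a T = (rank a T, rcost (size T).+1 (rank a T)).
Proof.
elim: f T => [|f IH] T srt szT aT.
  by move: szT; rewrite leqn0 => /nilP -> /=.
rewrite /=; case: eqP => [/eqP/nilP ->//|/eqP i0].
set i := size T in szT i0 *.
have [K [EK K2 iK1 iK2]] : exists K, [/\ clg i.+1 = K.+1, 0 < 2 ^ K, 2 ^ K < i.+1 & i.+1 <= 2 ^ K.+1].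
  have [] := andP (@clg_bounds i.+1 ltac:(lia)).
  have : 0 < clg i.+1 by rewrite up_log_gt0 /=; lia.
  by case: (clg i.+1) => // K _ /= ? ?; exists K; split=> //; rewrite expn_gt0.
rewrite EK.
set d0 := (if i <= 3 * _ - 1 then _ else _).
have [d dD] : {d | d = d0} by exists d0.
rewrite -dD; move: dD; rewrite {}/d0 subSS subn1 /= => dD.
have rec_l : d <= i -> 0 < d -> rank a T < d ->
    rhbs f a (take d.-1 T) = (rank a T, rcost d (rank a T)).
  move=> di d0 rd; have sz : size (take d.-1 T) = d.-1 by rewrite size_takel //; lia.
  rewrite IH ?sz.
  - by rewrite prednK // rank_take //; lia.
  - by apply: take_sorted.
  - lia.
  - by apply: contra aT; exact: mem_take.
have rec_r : d <= i -> 0 < d -> d <= rank a T ->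
    rhbs f a (drop d T) = (rank a T - d, rcost (i - d).+1 (rank a T - d)).
  move=> di d0 rd; rewrite IH ?size_drop.
  - by rewrite rank_drop.
  - by apply: drop_sorted.
  - by rewrite /i in i0 di d0 *; lia.
  - by apply: contra aT; exact: mem_drop.
have ltE : d <= i -> 0 < d -> (a < nth 0 T d.-1) = (rank a T < d).
  move=> di d0; have dT : d.-1 < size T by rewrite -/i; lia.
  have := @nth_lt_rank a T d.-1 srt dT.
  have : nth 0 T d.-1 != a by apply: contraNneq aT => <-; apply: mem_nth.
  lia.
have Ecl : clg i.+1 = K.+1 by apply: clg_eq.
have rki : rank a T <= i := rank_size a T.
rewrite [in RHS]/rcost Ecl.
clear EK; case: K K2 iK1 iK2 dD rec_l rec_r ltE Ecl => [|K] K2 iK1 iK2 dD rec_l rec_r ltE Ecl.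
  have i1 : i = 1 by move: iK1 iK2; rewrite expn0 expn1; lia.
  have d1 : d = 1 by rewrite dD i1.
  move: rec_l rec_r ltE; rewrite d1 i1 => rec_l rec_r ->//; case: ltnP => rd.
    rewrite rec_l //=; congr (_, _); rewrite /rcost /clg up_log1; lia.
  rewrite rec_r //= subnK; last by lia.
  by congr (_, _); rewrite /rcost /clg up_log1; lia.
move: iK1 iK2 K2; rewrite !expnS => iK1 iK2 K2.
have K0 : 0 < 2 ^ K by rewrite expn_gt0.
(* Here [clg i.+1 = K.+2]. In the first case the left part is complete with [2 ^ K] slots, all
   shallow; in the second the right part is complete with [2 ^ K.+1] slots, all deep. *)
have [dE|dE] : (i.+1 <= 3 * 2 ^ K /\ d = 2 ^ K) \/ (3 * 2 ^ K < i.+1 /\ d = i.+1 - 2 * 2 ^ K).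
  by rewrite dD ?subSS ?subn0 ?subn1 /= ?subn0 expnS; case: (leqP i) => h; [left|right]; split; lia.
- have di : d <= i by lia.
  have d0 : 0 < d by lia.
  rewrite ltE //; case: ltnP => rd.
    rewrite rec_l //; congr (_, _); rewrite dE.2 rcost_exp.
    have -> : rank a T < 2 * (2 * 2 ^ K) - i.+1 by lia.
    lia.
  rewrite rec_r //; congr (_, _); first by lia.
  rewrite /rcost (_ : clg _ = K.+1); last by apply: clg_eq; rewrite ?expnS; lia.
  by rewrite expnS; lia.
- have di : d <= i by lia.
  have d0 : 0 < d by lia.
  rewrite ltE //; case: ltnP => rd.
    rewrite rec_l //; congr (_, _); rewrite /rcost.
    rewrite (_ : clg d = K.+1); last by apply: clg_eq; rewrite ?expnS; lia.
    by rewrite expnS; lia.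
  rewrite rec_r //; congr (_, _); first by lia.
  rewrite (_ : (i - d).+1 = 2 ^ K.+1); last by rewrite expnS; lia.
  by rewrite rcost_exp; lia.
Qed.

Lemma RHBSE a T : sorted leq T -> a \notin T ->
  RHBS a T = (rank a T, rcost (size T).+1 (rank a T)).
Proof. by move=> srt aT; rewrite /RHBS rhbsE. Qed.

Lemma sort_cons_rank a C : sorted leq C ->
  take (rank a C) C ++ a :: drop (rank a C) C = sort leq (a :: C).
Proof.
move=> srt; apply: (sorted_eq leq_trans anti_leq); last first.
- rewrite perm_sym perm_sort -cat_rcons -cats1 -catA /=.
  by rewrite -[in X in perm_eq X](cat_take_drop (rank a C) C) -[X in perm_eq X]cat1s perm_catCA.
- exact: (sort_sorted leq_total).
apply/(sortedP 0) => i; rewrite size_cat /= => hi.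
have rC := rank_size a C.
rewrite !nth_cat size_takel //.
have nsrt j k : j <= k -> k < size C -> nth 0 C j <= nth 0 C k.
  move=> jk kC; apply: (sorted_leq_nth leq_trans leqnn) => //; rewrite inE; lia.
rewrite size_takel // size_drop in hi.
have nr j : j < size C -> (nth 0 C j < a) = (j < rank a C) by exact: nth_lt_rank.
case: (ltngtP i.+1 (rank a C)) => h.
- rewrite !nth_take; [apply: nsrt|..]; lia.
- rewrite (_ : i.+1 - rank a C = (i - rank a C).+1) /=; last by lia.
  rewrite nth_drop.
  case E : (i - rank a C) => [|j] /=; rewrite ?addn0.
    have := nr (rank a C); lia.
  by rewrite nth_drop; apply: nsrt; lia.
- rewrite h subnn /= nth_take; last by lia.
  by rewrite ltnW // nr; lia.
Qed.

Lemma ins_prefixE a m C : sorted leq C -> a \notin C -> rank a C <= m <= size C ->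
  ins_prefix a m C = (sort leq (a :: C), rcost m.+1 (rank a C)).
Proof.
move=> srt aC /andP[rm mC]; rewrite /ins_prefix RHBSE; last 2 first.
- exact: take_sorted.
- by apply: contra aC; exact: mem_take.
by rewrite rank_take // sort_cons_rank // size_takel.
Qed.

Lemma insE a C : sorted leq C -> a \notin C ->
  ins a C = (sort leq (a :: C), rcost (size C).+1 (rank a C)).
Proof. by move=> srt aC; rewrite /ins ins_prefixE // rank_size leqnn. Qed.

Lemma perm_rank a s t : perm_eq s t -> rank a s = rank a t.
Proof. by rewrite /rank => /seq.permP->. Qed.

Lemma rank_sort a s : rank a (sort leq s) = rank a s.
Proof. by apply: perm_rank; rewrite perm_sort. Qed.

Lemma eq_sort_perm s t : perm_eq s t -> sort leq s = sort leq t.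
Proof. by move=> st; apply/(perm_sortP leq_total leq_trans anti_leq). Qed.

(** External path length of the tree: [2 ^ clg m - m] leaves have depth [clg m - 1], the others
    [clg m]. The last term corrects [2 ^ clg 0 = 1]. *)
Lemma sum_rcost m : \sum_(0 <= k < m) rcost m k + 2 ^ clg m = m * (clg m).+1 + (m == 0).
Proof.
have [->|m0] := posnP m; first by rewrite big_geq.
rewrite addn0.
have [h1 h2] : 2 ^ clg m <= m.*2 /\ m <= 2 ^ clg m.
  split; last exact: leq_clg.
  case: (ltnP 1 m) => m1; last by rewrite (_ : m = 1) //; lia.
  have /andP[+ _] := clg_bounds m1.
  have : 0 < clg m by rewrite up_log_gt0.
  case: (clg m) => //= k _; rewrite expnS; lia.
have K0 : m < 2 ^ clg m -> 0 < clg m by case: (clg m) => //; rewrite expn0; lia.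
set s := 2 ^ clg m - m.
have -> : \sum_(0 <= k < m) rcost m k = s * (clg m).-1 + (m - s) * clg m.
  rewrite (@big_cat_nat _ _ _ s) /=; [|lia|rewrite /s; lia].
  congr (_ + _).
    rewrite (eq_big_nat _ _ (F2 := fun=> (clg m).-1)); last first.
      by move=> k /andP[_ ks]; rewrite /rcost -/s ks subn1.
    by rewrite sum_nat_const_nat subn0 mulnC.
  rewrite (eq_big_nat _ _ (F2 := fun=> clg m)); last first.
    by move=> k /andP[ks _]; rewrite /rcost -/s ltnNge ks subn0.
  by rewrite sum_nat_const_nat mulnC.
rewrite /s; case E : (clg m) K0 h1 h2 => [|k] /= K0 h1 h2.
  by move: h1 h2; rewrite expn0; nia.
by move: (2 ^ k.+1) h1 h2 => P h1 h2; rewrite mulnS; nia.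
Qed.

(** * Jacobsthal numbers and the insertion order of MergeInsertion *)

Lemma tJ3 k : 3 * tJ k + odd k = 2 ^ k.+1 + ~~ odd k.
Proof.
have [q Eq] : exists q, 2 ^ k.+1 = 3 * q + (if odd k then 1 else 2).
  elim: k => [|k [q Eq]]; first by exists 0.
  rewrite expnS Eq /=; case: (odd k) => /=; [exists q.*2 | exists q.*2.+1]; lia.
rewrite /tJ; case: (odd k) Eq => /= ->; [rewrite addnK | rewrite -addnA -[2 + 1]/3 -mulnSr];
  rewrite mulKn //; lia.
Qed.

(** This sum is the number of slots open to an element of a full group, and explains why the group
    boundaries are optimal. *)
Lemma tJS k : tJ k + tJ k.+1 = 2 ^ k.+1.
Proof. by have := tJ3 k; have := tJ3 k.+1; rewrite /= [2 ^ k.+2]expnS; case: (odd k); lia. Qed.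

Lemma tJ1 : tJ 1 = 1. Proof. by []. Qed.

Lemma tJ_gt0 k : 0 < tJ k.
Proof.
have := tJ3 k; have : 0 < 2 ^ k by rewrite expn_gt0.
by rewrite expnS; case: (odd k); lia.
Qed.

Lemma tJ_lt k : 0 < k -> tJ k < tJ k.+1.
Proof.
move=> k0; have := tJ3 k; have := tJ3 k.+1; rewrite /= [2 ^ k.+2]expnS.
have : 1 < 2 ^ k by rewrite -{1}(expn0 2) ltn_exp2l.
rewrite expnS; case: (odd k); lia.
Qed.

Lemma tJ_ge k : k <= tJ k.
Proof.
elim: k => // -[|k] IH //; by have := @tJ_lt k.+1 isT; lia.
Qed.

Definition fj_group (nb k : nat) : seq nat := iota (tJ k.-1).+1 (minn (tJ k) nb - tJ k.-1).

Lemma mem_fj_group nb k j : (j \in fj_group nb k) = (tJ k.-1 < j <= minn (tJ k) nb).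
Proof. by rewrite /fj_group mem_iota; lia. Qed.

(** Groups are consecutive blocks of indices, each reversed. Groups beyond [nb] are empty because
    their length is a truncated subtraction. *)
Lemma fj_prefix nb q :
  let L := flatten [seq rev (fj_group nb k) | k <- iota 2 q] in
  perm_eq L (iota 2 (minn (tJ q.+1) nb).-1).
Proof.
elim: q => [|q IH].
  by rewrite (_ : (minn _ _).-1 = 0) //= tJ1; lia.
have -> : iota 2 q.+1 = iota 2 q ++ [:: q.+2] by rewrite -(addn1 q) iotaD add2n addn1.
move: IH => /= IH; rewrite map_cat flatten_cat /= cats0.
move: IH; rewrite -(perm_cat2r (rev (fj_group nb q.+2))) => /permPl ->.
have -> : perm_eql (iota 2 (minn (tJ q.+1) nb).-1 ++ rev (fj_group nb q.+2))
         (iota 2 (minn (tJ q.+1) nb).-1 ++ fj_group nb q.+2).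
  by apply/permPl; rewrite perm_cat2l perm_rev.
rewrite /fj_group /=; have := @tJ_lt q.+1 isT; have := tJ_gt0 q.+1.
move=> h2 h3; have [h1|h1] : tJ q.+1 <= nb \/ nb < tJ q.+1 by lia.
  have -> : (tJ q.+1).+1 = 2 + (minn (tJ q.+1) nb).-1 by lia.
  rewrite -iotaD; have -> // : (minn (tJ q.+1) nb).-1 + (minn (tJ q.+2) nb - tJ q.+1) = (minn (tJ q.+2) nb).-1.
    by lia.
have -> : minn (tJ q.+2) nb - tJ q.+1 = 0 by lia.
have -> : minn (tJ q.+1) nb = nb by lia.
have -> : minn (tJ q.+2) nb = nb by lia.
by rewrite /= cats0.
Qed.

Lemma perm_fj nb : perm_eq (fj_order nb) (iota 2 nb.-1).
Proof.
have /= := fj_prefix nb nb; rewrite (_ : minn _ _ = nb) //.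
by have := tJ_ge nb.+1; lia.
Qed.

Lemma fj_uniq nb : uniq (fj_order nb).
Proof. by rewrite (perm_uniq (perm_fj nb)) iota_uniq. Qed.

Lemma mem_fj nb j : (j \in fj_order nb) = (1 < j <= nb).
Proof. by rewrite (perm_mem (perm_fj nb)) mem_iota; lia. Qed.

(** Before b_j come b_2, ..., b_{t_{k-1}} and the members of its own group with larger index. The
    successor accounts for b_1, which is in the chain but not in the order. *)
Lemma index_fj nb k j : 2 <= k < nb + 2 -> j \in fj_group nb k ->
  (index j (fj_order nb)).+1 = tJ k.-1 + minn (tJ k) nb - j.
Proof.
move=> k2 jk; rewrite /fj_order.
have -> : iota 2 nb = iota 2 (k - 2) ++ k :: iota k.+1 (nb + 1 - k).
  have -> : k :: iota k.+1 (nb + 1 - k) = iota k (nb + 2 - k).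
    by have -> : nb + 2 - k = (nb + 1 - k).+1 by lia.
  have {2}-> : k = 2 + (k - 2) by lia.
  by rewrite -iotaD; congr iota; lia.
rewrite map_cat flatten_cat /= -/(fj_group nb k).
have /= P := fj_prefix nb (k - 2).
have Pk : (k - 2).+1 = k.-1 by lia.
rewrite Pk in P.
move: jk; rewrite mem_fj_group => /andP[j1 j2].
have jnb : minn (tJ k.-1) nb = tJ k.-1 by lia.
rewrite jnb in P.
rewrite index_cat (perm_mem P) mem_iota ifF; last by lia.
rewrite (perm_size P) size_iota index_cat mem_rev -/(fj_group nb k) mem_fj_group j1 j2 /=.
have -> : index j (rev (fj_group nb k)) = minn (tJ k) nb - j.
  have -> : j = nth 0 (rev (fj_group nb k)) (minn (tJ k) nb - j).
    rewrite nth_rev /fj_group ?size_iota ?nth_iota; lia.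
  rewrite index_uniq ?rev_uniq ?iota_uniq //; last by rewrite size_rev size_iota; lia.
  rewrite nth_rev /fj_group ?size_iota ?nth_iota; lia.
have := tJ_gt0 k.-1; lia.
Qed.

(** * One level of MergeInsertion, freed from fuel and from the explicit chain *)

Definition bigs (s : seq nat) :=
  [seq maxn (nth 0 s j.*2) (nth 0 s j.*2.+1) | j <- iota 0 (size s)./2].
Definition smalls (s : seq nat) :=
  [seq minn (nth 0 s j.*2) (nth 0 s j.*2.+1) | j <- iota 0 (size s)./2].
Definition leftover (s : seq nat) := if odd (size s) then [:: last 0 s] else [::].
Definition asq (s : seq nat) := sort leq (bigs s).
Definition bsq (s : seq nat) :=
  [seq nth 0 (smalls s) (index a (bigs s)) | a <- asq s] ++ leftover s.
(* b_j, counted from 1. *)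
Definition bel (s : seq nat) j := nth 0 (bsq s) j.-1.
(* The main chain together with the b_i already inserted, i in [D]. *)
Definition base (D : seq nat) s := asq s ++ [seq bel s i | i <- D].
(** Cost of inserting b_j when exactly the b_i with i in [D] are in the chain. The second branch is
    the element left over from the pairing, which has no partner to bound it from above. *)
Definition insc (D : seq nat) s j :=
  rcost (if j <= (size s)./2 then rank (nth 0 (asq s) j.-1) (base D s)
         else size (base D s)).+1 (rank (bel s j) (base D s)).

Lemma size_bigs s : size (bigs s) = (size s)./2.
Proof. by rewrite size_map size_iota. Qed.
Lemma size_smalls s : size (smalls s) = (size s)./2.
Proof. by rewrite size_map size_iota. Qed.
Lemma size_asq s : size (asq s) = (size s)./2.
Proof. by rewrite size_sort size_bigs. Qed.
Lemma size_bsq s : size (bsq s) = uphalf (size s).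
Proof.
by rewrite size_cat size_map size_asq /leftover uphalf_half; case: (odd _) => /=; lia.
Qed.

Lemma bigs_cons x y s : bigs [:: x, y & s] = maxn x y :: bigs s.
Proof. by rewrite /bigs /= (iotaDl 1 0) -map_comp. Qed.
Lemma smalls_cons x y s : smalls [:: x, y & s] = minn x y :: smalls s.
Proof. by rewrite /smalls /= (iotaDl 1 0) -map_comp. Qed.

Lemma perm_pairs s : perm_eq (bigs s ++ smalls s ++ leftover s) s.
Proof.
have [n] := ubnP (size s); elim: n s => // n IH [|x [|y s]] // sn.
rewrite bigs_cons smalls_cons.
have -> : leftover [:: x, y & s] = leftover s.
  by rewrite /leftover /= negbK; case: (s).
have /IH P : size s < n by move: sn => /=; lia.
apply: (@perm_trans _ ([:: maxn x y; minn x y] ++ (bigs s ++ smalls s ++ leftover s))).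
  by rewrite /= perm_cons -(cat1s (minn x y)) -[X in perm_eq _ X]cat1s perm_catCA.
apply: (@perm_trans _ ([:: x; y] ++ s)) => //.
apply: perm_cat => //; case: (leqP x y) => // _.
by rewrite -[[:: y; x]]/([:: y] ++ [:: x]) perm_catC.
Qed.

Lemma perm_ab s : uniq s -> perm_eq (asq s ++ bsq s) s.
Proof.
move=> us; rewrite -(permPr (perm_pairs s)) /bsq; apply: perm_cat.
  by rewrite perm_sort.
apply: perm_cat => //.
have ub : uniq (bigs s) by have := us; rewrite -(perm_uniq (perm_pairs s)) cat_uniq => /andP[].
apply: (@perm_trans _ [seq nth 0 (smalls s) (index a (bigs s)) | a <- bigs s]).
  by apply: perm_map; rewrite perm_sort.
rewrite (_ : map _ _ = smalls s) //; apply: (@eq_from_nth _ 0); rewrite size_map size_bigs ?size_smalls //.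
by move=> i ih; rewrite (nth_map 0) ?size_bigs // index_uniq ?size_bigs.
Qed.

Lemma uniq_ab s : uniq s -> uniq (asq s ++ bsq s).
Proof. by move=> us; rewrite (perm_uniq (perm_ab us)). Qed.

Lemma bel_lt s j : uniq s -> 0 < j <= (size s)./2 -> bel s j < nth 0 (asq s) j.-1.
Proof.
move=> us /andP[j0 jh].
have ja : j.-1 < size (asq s) by rewrite size_asq; lia.
rewrite /bel nth_cat size_map ja (nth_map 0) //.
set a := nth 0 (asq s) j.-1.
have /(nthP 0)[q] : a \in bigs s by rewrite -(mem_sort leq) mem_nth.
rewrite size_bigs => qh Eq.
have ub : uniq (bigs s) by have := us; rewrite -(perm_uniq (perm_pairs s)) cat_uniq => /andP[].
rewrite -Eq index_uniq ?size_bigs //.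
rewrite !(nth_map 0) ?size_iota // !nth_iota // add0n.
have : nth 0 s q.*2 != nth 0 s q.*2.+1 by rewrite nth_uniq //; lia.
by lia.
Qed.

Lemma index_rank a C : uniq C -> sorted leq C -> a \in C -> index a C = rank a C.
Proof.
move=> uC sC aC; have iC : index a C < size C by rewrite index_mem.
have h j : j < size C -> (nth 0 C j < a) = (j < rank a C) by exact: nth_lt_rank.
have := h _ iC; rewrite nth_index // ltnn => /esym/negbT; rewrite -leqNgt => r1.
apply/eqP; rewrite eqn_leq r1 andbT leqNgt; apply/negP => r2.
have hr : rank a C < size C by lia.
have := h _ hr; rewrite ltnn => /negbT; rewrite -leqNgt => h1.
have : nth 0 C (rank a C) <= nth 0 C (index a C).
  by apply: (sorted_leq_nth leq_trans leqnn) => //; rewrite ?inE; lia.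
rewrite nth_index // => h2.
have : nth 0 C (rank a C) == nth 0 C (index a C) by rewrite nth_index //; lia.
rewrite nth_uniq //; lia.
Qed.

Lemma rank_mono a b s : a <= b -> rank a s <= rank b s.
Proof. by move=> ab; apply: sub_count => x /=; lia. Qed.

Section Chain.
Variable s : seq nat.
Hypothesis us : uniq s.
Let h := (size s)./2.
Let nb := uphalf (size s).

Lemma nth_bsq_bel : [seq bel s i | i <- iota 1 nb] = bsq s.
Proof.
apply: (@eq_from_nth _ 0); first by rewrite size_map size_iota size_bsq.
by move=> i; rewrite size_map size_iota => ib; rewrite (nth_map 0) ?size_iota // nth_iota.
Qed.

Lemma bel_inj : {in iota 1 nb &, injective (bel s)}.
Proof.
have := uniq_ab us; rewrite cat_uniq => /and3P[_ _ ub] i j.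
rewrite !mem_iota => hi hj /eqP; rewrite /bel nth_uniq ?size_bsq // -/nb; lia.
Qed.

Lemma bel_notin i : i \in iota 1 nb -> bel s i \notin asq s.
Proof.
move=> ib; have := uniq_ab us; rewrite cat_uniq => /and3P[_ /hasPn hb _].
by apply: hb; rewrite -nth_bsq_bel map_f.
Qed.

Lemma uniq_base D : uniq D -> {subset D <= iota 1 nb} -> uniq (base D s).
Proof.
move=> uD sD; have := uniq_ab us; rewrite !cat_uniq => /and3P[-> hn _] /=.
rewrite map_inj_in_uniq ?uD ?andbT; last by move=> i j /sD hi /sD hj; apply: bel_inj.
apply/hasPn => x /mapP[i /sD ib ->]; exact: bel_notin.
Qed.

Lemma bel_notin_base D j : {subset D <= iota 1 nb} -> j \in iota 1 nb -> j \notin D ->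
  bel s j \notin base D s.
Proof.
move=> sD jb jD; rewrite mem_cat negb_or bel_notin //=.
by apply/mapP => -[i iD] /bel_inj => /(_ jb (sD _ iD)) E; move: jD; rewrite E iD.
Qed.

(** Since b_j lies below its partner a_j, searching only the prefix before a_j still finds the right
    place, and the index of a_j in the sorted chain is its rank. *)
Lemma ins_step D j : uniq D -> {subset D <= iota 1 nb} -> j \in iota 1 nb -> j \notin D ->
  ins_prefix (bel s j) (if j <= h then index (nth 0 (asq s) j.-1) (sort leq (base D s))
     else size (sort leq (base D s))) (sort leq (base D s))
  = (sort leq (base (rcons D j) s), insc D s j).
Proof.
move=> uD sD jb jD; set C := sort leq _.
have sC : sorted leq C by apply: sort_sorted leq_total _.
have E1 : (if j <= h then index (nth 0 (asq s) j.-1) C else size C)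
  = (if j <= h then rank (nth 0 (asq s) j.-1) (base D s) else size (base D s)).
  case: (leqP j h) => jh; last by rewrite size_sort.
  rewrite index_rank ?rank_sort //; first by rewrite sort_uniq uniq_base.
  by rewrite mem_sort mem_cat mem_nth // size_asq; move: jb; rewrite mem_iota -/h; lia.
have bC : bel s j \notin C by rewrite mem_sort bel_notin_base.
rewrite ins_prefixE //; last first.
  rewrite E1 /C rank_sort size_sort; case: (leqP j h) => jh; rewrite ?rank_size ?leqnn ?andbT //.
  by rewrite rank_mono // ltnW // bel_lt //; move: jb; rewrite mem_iota -/h; lia.
rewrite /C rank_sort -/C E1; congr (_, _); apply: eq_sort_perm.
rewrite /base map_rcons -cats1 catA perm_sym perm_catC /= perm_cons.
by rewrite perm_sym perm_sort.
Qed.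

End Chain.

Definition chain_step (s : seq nat) (st : seq nat * nat) (j : nat) :=
  let: (C, cc) := st in
  let b := nth 0 (bsq s) j.-1 in
  let m := if j <= (size s)./2 then index (nth 0 (asq s) j.-1) C else size C in
  let: (C', c') := ins_prefix b m C in (C', cc + c').

Lemma foldl_chain s L D cc : uniq s -> uniq (D ++ L) ->
  {subset D ++ L <= iota 1 (uphalf (size s))} ->
  foldl (chain_step s) (sort leq (base D s), cc) L =
  (sort leq (base (D ++ L) s),
   cc + \sum_(j <- L) insc (D ++ take (index j L) L) s j).
Proof.
move=> us; elim: L D cc => [|j L IH] D cc uDL sDL /=.
  by rewrite big_nil cats0 addn0.
have sD : {subset D <= iota 1 (uphalf (size s))}.
  by move=> x xD; apply: sDL; rewrite mem_cat xD.
have jb : j \in iota 1 (uphalf (size s)).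
  by apply: sDL; rewrite mem_cat mem_head orbT.
have jD : j \notin D.
  apply: contraL uDL => jD; rewrite cat_uniq negb_and; apply/orP; right.
  by rewrite negb_and; apply/orP; left; rewrite /= jD.
have uD : uniq D by move: uDL; rewrite cat_uniq => /andP[].
have jL : j \notin L by move: uDL; rewrite cat_uniq => /and3P[_ _ /andP[]].
have := ins_step us uD sD jb jD; rewrite /bel => ->.
rewrite IH ?cat_rcons //; congr (_, _).
rewrite big_cons eqxx /= cats0 -addnA; congr (_ + (_ + _)).
apply: eq_big_seq => i iL; rewrite ifN; last by apply: contraNneq jL => ->.
by rewrite /= cat_rcons.
Qed.

(* b_1 heads the chain from the start. *)
Definition done_before (nb j : nat) := 1 :: take (index j (fj_order nb)) (fj_order nb).

Definition inscost (s : seq nat) :=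
  \sum_(j <- fj_order (uphalf (size s))) insc (done_before (uphalf (size s)) j) s j.

Lemma perm_base_full (s : seq nat) : uniq s -> 0 < size s ->
  perm_eq (base (1 :: fj_order (uphalf (size s))) s) s.
Proof.
move=> us s0; apply: perm_trans (perm_ab us); rewrite /base perm_cat2l -nth_bsq_bel //.
apply: perm_map; have -> : iota 1 (uphalf (size s)) = 1 :: iota 2 (uphalf (size s)).-1.
  have : 0 < uphalf (size s) by lia.
  by case: (uphalf (size s)).
by rewrite perm_cons perm_fj.
Qed.

(** b_1 is below a_1, hence below the whole chain, and enters without any comparison. *)
Lemma chain0E (s : seq nat) : uniq s -> 1 < size s ->
  head 0 (bsq s) :: asq s = sort leq (base [:: 1] s).
Proof.
move=> us s1; have := @bel_lt s 1 us; rewrite /bel /= nth0 => hlt.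
have {}hlt : head 0 (bsq s) < nth 0 (asq s) 0 by apply: hlt; lia.
have -> : head 0 (bsq s) :: asq s = sort leq (head 0 (bsq s) :: asq s).
  rewrite (sorted_sort leq_trans) //=; case: (asq s) hlt (sort_sorted leq_total (bigs s) : sorted leq (asq s)) => //= x r /ltnW -> //.
by apply: eq_sort_perm; rewrite /base /= /bel /= nth0 cats1 perm_sym perm_rcons.
Qed.

Lemma mi_rec f (s : seq nat) : uniq s -> 1 < size s ->
  (mi f (bigs s)).1 = asq s ->
  mi f.+1 s = (sort leq s, (size s)./2 + (mi f (bigs s)).2 + inscost s).
Proof.
move=> us s1 E1; rewrite [LHS]/= leqNgt s1 /= -/(bigs s) -/(smalls s).
case E : (mi f (bigs s)) => [as_ c]; move: E1; rewrite E /= => ->.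
rewrite -/(leftover s) -/(bsq s) size_bsq -/(chain_step s) chain0E //.
have s0 : 0 < size s by lia.
have P := perm_base_full us s0.
rewrite foldl_chain //=.
- by rewrite (eq_sort_perm P).
- by rewrite fj_uniq mem_fj.
- by move=> x; rewrite inE mem_fj mem_iota => /orP[/eqP->|]; lia.
Qed.

Lemma uniq_bigs (s : seq nat) : uniq s -> uniq (bigs s).
Proof. by move=> us; have := us; rewrite -(perm_uniq (perm_pairs s)) cat_uniq => /andP[]. Qed.

(** Independence of the fuel: the recursive call on [bigs] in [mi] runs with more fuel than its
    size, while [MergeInsertion] supplies exactly the size. *)
Lemma miE f (s : seq nat) : uniq s -> size s <= f ->
  mi f s = (sort leq s, (MergeInsertion s).2).
Proof.
have [n] := ubnP (size s); elim: n f s => // n IH f s sn us sf.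
case: (ltnP 1 (size s)) => s1; last first.
  have -> : mi f s = (s, 0) by case: (f) => //= f'; rewrite s1.
  have -> : (MergeInsertion s).2 = 0 by rewrite /MergeInsertion; case: (size s) => //= ?; rewrite s1.
  by case: (s) s1 => [|x [|]].
have ub := uniq_bigs us; have sb := size_bigs s.
have hn : size (bigs s) < n by lia.
case: f sf => [|f] sf; first by lia.
have E g : size (bigs s) <= g -> mi g.+1 s = (sort leq s, (size s)./2 + (MergeInsertion (bigs s)).2 + inscost s).
  by move=> hg; rewrite mi_rec // IH.
have s0 : 0 < size s by lia.
have EM : MergeInsertion s = mi (size s).-1.+1 s by rewrite (prednK s0).
rewrite EM !E //; lia.
Qed.

Lemma MergeInsertion_sort (s : seq nat) : uniq s -> (MergeInsertion s).1 = sort leq s.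
Proof. by move=> us; rewrite /MergeInsertion miE. Qed.

Lemma MergeInsertion_cost (s : seq nat) : uniq s -> 1 < size s ->
  (MergeInsertion s).2 = (size s)./2 + (MergeInsertion (bigs s)).2 + inscost s.
Proof.
move=> us s1; have ub := uniq_bigs us; have sb := size_bigs s.
have s0 : 0 < size s by lia.
have EM : MergeInsertion s = mi (size s).-1.+1 s by rewrite (prednK s0).
have hs : size (bigs s) <= (size s).-1 by lia.
by rewrite EM mi_rec // (miE ub hs).
Qed.

Lemma MergeInsertion_cost0 (s : seq nat) : size s <= 1 -> (MergeInsertion s).2 = 0.
Proof. by rewrite /MergeInsertion; move: {2}(size s) => [|n] //= ->. Qed.

(** * Worst-case cost of one insertion phase, with the saving of a truncated group *)

Section InsBound.
Variable s : seq nat.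
Hypothesis us : uniq s.
Let h := (size s)./2.
Let nb := uphalf (size s).

Definition bpos (nb j : nat) (s : seq nat) : nat := rank (bel s j) (base (done_before nb j) s).

Lemma size_done_before k j : 2 <= k < nb + 2 -> j \in fj_group nb k ->
  size (done_before nb j) = tJ k.-1 + minn (tJ k) nb - j.
Proof.
move=> k2 jk; rewrite /= size_takel ?(index_fj k2 jk) //.
exact: index_size.
Qed.

Lemma rank_base D a : rank a (base D s) <= rank a (asq s) + size D.
Proof. by rewrite /rank count_cat leq_add2l -(size_map (bel s) D) count_size. Qed.

Lemma rank_asq j : j < h -> rank (nth 0 (asq s) j) (asq s) = j.
Proof.
move=> jh; have sa : size (asq s) = h := size_asq s.
have ua : uniq (asq s) by rewrite sort_uniq uniq_bigs.
rewrite -index_rank ?mem_nth ?index_uniq ?sa //.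
exact: sort_sorted leq_total _.
Qed.

Lemma slots_le k j : 2 <= k < nb + 2 -> j \in fj_group nb k ->
  (if j <= h then rank (nth 0 (asq s) j.-1) (base (done_before nb j) s)
         else size (base (done_before nb j) s)).+1 <= 2 ^ k - (tJ k - nb).
Proof.
move=> k2 jk; have sd := size_done_before k2 jk.
have := jk; rewrite mem_fj_group => /andP[j1 j2].
have := tJS k.-1; rewrite prednK; last by lia.
move=> tk; have t0 := tJ_gt0 k.-1.
have H : (if j <= h then rank (nth 0 (asq s) j.-1) (base (done_before nb j) s)
         else size (base (done_before nb j) s)) <= j.-1 + size (done_before nb j).
  case: (leqP j h) => jh.
    by apply: leq_trans (rank_base _ _) _; rewrite rank_asq //; lia.
  rewrite size_cat size_map size_asq -/h leq_add2r; lia.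
rewrite sd in H; lia.
Qed.

Lemma insc_le k j : 2 <= k < nb + 2 -> j \in fj_group nb k ->
  insc (done_before nb j) s j + (bpos nb j s < tJ k - nb) <= k.
Proof.
move=> k2 jk; have H := slots_le k2 jk.
have tk : tJ k <= 2 ^ k by have := tJS k.-1; rewrite prednK; lia.
have H2 := leq_trans H (leq_subr _ _).
have := rcost_le (bpos nb j s) H2; rewrite /insc -/(bpos nb j s) -/h => H3.
apply: leq_trans (_ : (k - (bpos nb j s < tJ k - nb)) + (bpos nb j s < tJ k - nb) <= k); last by lia.
rewrite leq_add2r; apply: leq_trans H3 _; apply: leq_sub2l.
by case: (ltnP (bpos nb j s) (tJ k - nb)) => // hb; rewrite (_ : _ < _ = true) //; lia.
Qed.

(* An element of group k is inserted with at most k comparisons. *)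
Definition ins_bound (nb : nat) : nat := \sum_(k <- iota 2 nb) k * (minn (tJ k) nb - tJ k.-1).

Lemma inscost_le kk : 2 <= kk < nb + 2 ->
  inscost s + \sum_(j <- fj_group nb kk) (bpos nb j s < tJ kk - nb) <= ins_bound nb.
Proof.
move=> kk2; rewrite /inscost -/nb /fj_order big_flatten big_map /ins_bound.
(* The factor [(k == kk)] spreads the saving of the one group [kk] over the sum, so that all groups
   can be bounded uniformly. *)
have E k : k \in iota 2 nb ->
   \sum_(j <- rev (fj_group nb k)) insc (done_before nb j) s j
   + (k == kk) * \sum_(j <- fj_group nb kk) (bpos nb j s < tJ kk - nb)
   <= k * (minn (tJ k) nb - tJ k.-1).
  rewrite mem_iota => hk; have k2 : 2 <= k < nb + 2 by lia.
  rewrite (perm_big (fj_group nb k)); last by rewrite /= perm_rev.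
  have -> : (k == kk) * \sum_(j <- fj_group nb kk) (bpos nb j s < tJ kk - nb)
     = \sum_(j <- fj_group nb k) (k == kk) * (bpos nb j s < tJ k - nb).
    case: eqP => [->|_]; last by rewrite mul0n big1.
    by rewrite mul1n; apply: eq_bigr => j _; rewrite mul1n.
  rewrite -big_split /=.
  apply: (@leq_trans (\sum_(j <- fj_group nb k) k)).
    rewrite !big_seq; apply: leq_sum => j jk; apply: leq_trans (insc_le k2 jk).
    by rewrite leq_add2l; case: (k == kk); case: (_ < _).
  by rewrite big_const_seq count_predT size_iota iter_addn_0.
apply: leq_trans (_ : \sum_(k <- iota 2 nb) (\sum_(j <- rev (fj_group nb k)) insc (done_before nb j) s j
   + (k == kk) * \sum_(j <- fj_group nb kk) (bpos nb j s < tJ kk - nb)) <= _).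
  rewrite big_split /= leq_add2l -big_distrl /=.
  rewrite [X in X * _](bigD1_seq kk) /=; [|by rewrite mem_iota; lia|exact: iota_uniq].
  by rewrite eqxx mulnDl mul1n leq_addr.
by rewrite big_seq [X in _ <= X]big_seq; apply: leq_sum => k /E.
Qed.

End InsBound.

(** * Averaging over orderings; the larger elements of the pairs are again in uniformly random
    order *)

Lemma perm_map_inj (T : eqType) (g : T -> T) (G : seq T) :
  uniq G -> {in G, forall t, g t \in G} -> {in G &, injective g} ->
  perm_eq (map g G) G.
Proof.
move=> uG gG injg; have um : uniq (map g G) by rewrite map_inj_in_uniq.
have sub : {subset map g G <= G} by move=> x /mapP[t tG ->]; apply: gG.
by apply: uniq_perm => //; have [|] := uniq_min_size um sub; rewrite ?size_map.
Qed.

Lemma nth_iota_id (t : seq nat) : [seq nth 0 t i | i <- iota 0 (size t)] = t.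
Proof. by rewrite map_nth_iota0 ?take_size. Qed.

(** Rearranging positions by a fixed permutation is a bijection of the set of orderings. *)
Lemma sum_reindex (l e : seq nat) (F : seq nat -> nat) : perm_eq e (iota 0 (size l)) ->
  \sum_(t <- permutations l) F [seq nth 0 t i | i <- e] = \sum_(t <- permutations l) F t.
Proof.
move=> pe; rewrite -[LHS](big_map (fun t : seq nat => [seq nth 0 t i | i <- e]) predT F).
apply: perm_big; apply: perm_map_inj; first exact: permutations_uniq.
  move=> t; rewrite !mem_permutations => pt.
  apply: (perm_trans _ pt); rewrite -[X in perm_eq _ X]nth_iota_id; apply: perm_map.
  by rewrite -(perm_size pt) in pe.
move=> t t'; rewrite !mem_permutations => /perm_size st /perm_size st' /eq_in_map E.
apply: (@eq_from_nth _ 0); first by rewrite st st'.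
by move=> i; rewrite st => il; apply: E; rewrite (perm_mem pe) mem_iota.
Qed.

Lemma sum_perm_nth (v : seq nat) (F : seq nat -> nat) : uniq v ->
  \sum_(e <- permutations (iota 0 (size v))) F [seq nth 0 v i | i <- e]
  = \sum_(w <- permutations v) F w.
Proof.
move=> uv; rewrite -[LHS](big_map (fun e : seq nat => [seq nth 0 v i | i <- e]) predT F).
have um : uniq [seq [seq nth 0 v i | i <- e] | e <- permutations (iota 0 (size v))].
  rewrite map_inj_in_uniq ?permutations_uniq // => e e'; rewrite !mem_permutations => pe pe' E.
  have s1 := perm_size pe; have s2 := perm_size pe'.
  apply: (@eq_from_nth _ 0); first by rewrite s1 s2.
  rewrite s1 size_iota => i iv; have /(congr1 (nth 0 ^~ i)) := E.
  rewrite !(nth_map 0) ?s1 ?s2 ?size_iota // => /eqP.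
  have hb e0 : perm_eq e0 (iota 0 (size v)) -> nth 0 e0 i < size v.
    move=> p0; have : nth 0 e0 i \in e0 by rewrite mem_nth // (perm_size p0) size_iota.
    by rewrite (perm_mem p0) mem_iota.
  by rewrite nth_uniq ?hb // => /eqP.
have sub : {subset [seq [seq nth 0 v i | i <- e] | e <- permutations (iota 0 (size v))] <= permutations v}.
  move=> x /mapP[t]; rewrite !mem_permutations => pt ->.
  by rewrite -[X in perm_eq _ X]nth_iota_id; apply: perm_map.
apply: perm_big; apply: uniq_perm => //; first exact: permutations_uniq.
have [|//] := uniq_min_size um sub.
by rewrite size_map !size_permutations ?iota_uniq // size_iota.
Qed.

(** Permutation of positions that moves whole pairs according to [rho] and keeps an unpaired last
    position in place. *)
Definition pair_perm (n : nat) (rho : seq nat) :=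
  flatten [seq [:: i.*2; i.*2.+1] | i <- rho] ++ iota n./2.*2 (n - n./2.*2).

Lemma perm_pair_perm n rho : perm_eq rho (iota 0 n./2) -> perm_eq (pair_perm n rho) (iota 0 n).
Proof.
move=> pr; rewrite /pair_perm.
apply: (@perm_trans _ (flatten [seq [:: i.*2; i.*2.+1] | i <- iota 0 n./2] ++ iota n./2.*2 (n - n./2.*2))).
  by rewrite perm_cat2r; apply: perm_flatten; apply: perm_map.
have -> : flatten [seq [:: i.*2; i.*2.+1] | i <- iota 0 n./2] = iota 0 n./2.*2.
  elim: (n./2) => // m IH; rewrite doubleS -(addn2 m.*2) (iotaD 0 m.*2 2) -IH.
  by rewrite -(addn1 m) (iotaD 0 m 1) map_cat flatten_cat.
rewrite -iotaD; have -> // : n./2.*2 + (n - n./2.*2) = n by lia.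
Qed.

Lemma nth_bigs (s : seq nat) i : i < (size s)./2 ->
  nth 0 (bigs s) i = maxn (nth 0 s i.*2) (nth 0 s i.*2.+1).
Proof. by move=> ih; rewrite (nth_map 0) ?size_iota // nth_iota. Qed.

Lemma nth_smalls (s : seq nat) i : i < (size s)./2 ->
  nth 0 (smalls s) i = minn (nth 0 s i.*2) (nth 0 s i.*2.+1).
Proof. by move=> ih; rewrite (nth_map 0) ?size_iota // nth_iota. Qed.

Lemma bigs_pair_perm (t rho : seq nat) : {subset rho <= iota 0 (size t)./2} ->
  bigs [seq nth 0 t i | i <- pair_perm (size t) rho] = [seq nth 0 (bigs t) i | i <- rho].
Proof.
rewrite /pair_perm; elim: rho => [|r rho IH] sr /=.
  by rewrite /bigs size_map size_iota (_ : (_ - _)./2 = 0) //; lia.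
rewrite bigs_cons IH; last by move=> x xr; apply: sr; rewrite inE xr orbT.
rewrite nth_bigs //; by have := sr _ (mem_head r rho); rewrite mem_iota.
Qed.

(** Averaging also over all rearrangements of the pairs does not change the sum over orderings, and
    for a fixed ordering these rearrangements run through all orders of its larger elements. This is
    what allows the induction hypothesis to be applied to the recursive call. *)
Lemma sum_bigs (l : seq nat) (F : seq nat -> nat) : uniq l ->
  (size l)./2`! * \sum_(t <- permutations l) F (bigs t)
  = \sum_(t <- permutations l) \sum_(w <- permutations (bigs t)) F w.
Proof.
move=> ul; set h := (size l)./2.
have -> : h`! = size (permutations (iota 0 h)) by rewrite size_permutations ?iota_uniq // size_iota.
rewrite -sum1_size big_distrl /= .
transitivity (\sum_(rho <- permutations (iota 0 h)) \sum_(t <- permutations l)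
   F [seq nth 0 (bigs t) i | i <- rho]).
  rewrite [LHS]big_seq [RHS]big_seq; apply: eq_bigr => rho; rewrite mem_permutations => pr.
  rewrite mul1n -(@sum_reindex l (pair_perm (size l) rho) (F \o bigs)) /=; last exact: perm_pair_perm.
  rewrite [LHS]big_seq [RHS]big_seq; apply: eq_bigr => t; rewrite mem_permutations => pt.
  by rewrite -(perm_size pt) bigs_pair_perm // => x; rewrite (perm_mem pr) (perm_size pt).
rewrite exchange_big /= [LHS]big_seq [RHS]big_seq; apply: eq_bigr => t.
rewrite mem_permutations => pt; have ut : uniq t by rewrite (perm_uniq pt).
by rewrite -(sum_perm_nth _ (uniq_bigs ut)) size_bigs (perm_size pt).
Qed.

(** * Exchanging b_j with its predecessor: insertion positions have decreasing frequencies *)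

Definition swap (z y x : nat) := if x == z then y else if x == y then z else x.

Lemma swapK z y : involutive (swap z y).
Proof.
move=> x; rewrite /swap; case: (x =P z) => [->|xz].
  by case: (y =P z) => [->|]; rewrite ?eqxx.
by case: (x =P y) => [->|xy]; [rewrite eqxx | do 2 case: eqP => // _].
Qed.

Lemma swapC z y x : swap z y x = swap y z x.
Proof. by rewrite /swap; case: (x =P z) => [->|//]; case: (z =P y) => [->|]. Qed.

Section Naturality.
Variables (f : nat -> nat) (s : seq nat).
Hypotheses (us : uniq s) (fI : injective f).
Hypothesis fpair : forall q, q < (size s)./2 -> f (nth 0 (smalls s) q) < f (nth 0 (bigs s) q).
Hypothesis fbig : {in bigs s &, {homo f : x y / x <= y}}.

(** A relabelling that keeps the order inside every pair and the order among the larger elements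
    commutes with the whole pairing phase; it may change the relative order of the smaller
    elements. *)
Lemma bigs_map : bigs (map f s) = map f (bigs s).
Proof.
apply: (@eq_from_nth _ 0); rewrite !size_map ?size_iota ?size_map // => i ih.
rewrite [RHS](nth_map 0) ?size_bigs // !nth_bigs ?size_map //.
have := fpair ih; rewrite nth_bigs // nth_smalls //.
rewrite !(@nth_map _ 0 _ 0 f); try lia.
by case: (leqP (nth 0 s i.*2) (nth 0 s i.*2.+1)) => _; lia.
Qed.

Lemma smalls_map : smalls (map f s) = map f (smalls s).
Proof.
apply: (@eq_from_nth _ 0); rewrite !size_map ?size_iota ?size_map // => i ih.
rewrite [RHS](nth_map 0) ?size_smalls // !nth_smalls ?size_map //.
have := fpair ih; rewrite nth_bigs // nth_smalls //.
rewrite !(@nth_map _ 0 _ 0 f); try lia.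
by case: (leqP (nth 0 s i.*2) (nth 0 s i.*2.+1)) => _; lia.
Qed.

Lemma sort_map_homo (t : seq nat) : {in t &, {homo f : x y / x <= y}} ->
  sort leq (map f t) = map f (sort leq t).
Proof.
move=> ft; have -> : sort leq (map f t) = sort leq (map f (sort leq t)).
  by apply: eq_sort_perm; apply: perm_map; rewrite perm_sym perm_sort.
rewrite (sorted_sort leq_trans) // sorted_map.
apply: (@sub_in_sorted _ (mem t) leq); last exact: sort_sorted leq_total _.
  by move=> x y xt yt /=; apply: ft.
by apply/allP => x; rewrite mem_sort.
Qed.

Lemma asq_map : asq (map f s) = map f (asq s).
Proof. by rewrite /asq bigs_map sort_map_homo. Qed.

Lemma bsq_map : bsq (map f s) = map f (bsq s).
Proof.
rewrite /bsq map_cat asq_map bigs_map smalls_map -map_comp; congr (_ ++ _).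
  rewrite -map_comp; apply/eq_in_map => a; rewrite mem_sort => ab /=.
  by rewrite index_map // (nth_map 0) // size_smalls -size_bigs index_mem.
rewrite /leftover size_map; case: (s) => //= x r; case: (~~ _) => //=.
by rewrite last_map.
Qed.

Lemma bel_map j : 0 < j <= uphalf (size s) -> bel (map f s) j = f (bel s j).
Proof. by move=> jb; rewrite /bel bsq_map (nth_map 0) // size_bsq; lia. Qed.

Lemma base_map D : {subset D <= iota 1 (uphalf (size s))} -> base D (map f s) = map f (base D s).
Proof.
move=> sD; rewrite /base map_cat asq_map -map_comp; congr (_ ++ _).
by apply/eq_in_map => i /sD; rewrite mem_iota => ib; rewrite bel_map //; lia.
Qed.
End Naturality.

Section Monotone.
Variables (D : seq nat) (j : nat).
Let pos s := rank (bel s j) (base D s).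
Let chain s := sort leq (base D s).
Let shift p s := map (swap (nth 0 (chain s) p) (bel s j)) s.

(** The transposition of b_j with the chain element just below it preserves the order of the chain,
    since no chain element lies between the two, and keeps every pair in order. All comparisons
    before the insertion of b_j therefore come out the same, and only its position drops by one. *)
Lemma shift_spec s p : uniq s -> uniq D -> {subset D <= iota 1 (uphalf (size s))} ->
  j \in iota 1 (uphalf (size s)) -> j \notin D -> pos s = p.+1 ->
  [/\ pos (shift p s) = p, perm_eq (shift p s) s & shift p (shift p s) = s].
Proof.
move=> us uD sD jb jD pE.
set C := chain s; set y := bel s j; set z := nth 0 C p; set f := swap z y.
have uC : uniq C by rewrite sort_uniq uniq_base.
have sC : sorted leq C by apply: sort_sorted leq_total _.
have yC : y \notin C by rewrite mem_sort bel_notin_base.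
have rC : rank y C = p.+1 by rewrite rank_sort.
have pC : p < size C by rewrite -rC rank_size.
have zC : z \in C by apply: mem_nth.
have zy : z < y by rewrite nth_lt_rank // rC.
have ltC c : c \in C -> (c < y) = (c <= z).
  move=> cC; have iC : index c C < size C by rewrite index_mem.
  have := nth_lt_rank y sC iC; rewrite nth_index // rC => ->; rewrite ltnS.
  rewrite index_rank // -[p](index_uniq 0 pC uC) -/z index_rank //.
  apply/idP/idP => h; last exact: rank_mono.
  rewrite leqNgt; apply/negP => zc.
  have := nth_lt_rank c sC pC; rewrite -/z zc -{1}[p](index_uniq 0 pC uC) -/z index_rank //.
  lia.
have fI : injective f := inv_inj (@swapK z y).
have fz : f z = y by rewrite /f /swap eqxx.
have fy : f y = z by rewrite /f /swap eqxx; case: eqP => //.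
have fC c : c \in C -> c != z -> f c = c.
  by rewrite /f /swap => cC /negPf ->; case: eqP => // cy; move: cC; rewrite cy (negPf yC).
have fhomo : {in C &, {homo f : a b / a <= b}}.
  move=> a b aC bC; have := ltC b bC.
  have [->|az] := eqVneq a z; have [->|bz] := eqVneq b z => //; rewrite ?fz ?(fC a) ?(fC b) //; move: zy; try move: bz; clear; lia.
have bigC a : a \in bigs s -> a \in C by move=> ab; rewrite mem_sort mem_cat mem_sort ab.
(* A larger partner is in the chain and can only be raised. A smaller one is raised only if it is
   [z], and then its partner, being in the chain and above [z], is also above [y]. *)
have fpair q : q < (size s)./2 -> f (nth 0 (smalls s) q) < f (nth 0 (bigs s) q).
  move=> qh; have bC : nth 0 (bigs s) q \in C by apply/bigC/mem_nth; rewrite size_bigs.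
  have sb : nth 0 (smalls s) q < nth 0 (bigs s) q.
    rewrite nth_smalls // nth_bigs //.
    have : nth 0 s q.*2 != nth 0 s q.*2.+1 by rewrite nth_uniq //; clear - qh; lia.
    clear; lia.
  move: sb bC; move: (nth 0 (smalls s) q) (nth 0 (bigs s) q) => a b ab bC.
  have hb := ltC b bC; have hby : b != y by apply: contraNneq yC => <-.
  have bf : b <= f b by have [->|bz] := eqVneq b z; [rewrite fz ltnW | rewrite fC].
  have [ay|ay] := eqVneq a y.
    by rewrite ay fy fC //; [|apply/eqP]; move: zy ab; rewrite ay; clear; lia.
  have [az|az] := eqVneq a z.
    by rewrite az fz fC //; [|apply/eqP]; move: zy ab hb hby; rewrite az; clear; lia.
  by rewrite {1}/f /swap (negPf az) (negPf ay) (leq_trans ab).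
have fbig : {in bigs s &, {homo f : a b / a <= b}}.
  by move=> a b /bigC aC /bigC bC; apply: fhomo.
have fbase : {in base D s &, {homo f : a b / a <= b}}.
  by move=> a b aC bC; apply: fhomo; rewrite mem_sort.
have bE : base D (shift p s) = map f (base D s) by rewrite /shift base_map.
have jE : bel (shift p s) j = z.
  by rewrite /shift bel_map //; move: jb; rewrite mem_iota; clear; lia.
have cE : chain (shift p s) = map f C by rewrite /chain bE sort_map_homo.
split.
- rewrite /pos jE -rank_sort -/(chain _) cE /rank count_map.
  rewrite (eq_in_count (a2 := fun x => x < z)); last first.
    move=> c cC /=; have [->|cz] := eqVneq c z; last by rewrite fC.
    by rewrite fz ltnn ltnNge (ltnW zy).
  by rewrite -/(rank z C) -index_rank // index_uniq.
- apply: uniq_perm => //; first by rewrite map_inj_uniq.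
  suff fs x : x \in s -> f x \in s.
    move=> x; apply/mapP/idP => [[a /fs fa ->] //|xs]; exists (f x); first exact: fs.
    by rewrite /f swapK.
  have memS a : a \in asq s ++ bsq s -> a \in s by rewrite (perm_mem (perm_ab us)).
  have memC c : c \in C -> c \in s.
    rewrite mem_sort mem_cat => /orP[ca|/mapP[i /sD ib ->]]; apply: memS; rewrite mem_cat ?ca //.
    by rewrite -nth_bsq_bel map_f ?orbT.
  have ys : y \in s by apply: memS; rewrite mem_cat -nth_bsq_bel map_f ?orbT.
  by rewrite /f /swap; case: eqP => // _; case: eqP => // _ _; apply: memC.
(* After the exchange [y] sits at position [p] of the chain and [z] is b_j, so the second
   application performs the same transposition. *)
- rewrite {1}/shift jE cE (nth_map 0) // -/z fz /shift -map_comp -[RHS]map_id.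
  by apply: eq_map => x /=; rewrite swapC; exact: swapK.
Qed.

(* Exchanging b_j with its predecessor in the chain turns position p + 1 into position p. *)
Lemma count_pos_mono (l : seq nat) p : uniq l -> uniq D ->
  {subset D <= iota 1 (uphalf (size l))} -> j \in iota 1 (uphalf (size l)) -> j \notin D ->
  count (fun s => pos s == p.+1) (permutations l) <= count (fun s => pos s == p) (permutations l).
Proof.
move=> ul uD sD jb jD; rewrite -!size_filter.
have H s : s \in [seq s <- permutations l | pos s == p.+1] ->
  [/\ perm_eq s l, pos (shift p s) = p, perm_eq (shift p s) s & shift p (shift p s) = s].
  rewrite mem_filter mem_permutations => /andP[/eqP pE ps].
  have [] := @shift_spec s p; rewrite ?(perm_size ps) ?(perm_uniq ps) //.
rewrite -(size_map (shift p)); apply: uniq_leq_size.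
  rewrite map_inj_in_uniq ?filter_uniq ?permutations_uniq // => a b /H[_ _ _ Ea] /H[_ _ _ Eb] E.
  by rewrite -Ea E.
move=> x /mapP[s /H[ps p1 p2 _] ->].
by rewrite mem_filter p1 eqxx mem_permutations (perm_trans p2 ps).
Qed.

(** For a decreasing distribution on M positions, the first m carry at least the fraction m / M of
    the mass. *)
Lemma sum_pos_lt (l : seq nat) m M : uniq l -> uniq D ->
  {subset D <= iota 1 (uphalf (size l))} -> j \in iota 1 (uphalf (size l)) -> j \notin D ->
  {in permutations l, forall s, pos s < M} -> m <= M ->
  m * (size l)`! <= M * \sum_(s <- permutations l) (pos s < m).
Proof.
move=> ul uD sD jb jD posM mM.
set N := fun p => count (fun s => pos s == p) (permutations l).
have Nmono p q : p <= q -> N q <= N p.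
  move=> /subnK <-; elim: (q - p) => // k IH; apply: leq_trans IH.
  exact: count_pos_mono.
have sumN k : \sum_(s <- permutations l) (pos s < k) = \sum_(0 <= p < k) N p.
  rewrite /N; under [RHS]eq_bigr do rewrite -sum1_count big_mkcond.
  rewrite exchange_big /=; apply: eq_bigr => s _.
  rewrite -big_mkcond sum1_count /index_iota subn0.
  have : count_mem (pos s) (iota 0 k) = (pos s < k).
    by rewrite count_uniq_mem ?iota_uniq // mem_iota.
  by move=> <-; apply: eq_count => q /=; rewrite eq_sym.
have <- : \sum_(0 <= p < M) N p = (size l)`!.
  rewrite -sumN -size_permutations // -sum1_size [LHS]big_seq [RHS]big_seq.
  by apply: eq_bigr => s /posM ->.
rewrite sumN (@big_cat_nat _ _ _ m) //= mulnDr -{2}(subnKC mM) mulnDl leq_add2l.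
(* [N m] separates the two blocks: every later frequency is at most, every earlier one at least,
   this value. *)
apply: (@leq_trans (m * ((M - m) * N m))).
  rewrite leq_mul2l; apply/orP; right; rewrite -sum_nat_const_nat.
  by rewrite big_nat [X in _ <= X]big_nat; apply: leq_sum => p /andP[h _]; apply: Nmono.
rewrite mulnCA leq_mul2l; apply/orP; right; rewrite -[m in X in X <= _]subn0 -sum_nat_const_nat.
by rewrite big_nat [X in _ <= X]big_nat; apply: leq_sum => p /andP[_ h]; apply: Nmono; lia.
Qed.
End Monotone.

(** * Closed forms for the insertion bound and the worst case of MergeInsertion *)

Lemma tJ_mono a b : a <= b -> tJ a <= tJ b.
Proof.
move=> /subnK <-; elim: (b - a) => // k IH; apply: leq_trans IH _.
rewrite addSn; case: (k + a) => // m; exact/ltnW/tJ_lt.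
Qed.

Lemma ins_bound_partial q nb : tJ q.+1 <= nb ->
  3 * (\sum_(k <- iota 2 q) k * (minn (tJ k) nb - tJ k.-1)) + 2 ^ q.+3
  = 3 * q.+2 * tJ q.+1 + 1 + ~~ odd q.
Proof.
elim: q => [|q IH] tq; first by rewrite big_nil.
have -> : iota 2 q.+1 = iota 2 q ++ [:: q.+2] by rewrite -(addn1 q) iotaD add2n addn1.
have tq' : tJ q.+1 <= tJ q.+2 by exact/ltnW/tJ_lt.
have {}IH := IH (leq_trans tq' tq).
rewrite big_cat /= big_seq1 /= (minn_idPl tq).
have := tJ3 q.+2; rewrite /= negbK; move: IH.
rewrite [2 ^ q.+4]expnS; move: (\sum_(k <- _) _) (2 ^ q.+3) (tJ q.+2) (tJ q.+1) tq' => S P t t' tt.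
have -> : q.+2 * (t - t') = q.+2 * t - q.+2 * t' by rewrite mulnBr.
have : q.+2 * t' <= q.+2 * t by rewrite leq_mul2l tt orbT.
rewrite -!mulnA !mulSn; move: (q * t) (q * t') => u v.
by case: (odd q) => /=; lia.
Qed.

Lemma ins_bound_le k nb : 0 < k -> tJ k.-1 <= nb <= tJ k ->
  3 * ins_bound nb + 2 ^ k.+1 <= 3 * k * nb + 2.
Proof.
case: k => // -[_|k _] /andP[h1 h2].
  have -> : nb = 1 by move: h1 h2; rewrite tJ1 /=; have := tJ_gt0 0; lia.
  by rewrite /ins_bound /= big_cons big_nil.
have kn : k <= nb by apply: leq_trans h1; rewrite /=; exact: leq_trans (tJ_ge k) (tJ_mono (leqnSn k)).
have kn1 : k < nb by apply: leq_trans h1; exact: tJ_ge.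
have -> : ins_bound nb = \sum_(i <- iota 2 k) i * (minn (tJ i) nb - tJ i.-1) + k.+2 * (nb - tJ k.+1).
  rewrite /ins_bound; have -> : iota 2 nb = iota 2 k ++ k.+2 :: iota k.+3 (nb - k.+1).
    have {1}-> : nb = k + (nb - k.+1).+1 by lia.
    by rewrite iotaD add2n.
  rewrite big_cat big_cons /= (minn_idPr h2) [X in _ + (_ + X)]big1_seq ?addn0 // => i.
  rewrite mem_iota => /andP[_ /andP[hi _]].
  have := @tJ_mono k.+2 i.-1 ltac:(lia); case: i hi => // i hi.
  move=> /= ?; rewrite (_ : minn _ _ - _ = 0) ?muln0 //; lia.
have := ins_bound_partial h1; rewrite /= in h1.
have -> : k.+2 * (nb - tJ k.+1) = k.+2 * nb - k.+2 * tJ k.+1 by rewrite mulnBr.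
have : k.+2 * tJ k.+1 <= k.+2 * nb by rewrite leq_mul2l h1 orbT.
rewrite -!mulnA; case: (~~ odd k) => /=; lia.
Qed.

(** Rounding in the recursion may push [nb] slightly into the next group. The elements that spill
    over cost one comparison more each, which raises the constant from 2 to 2 + 6. *)
Lemma ins_bound_le_near k nb : 0 < k -> tJ k.-1 <= nb -> 3 * nb <= 2 ^ k.+1 + 6 ->
  3 * ins_bound nb + 2 ^ k.+1 <= 3 * k * nb + 8.
Proof.
move=> k0 h1 h2; case: (leqP nb (tJ k)) => h3.
  have h13 : tJ k.-1 <= nb <= tJ k by rewrite h1 h3.
  have := ins_bound_le k0 h13; lia.
have h : tJ k <= nb <= tJ k.+1.
  have := tJ3 k; have := tJ3 k.+1; have := tJ_lt k0.
  have : 1 < 2 ^ k by rewrite -{1}(expn0 2) ltn_exp2l.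
  rewrite /=; move: h2; rewrite [2 ^ k.+2]expnS [2 ^ k.+1]expnS.
  by case: (odd k) => /=; lia.
have := @ins_bound_le k.+1 nb isT h; rewrite [2 ^ k.+2]expnS -!mulnA mulSn; lia.
Qed.

Lemma inscost_le_bound (s : seq nat) : uniq s -> 1 < size s -> inscost s <= ins_bound (uphalf (size s)).
Proof.
move=> us s1; have := @inscost_le s us 2; rewrite (_ : 2 <= 2 < _); last by lia.
by move=> /(_ isT) h; apply: leq_trans h; rewrite leq_addr.
Qed.

(** Base of the inductions; for four elements two comparisons form the pairs, one compares the
    larger elements and two insert. *)
Lemma MergeInsertion_cost_small (s : seq nat) : uniq s -> size s <= 4 -> (MergeInsertion s).2 <= 5.
Proof.
have W1 : ins_bound 1 = 0 by rewrite /ins_bound big_cons big_nil.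
have W2 : ins_bound 2 = 2 by rewrite /ins_bound !big_cons big_nil.
have H2 (t : seq nat) : uniq t -> size t <= 2 -> (MergeInsertion t).2 <= 1.
  move=> ut t2; case: (leqP (size t) 1) => t1; first by rewrite MergeInsertion_cost0.
  have E : size t = 2 by lia.
  rewrite MergeInsertion_cost // MergeInsertion_cost0 ?size_bigs ?E //.
  by have := inscost_le_bound ut t1; rewrite E W1; lia.
move=> us s4; case: (leqP (size s) 1) => s1; first by rewrite MergeInsertion_cost0.
rewrite MergeInsertion_cost //; have := inscost_le_bound us s1.
have : ins_bound (uphalf (size s)) <= 2.
  have [->|->] : uphalf (size s) = 1 \/ uphalf (size s) = 2 by lia.
    by rewrite W1.
  by rewrite W2.
have := H2 _ (uniq_bigs us); rewrite size_bigs; lia.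
Qed.

(** The slack 9 survives halving, and rounding up leaves (9 + 3) / 2 = 6, as [ins_bound_le_near]
    requires. *)
Lemma nb_bounds n k : 2 ^ k.+1 <= n -> 3 * n <= 2 ^ k.+3 + 9 ->
  [/\ tJ k <= uphalf n, 3 * uphalf n <= 2 ^ k.+2 + 6, 2 ^ k <= n./2 & 3 * n./2 <= 2 ^ k.+2 + 9].
Proof.
rewrite [2 ^ k.+3]expnS => h1 h2; have := tJ3 k.
have k0 : 0 < 2 ^ k by rewrite expn_gt0.
have : 2 ^ k.+1 = 2 * 2 ^ k by rewrite expnS.
by case: (odd k) => /=; split; lia.
Qed.

(** Each level contributes the 8 of [ins_bound_le_near], and 19 = 3 * 5 + 4 is the base case. For a
    size near 2N/3 with N = 2^(k+1) the cost is then (k + 1) n - 4N/3 + O(k), the value at which the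
    potential is started. *)
Lemma MergeInsertion_worst k (s : seq nat) : uniq s ->
  2 ^ k <= size s -> 3 * size s <= 2 ^ k.+2 + 9 ->
  3 * (MergeInsertion s).2 + 2 ^ k.+2 <= 3 * k * size s + 8 * k + 19.
Proof.
elim: k s => [|k IH] s us h1 h2.
  have s4 : size s <= 4 by move: h2; rewrite /=; lia.
  have := MergeInsertion_cost_small us s4; rewrite expnS expn1; lia.
have [b1 b2 b3 b4] := nb_bounds h1 h2.
have s1 : 1 < size s by apply: leq_trans h1; rewrite -{1}(expn0 2) ltn_exp2l.
have := IH _ (uniq_bigs us); rewrite size_bigs => /(_ b3 b4).
have := @ins_bound_le_near k.+1 _ isT b1 b2; have := inscost_le_bound us s1.
rewrite (MergeInsertion_cost us s1) [2 ^ k.+3]expnS.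
have : size s = (size s)./2 + uphalf (size s) by lia.
move: (inscost s) (ins_bound _) => a b; move: (2 ^ k.+2) (MergeInsertion (bigs s)).2 ((size s)./2) (uphalf _) => c d e f.
by move=> -> i1 i2 i3; rewrite mulnDr -!mulnA !mulSn; nia.
Qed.

(** * Average cost of MergeInsertion for 0.638 <= p <= 2/3 *)

Lemma bpos_lt (s : seq nat) k j : uniq s -> 2 <= k < uphalf (size s) + 2 ->
  j \in fj_group (uphalf (size s)) k ->
  bpos (uphalf (size s)) j s < 2 ^ k - (tJ k - uphalf (size s)).
Proof.
move=> us k2 jk; apply: leq_trans (slots_le us k2 jk); rewrite ltnS /bpos.
case: (leqP j (size s)./2) => jh; last exact: rank_size.
apply/rank_mono/ltnW/bel_lt => //; move: jk; rewrite mem_fj_group jh; have := tJ_gt0 k.-1.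
by case: j {jh} => //; lia.
Qed.

(** Each of the nb - t_{k-1} elements of the truncated group has at most t_{k-1} + nb slots, of
    which t_k - nb are shallow, so by monotonicity it saves with probability at least (t_k - nb) /
    (t_{k-1} + nb). Both sides are multiplied by the denominator. *)
Lemma sum_inscost_le (l : seq nat) k : uniq l -> 2 <= k < uphalf (size l) + 2 ->
  tJ k.-1 <= uphalf (size l) <= tJ k ->
  (tJ k.-1 + uphalf (size l)) * \sum_(t <- permutations l) inscost t
    + (uphalf (size l) - tJ k.-1) * (tJ k - uphalf (size l)) * (size l)`!
  <= (tJ k.-1 + uphalf (size l)) * ((size l)`! * ins_bound (uphalf (size l))).
Proof.
move=> ul k2; set nb := uphalf (size l) => /andP[h1 h2].
have tk := tJS k.-1; rewrite prednK in tk; last by lia.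
have MM : tJ k.-1 + nb = 2 ^ k - (tJ k - nb) by lia.
have H : \sum_(t <- permutations l) (inscost t + \sum_(j <- fj_group nb k) (bpos nb j t < tJ k - nb))
   <= (size l)`! * ins_bound nb.
  rewrite -size_permutations // -sum1_size big_distrl /= big_seq [X in _ <= X]big_seq.
  apply: leq_sum => t; rewrite mem_permutations mul1n => pt.
  by rewrite /nb -(perm_size pt); apply: inscost_le; rewrite ?(perm_uniq pt) ?(perm_size pt).
apply: leq_trans (_ : (tJ k.-1 + nb) *
   \sum_(t <- permutations l) (inscost t + \sum_(j <- fj_group nb k) (bpos nb j t < tJ k - nb)) <= _);
  last by rewrite leq_mul2l H orbT.
rewrite big_split /= mulnDr leq_add2l exchange_big /= big_distrr /=.
have -> : (nb - tJ k.-1) * (tJ k - nb) * (size l)`! = \sum_(j <- fj_group nb k) (tJ k - nb) * (size l)`!.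
  rewrite big_const_seq count_predT size_iota iter_addn_0 (minn_idPr h2).
  by rewrite -mulnA mulnC.
rewrite big_seq [X in _ <= X]big_seq; apply: leq_sum => j jk.
rewrite MM; have := jk; rewrite mem_fj_group (minn_idPr h2) => /andP[j1 j2].
have inL x : x \in fj_order nb -> 1 < x <= nb by rewrite mem_fj.
have jnb : j \in iota 1 nb by rewrite mem_iota; lia.
have j_fj : j \in fj_order nb by rewrite mem_fj j2 andbT; have := tJ_gt0 k.-1; lia.
apply: (@sum_pos_lt (done_before nb j) j l) => //.
- rewrite /= take_uniq ?fj_uniq // andbT; apply/negP => /mem_take /inL; lia.
- move=> x; rewrite inE => /orP[/eqP->|/mem_take /inL]; rewrite mem_iota; lia.
- rewrite inE negb_or; apply/andP; split; first by have := inL _ j_fj; lia.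
  by rewrite in_take_leq ?index_size // ltnn.
- move=> t; rewrite mem_permutations => pt; have st := perm_size pt.
  by have := @bpos_lt t k j; rewrite st (perm_uniq pt); apply.
- have := tJ3 k.-1; have := tJ_gt0 k.-1; rewrite -MM prednK; last by lia.
  by case: (odd _) => /=; lia.
Qed.

Section Avg.
Variable R : realFieldType.
Local Open Scope ring_scope.

(* (b - t')/(b + t') at b = 0.638 N, t' = N/3. *)
Definition saving_rate : R := 457%:R / 1457%:R.

(** The ratio (b - t') / (b + t') grows with b, so on this range it is at least its value at the
    left end, up to rounding. The saving is thereby bounded by a function linear in b, which can be
    added over the levels of the recursion. *)
Lemma saving_ineq (t' t b N : R) : t + t' = N -> 3%:R * t' <= N + 1 -> t <= 2%:R * t' + 1 ->
  1 <= t' -> t' <= b <= t ->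
  638%:R / 1000%:R * N - 1 <= b ->
  (t' + b) * (saving_rate * (t - b) - 2%:R) <= (b - t') * (t - b).
Proof.
rewrite /saving_rate => tN h1 h2 t1 /andP[tb bt] hb.
have h : saving_rate * (t' + b) - (b - t') <= 2%:R by rewrite /saving_rate; lra.
have : (t - b) * (saving_rate * (t' + b) - (b - t')) <= (t - b) * 2%:R by rewrite ler_wpM2l // subr_ge0.
rewrite /saving_rate; nra.
Qed.

Lemma sum_inscost_avg (l : seq nat) k : uniq l -> (1 < size l)%N ->
  (2 ^ k.+1 <= size l)%N -> (3 * size l <= 2 ^ k.+3 + 9)%N ->
  638%:R / 1000%:R * (2 ^ k.+2)%:R - 2%:R <= (size l)%:R :> R ->
  (\sum_(t <- permutations l) inscost t)%:R <=
   (size l)`!%:R * (k.+1%:R * (uphalf (size l))%:R - (2 ^ k.+2)%:R / 3%:R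
    - saving_rate * ((2 ^ k.+2)%:R / 3%:R - (uphalf (size l))%:R) + 17%:R / 3%:R) :> R.
Proof.
move=> ul l1 h1 h2 h3; have [b1 b2 b3 b4] := nb_bounds h1 h2.
have := @ins_bound_le_near k.+1 _ isT b1 b2; set nb := uphalf (size l) => W.
have {}W : (ins_bound nb)%:R <= k.+1%:R * nb%:R - (2 ^ k.+2)%:R / 3%:R + 8%:R / 3%:R :> R.
  have : 3%:R * (ins_bound nb)%:R + (2 ^ k.+2)%:R <= 3%:R * k.+1%:R * nb%:R + 8%:R :> R.
    by rewrite -!natrM -!natrD ler_nat.
  move: (ins_bound nb)%:R nb%:R k.+1%:R (2 ^ k.+2)%:R => a b c d; lra.
have F0 : 0 < (size l)`!%:R :> R by rewrite ltr0n fact_gt0.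
have triv : (\sum_(t <- permutations l) inscost t)%:R <= (size l)`!%:R * (ins_bound nb)%:R :> R.
  rewrite -natrM ler_nat -size_permutations // -sum1_size big_distrl /= big_seq [X in (_ <= X)%N]big_seq.
  apply: leq_sum => t; rewrite mem_permutations mul1n /nb => pt.
  by rewrite -(perm_size pt); apply: inscost_le_bound; rewrite ?(perm_uniq pt) ?(perm_size pt).
have hn : (size l)%:R <= 2%:R * nb%:R :> R by rewrite -natrM ler_nat /nb; clear; lia.
(* If [nb] has almost reached 2^(k+2) / 3, the claimed saving is below 1 and disappears in the
   surplus 17/3 - 8/3; otherwise the last group is truncated and the exchange argument applies. *)
have [small|[k0 tb]] : (2 ^ k.+2 <= 3 * nb + 7)%N \/ (0 < k)%N /\ (nb <= tJ k.+1)%N.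
  have := tJ3 k.+1; case: (k) => [|k'].
    by left; rewrite /=; clear; lia.
  case: (leqP nb (tJ k'.+2)) => h t; [by right | left].
  by move: t h; clear; case: (odd _) => /=; lia.
  apply: le_trans triv _; rewrite ler_pM2l //.
  have : (2 ^ k.+2)%:R <= 3%:R * nb%:R + 7%:R :> R by rewrite -natrM -natrD ler_nat.
  by move: W; rewrite /saving_rate; lra.
have M0 : 0 < (tJ k + nb)%:R :> R by rewrite ltr0n; have := tJ_gt0 k; clear; lia.
have k2 : (2 <= k.+1 < nb + 2)%N by have := tJ_ge k; move: b1 k0; clear; lia.
have kb : (tJ k.+1.-1 <= nb <= tJ k.+1)%N by rewrite /= b1 tb.
have := sum_inscost_le ul k2 kb; rewrite /= -/nb => S.
have {}S : (tJ k + nb)%:R * (\sum_(t <- permutations l) inscost t)%:R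
   + (nb%:R - (tJ k)%:R) * ((tJ k.+1)%:R - nb%:R) * (size l)`!%:R
   <= (tJ k + nb)%:R * ((size l)`!%:R * (ins_bound nb)%:R) :> R.
  by rewrite -!natrB // -!natrM -natrD ler_nat.
rewrite -(ler_pM2l M0).
have I : ((tJ k)%:R + nb%:R) * (saving_rate * ((tJ k.+1)%:R - nb%:R) - 2%:R) <= (nb%:R - (tJ k)%:R) * ((tJ k.+1)%:R - nb%:R) :> R.
  have tt := tJ3 k; have tt' := tJ3 k.+1.
  apply: (@saving_ineq _ _ _ (2 ^ k.+1)%:R).
  - by rewrite -natrD addnC tJS.
  - by rewrite -natrM (natr1 (2 ^ k.+1)%N) ler_nat; move: tt; clear; case: (odd k); lia.
  - rewrite -natrM natr1 ler_nat; move: tt tt'; clear; rewrite /= [(2 ^ k.+2)%N]expnS.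
    by case: (odd k) => /=; lia.
  - by rewrite ler1n tJ_gt0.
  - by rewrite !ler_nat b1 tb.
  - by move: h3 hn; rewrite [(2 ^ k.+2)%N]expnS natrM; lra.
have t1 : (2 ^ k.+2)%:R / 3%:R - 1 / 3%:R <= (tJ k.+1)%:R :> R.
  have : (2 ^ k.+2)%:R <= 3%:R * (tJ k.+1)%:R + 1%:R :> R.
    rewrite -natrM -natrD ler_nat; have := tJ3 k.+1; clear; case: (odd _); lia.
  lra.
move: S I W t1 M0 F0; rewrite !(natrD _ (tJ k) nb).
move: (\sum_(t <- _) _)%:R ((size l)`!%:R) (tJ k)%:R (tJ k.+1)%:R nb%:R (ins_bound nb)%:R (2 ^ k.+2)%:R => S F t' t b w P.
move=> iS iI iW it M0 F0.
have : (t' + b) * F * w <= (t' + b) * F * (k.+1%:R * b - P / 3%:R + 8%:R / 3%:R) by rewrite ler_pM2l // mulr_gt0.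
have : F * ((t' + b) * (saving_rate * (t - b) - 2%:R)) <= F * ((b - t') * (t - b)) by rewrite ler_pM2l.
have : (t' + b) * F * (saving_rate * (P / 3%:R - 1 / 3%:R)) <= (t' + b) * F * (saving_rate * t).
  by rewrite ler_pM2l ?mulr_gt0 // /saving_rate; lra.
have : 0 <= (t' + b) * F by rewrite ltW // mulr_gt0.
rewrite /saving_rate; nra.
Qed.
End Avg.

Section AvgMI.
Variable R : realFieldType.
Local Open Scope ring_scope.

Lemma sum_permutations_le (l : seq nat) (F : seq nat -> nat) (B : R) : uniq l ->
  (forall t, perm_eq t l -> (F t)%:R <= B) ->
  (\sum_(t <- permutations l) F t)%:R <= (size l)`!%:R * B.
Proof.
move=> ul H; rewrite natr_sum -size_permutations // -sum1_size natr_sum mulr_suml.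
rewrite big_seq [leRHS]big_seq; apply: ler_sum => t; rewrite mem_permutations => /H.
by rewrite mul1r.
Qed.

(** All levels of the recursion have nearly the same ratio to a power of two, so the same rate of
    saving applies at each; the slack 2 in the lower bound on the size survives halving. A level
    adds the constant 17/3, rounded up to 6. *)
Lemma MergeInsertion_avg k (l : seq nat) : uniq l ->
  (2 ^ k <= size l)%N -> (3 * size l <= 2 ^ k.+2 + 9)%N ->
  638%:R / 1000%:R * (2 ^ k.+1)%:R - 2%:R <= (size l)%:R :> R ->
  (\sum_(t <- permutations l) (MergeInsertion t).2)%:R <=
   (size l)`!%:R * (k%:R * (size l)%:R - (2 ^ k.+2)%:R / 3%:R
    - saving_rate R * ((2 ^ k.+2)%:R / 3%:R - (size l)%:R) + 6%:R * k%:R + 7%:R) :> R.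
Proof.
elim: k l => [|k IH] l ul h1 h2 h3.
  apply: sum_permutations_le => // t pt.
  have ut : uniq t by rewrite (perm_uniq pt).
  have s4 : (size t <= 4)%N by rewrite (perm_size pt); move: h2; clear; rewrite /=; lia.
  have := MergeInsertion_cost_small ut s4; rewrite -(ler_nat R) => /le_trans; apply.
  have : 0 <= (size l)%:R :> R by [].
  by rewrite /saving_rate expnS expn1; lra.
have [b1 b2 b3 b4] := nb_bounds h1 h2.
have l1 : (1 < size l)%N by apply: leq_trans h1; rewrite -{1}(expn0 2) ltn_exp2l.
set n := size l in h1 h2 h3 b1 b2 b3 b4 l1 *; set m := n./2 in b3 b4; set nb := uphalf n in b1 b2.
have nE : n%:R = m%:R + nb%:R :> R by rewrite -natrD /m /nb; congr (_%:R); clear; lia.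
have hm : n%:R <= 2%:R * m%:R + 1 :> R by rewrite -natrM natr1 ler_nat /m; clear; lia.
have P2 : (2 ^ k.+2)%:R = 2%:R * (2 ^ k.+1)%:R :> R by rewrite -natrM expnS.
have P3 : (2 ^ k.+3)%:R = 2%:R * (2 ^ k.+2)%:R :> R by rewrite -natrM expnS.
set B := k%:R * m%:R - (2 ^ k.+2)%:R / 3%:R
    - saving_rate R * ((2 ^ k.+2)%:R / 3%:R - m%:R) + 6%:R * k%:R + 7%:R.
have Sb : (\sum_(t <- permutations l) (MergeInsertion (bigs t)).2)%:R <= n`!%:R * B :> R.
  have m0 : 0 < m`!%:R :> R by rewrite ltr0n fact_gt0.
  have sum_b := @sum_bigs l (fun t => (MergeInsertion t).2) ul.
  rewrite -(ler_pM2l m0) -natrM sum_b natr_sum mulrCA.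
  rewrite -size_permutations // -sum1_size natr_sum mulr_suml big_seq [leRHS]big_seq.
  apply: ler_sum => t; rewrite mem_permutations mul1r => pt.
  have ut : uniq t by rewrite (perm_uniq pt).
  have := IH _ (uniq_bigs ut); rewrite size_bigs (perm_size pt) -/n -/m => /(_ b3 b4).
  apply; move: h3 hm; rewrite P2; lra.
have Si := sum_inscost_avg ul l1 h1 h2 h3; rewrite -/n -/nb in Si.
have -> : \sum_(t <- permutations l) (MergeInsertion t).2
  = (n`! * m + \sum_(t <- permutations l) (MergeInsertion (bigs t)).2 + \sum_(t <- permutations l) inscost t)%N.
  rewrite -size_permutations // -sum1_size big_distrl -!big_split /= [LHS]big_seq [RHS]big_seq.
  apply: eq_bigr => t; rewrite mem_permutations mul1n => pt.
  by rewrite MergeInsertion_cost ?(perm_uniq pt) ?(perm_size pt).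
rewrite natrD (natrD _ (n`! * m)) natrM.
have -> : n`!%:R * (k.+1%:R * n%:R - (2 ^ k.+3)%:R / 3%:R - saving_rate R * ((2 ^ k.+3)%:R / 3%:R - n%:R) + 6%:R * k.+1%:R + 7%:R)
  = n`!%:R * m%:R + n`!%:R * B + n`!%:R * (k.+1%:R * nb%:R - (2 ^ k.+2)%:R / 3%:R -
        saving_rate R * ((2 ^ k.+2)%:R / 3%:R - nb%:R) + 17%:R / 3%:R) + n`!%:R * (1 / 3%:R).
  by rewrite nE P3 /B -natr1; field.
have : 0 <= n`!%:R * (1 / 3%:R) :> R by apply: mulr_ge0; rewrite ?ler0n ?divr_ge0 ?ler0n ?ler01.
lra.
Qed.
End AvgMI.

(** * Correctness of 2Merge and its cost in terms of ranks *)

Section TwoMerge.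
Variable R : realType.

Lemma pp_gt (i : nat) : 1 < i -> (1 / 2%:R < pp R i)%R.
Proof.
move=> i1; rewrite /pp ltr_pdivlMr ?ltr0n ?expn_gt0 // mul1r.
rewrite mulrC ltr_pdivrMr ?ltr0n // -natrM ltr_nat.
have /andP[+ _] := clg_bounds i1.
have : 0 < clg i by rewrite up_log_gt0.
by case: (clg i) => //= k _; rewrite expnS; lia.
Qed.

Lemma pp_le1 (i : nat) : (pp R i <= 1)%R.
Proof.
by rewrite /pp ler_pdivrMr ?ltr0n ?expn_gt0 // mul1r ler_nat leq_clg.
Qed.

(** Ensures that probe positions, which count from 1, are never 0; position 0 is reserved for the
    start before the first probe. *)
Lemma alpha_gt0 r (p : R) : 0 < r -> (1 / 2%:R < p)%R -> (0 < alpha r p)%R.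
Proof.
move=> r0 hp; rewrite /alpha.
have pow k : 0 < k -> (((2 ^ k)%N%:R)^-1 <= 1 / 2%:R :> R)%R.
  case: k => // k _; rewrite expnS natrM invfM mul1r ler_piMr ?invr_ge0 ?ler0n //.
  by rewrite invf_le1 ?ltr0n ?expn_gt0 // ler1n expn_gt0.
have posq k : (0 < ((2 ^ k)%N%:R)^-1 :> R)%R by rewrite invr_gt0 ltr0n expn_gt0.
case: ifP => ro.
  have [k ->] : exists k, (r.+1)./2 = k.+1 by exists r.-1./2; case: r r0 ro => // r _ /=; rewrite negbK; lia.
  case: ifP => h; rewrite /=.
    have : (((2 ^ k)%N%:R)^-1 <= 1 :> R)%R by rewrite invf_le1 ?ltr0n ?expn_gt0 // ler1n expn_gt0.
    have : (0 < (p * (2 ^ k.+2)%N%:R)^-1)%R by rewrite invr_gt0 mulr_gt0 ?ltr0n ?expn_gt0 //; lra.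
    by lra.
  have := pow k.+1 isT; have -> : ((p * (2 ^ k.+3)%N%:R)^-1 = (p * 4%:R)^-1 * ((2 ^ k.+1)%N%:R)^-1)%R.
    by rewrite -invfM -mulrA -natrM -(expnD 2 2) add2n.
  have : ((p * 4%:R)^-1 < 1 / 2%:R)%R.
    rewrite mul1r ltf_pV2 ?posrE ?ltr0n //; lra.
  have := posq k.+1; move: (_^-1)%R (_^-1)%R => x y; nra.
have : 0 < r./2 by case: r r0 ro => [|[|r]].
by move/pow; lra.
Qed.

Lemma apos_gt0 r i : 0 < r -> 1 < i -> 0 < apos R r i.
Proof.
move=> r0 i1; rewrite /apos ifN; last by rewrite -lt0n.
have h : (0 < Num.ceil (alpha r (pp R i) * i%:R))%R.
  by rewrite ceil_gt0 mulr_gt0 ?alpha_gt0 ?pp_gt ?ltr0n //; lia.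
by rewrite absz_gt0 gt_eqF.
Qed.

Definition rfind (i g : nat) : nat :=
  (find (fun r => g < apos R r i) (iota 1 i.*2.+2)).+1.

(* Comparisons spent on A by 2Merge when exactly [g] elements of T lie below A. *)
Definition depthA (i g : nat) : nat :=
  let r := rfind i g in
  r - (i - 2 < apos R r i)
  + rcost (minn (apos R r i) i.-1 - apos R r.-1 i) (g - apos R r.-1 i).

(** T has i - 2 elements, so a probe at i - 1 or later acts as infinity; [i.*2.+2] is the fuel that
    [two_merge] gives to [search]. *)
Definition terminates (i : nat) := exists2 r, r <= i.*2.+2 & 0 < r /\ i.-1 <= apos R r i.

Lemma rfindP i g : terminates i -> g <= i - 2 -> 1 < i ->
  [/\ 0 < rfind i g, rfind i g <= i.*2.+2, g < apos R (rfind i g) i &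
      forall q, 0 < q < rfind i g -> apos R q i <= g].
Proof.
move=> [r ri [r0 hr]] gi i1.
have H : has (fun r => g < apos R r i) (iota 1 i.*2.+2).
  by apply/hasP; exists r; rewrite ?mem_iota; lia.
have := H; rewrite has_find size_iota => Hf; rewrite /rfind; split=> //.
  by have := nth_find 0 H; rewrite nth_iota // add1n.
move=> q /andP[q0 qr]; have qf : q.-1 < find (fun r => g < apos R r i) (iota 1 i.*2.+2) by lia.
by have /negbT := before_find 0 qf; rewrite nth_iota ?add1n ?prednK //; lia.
Qed.

Lemma searchE f r r0 i A (T : seq nat) : sorted leq T -> A \notin T -> (size T).+2 = i ->
  0 < r0 <= r -> r - r0 < f -> rank A T < apos R r i ->
  (forall q, r0 <= q < r -> apos R q i <= rank A T) ->
  search R f r0 i A T = (r, r - r0 + (apos R r i <= size T)).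
Proof.
move=> srt AT si; elim: f r0 => // f IH r0 /andP[r00 r0r] rf gr hq /=.
have i1 : 1 < i by lia.
have a0 := apos_gt0 r00 i1.
have lt_rank : apos R r0 i <= size T ->
   (A < nth 0 T (apos R r0 i).-1) = (rank A T < apos R r0 i).
  move=> aT; have jT : (apos R r0 i).-1 < size T by lia.
  have := nth_lt_rank A srt jT.
  have : nth 0 T (apos R r0 i).-1 != A by apply: contraNneq AT => <-; apply: mem_nth.
  lia.
have rs := rank_size A T.
case: (ltnP (size T) (apos R r0 i)) => h1.
  have E : r0 = r by apply/eqP; case: ltngtP r0r => // h _; have := hq r0; rewrite leqnn h => /(_ isT); lia.
  by subst r0; rewrite subnn leqNgt h1.
rewrite lt_rank //; case: (ltnP (rank A T) (apos R r0 i)) => h2.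
  have E : r0 = r by apply/eqP; case: ltngtP r0r => // h _; have := hq r0; rewrite leqnn h => /(_ isT); lia.
  by subst r0; rewrite subnn h1.
have r0r' : r0 < r by rewrite ltn_neqAle r0r andbT; apply: contraTneq gr => <-; lia.
rewrite (IH r0.+1) //; [|lia|by move=> q hh; apply: hq; lia].
by congr (_, _); lia.
Qed.

Lemma two_mergeE a b (T : seq nat) : sorted leq T -> uniq (a :: b :: T) ->
  terminates (size T).+2 ->
  two_merge R a b T = (sort leq (a :: b :: T),
    1 + depthA (size T).+2 (rank (minn a b) T)
      + rcost ((size T).+1 - rank (minn a b) T) (rank (maxn a b) T - rank (minn a b) T)).
Proof.
move=> srt uT tm.
have -> : sort leq (a :: b :: T) = sort leq (maxn a b :: minn a b :: T).
  apply: eq_sort_perm; case: (leqP a b) => // _.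
  by rewrite -(cat1s a) -(cat1s b) perm_catCA.
have uT' : uniq (maxn a b :: minn a b :: T).
  move: uT; case: (leqP a b) => _ //=; rewrite !inE !negb_or eq_sym.
  by case/and3P => /andP[-> ->] -> ->.
have AB : minn a b < maxn a b by move: uT; rewrite /= !inE !negb_or => /andP[/andP[+ _] _]; lia.
cbv beta delta [two_merge] zeta; move: (minn a b) (maxn a b) AB uT' => A B AB uT'.
set i := (size T).+2 in tm *.
have [BT AT] : B \notin T /\ A \notin T.
  by move: uT'; rewrite /= !inE !negb_or => /and3P[/andP[_ ->] -> _].
set g := rank A T; have gs : g <= size T := rank_size A T.
have [r0 ri gr hq] := @rfindP i g tm ltac:(rewrite /i; lia) isT.
set r := rfind i g in r0 ri gr hq.
have -> := @searchE i.*2.+2 r 1 i A T srt AT erefl ltac:(lia) ltac:(lia) gr ltac:(by move=> q hh; apply: hq; lia).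
set lo := apos R r.-1 i.
have log : lo <= g.
  case E : r.-1 => [|r']; first by rewrite /lo E.
  by rewrite /lo E; apply: hq; lia.
set hi := minn _ _.
have hig : g < hi by rewrite /hi; lia.
have hiT : hi.-1 <= size T by rewrite /hi; lia.
have sA : sorted leq (drop lo (take hi.-1 T)) by apply/drop_sorted/take_sorted.
rewrite RHBSE //; last by apply: contra AT => /mem_drop /mem_take.
have -> : rank A (drop lo (take hi.-1 T)) = g - lo.
  by rewrite rank_drop ?take_sorted // rank_take //; rewrite -/g; lia.
rewrite subnKC // size_drop size_takel //.
rewrite RHBSE ?drop_sorted //; last by apply: contra BT => /mem_drop.
have gB : g <= rank B T by apply/rank_mono/ltnW.
rewrite rank_drop // size_drop.
have -> : take g T ++ A :: drop g T = sort leq (A :: T) by apply: sort_cons_rank.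
have -> : g.+1 + (rank B T - g) = rank B (sort leq (A :: T)).
  rewrite rank_sort (_ : rank B (A :: T) = (rank B T).+1); last by rewrite /rank /= AB.
  by rewrite addSn subnKC.
congr (_, _).
  rewrite sort_cons_rank; last exact: sort_sorted leq_total _.
  by apply: eq_sort_perm; rewrite perm_cons perm_sort.
have E1 : r - (i - 2 < apos R r i) = r - 1 + (apos R r i <= size T).
  have -> : i - 2 = size T by rewrite /i; lia.
  by case: (leqP (apos R r i) (size T)) => h; lia.
rewrite /depthA -/r -/lo (_ : minn (apos R r i) i.-1 = hi) // E1.
have -> : (hi.-1 - lo).+1 = hi - lo by lia.
have -> : (size T - g).+1 = (size T).+1 - g by lia.
by rewrite !addnA.
Qed.

End TwoMerge.

(** * The combined algorithm as a sum of step costs depending on relative ranks *)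

Section Combined.
Variable R : realType.

Lemma leq_absz_ceil (m : nat) (x : R) : (m%:R <= x)%R -> m <= `|Num.ceil x|%N.
Proof.
move=> h; have : (m%:R <= (Num.ceil x)%:~R :> R)%R by apply: le_trans h (ceil_ge _).
rewrite -[(m%:R)%R]/((m%:Z)%:~R)%R ler_int; lia.
Qed.

(** The even probe number 2K, with K = [clg i], is far enough to the right because i / 2^K <= 1. *)
Lemma terminatesP i : 1 < i -> terminates R i.
Proof.
move=> i1; exists (clg i).*2.
  have : clg i <= i by apply/clg_min/ltnW/ltn_expl.
  lia.
have K0 : 0 < clg i by rewrite up_log_gt0.
split; first by lia.
rewrite /apos ifN; last by lia.
apply: leq_absz_ceil; rewrite /alpha odd_double doubleK mulrBl mul1r.
have -> : (i.-1%:R = i%:R - 1 :> R)%R by rewrite -subn1 natrB // ltnW.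
rewrite lerB // mulrC ler_pdivrMr ?ltr0n ?expn_gt0 // mul1r ler_nat; exact: leq_clg.
Qed.

(** The ranks are taken among all i elements, so the larger one also counts the smaller element of
    the pair; the predecessor removes it. *)
Definition two_merge_cost (i rx ry : nat) : nat :=
  1 + depthA R i (minn rx ry)
  + rcost (i.-1 - minn rx ry) ((maxn rx ry).-1 - minn rx ry).

Definition step_cost (s : seq nat) (i : nat) : nat :=
  if in_2merge_range (pp R i)
  then two_merge_cost i (rank (nth 0 s i.-2) (take i s)) (rank (nth 0 s i.-1) (take i s))
  else rcost i.-1 (rank (nth 0 s i.-2) (take i.-1 s)) + rcost i (rank (nth 0 s i.-1) (take i s)).

Definition cstep (s : seq nat) (n' : nat) (st : seq nat * nat) (t : nat) : seq nat * nat :=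
  let: (C, c) := st in
      let i := n' + t.*2 in
      let x := nth 0 s i.-2 in
      let y := nth 0 s i.-1 in
      if in_2merge_range (pp R i) then
        let: (C', c') := two_merge R x y C in (C', c + c')
      else
        let: (C1, c1) := ins x C in
        let: (C2, c2) := ins y C1 in (C2, c + c1 + c2).

Lemma take2 (s : seq nat) i : 1 < i -> i <= size s ->
  take i.-1 s = rcons (take i.-2 s) (nth 0 s i.-2) /\
  take i s = rcons (rcons (take i.-2 s) (nth 0 s i.-2)) (nth 0 s i.-1).
Proof.
move=> i1 si; have E j : 0 < j <= size s -> take j s = rcons (take j.-1 s) (nth 0 s j.-1).
  by case: j => // j /andP[_ js]; rewrite (take_nth 0).
have E1 : take i.-1 s = rcons (take i.-2 s) (nth 0 s i.-2) by apply: E; clear - i1 si; lia.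
by split=> //; rewrite -E1; apply: E; clear - i1 si; lia.
Qed.

Lemma cstepE (s : seq nat) n' t c : uniq s -> 0 < t -> n' + t.*2 <= size s ->
  cstep s n' (sort leq (take (n' + t.*2).-2 s), c) t
  = (sort leq (take (n' + t.*2) s), c + step_cost s (n' + t.*2)).
Proof.
move=> us t0 si; rewrite /cstep /step_cost; set i := n' + t.*2 in si *.
have i1 : 1 < i by rewrite /i; lia.
have [E1 E2] := take2 i1 si.
set x := nth 0 s i.-2 in E1 E2 *; set y := nth 0 s i.-1 in E2 *.
have : uniq (take i s) by rewrite take_uniq.
rewrite E1 E2; set T := take i.-2 s => uT.
have sT : size T = i - 2 by rewrite size_takel; lia.
have srt : sorted leq (sort leq T) by apply: sort_sorted leq_total _.
have uxy : uniq (x :: y :: T).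
  move: uT; rewrite !rcons_uniq mem_rcons /= !inE !negb_or [x == y]eq_sym.
  by case/and3P => /andP[-> ->] -> ->.
have rk a : rank a (rcons (rcons T x) y) = rank a T + (x < a) + (y < a).
  by rewrite /rank -!cats1 !count_cat /= !addn0.
have [xT yT xy] : [/\ x \notin T, y \notin T & x != y].
  by move: uxy; rewrite /= inE negb_or => /and3P[/andP[-> ->] ->].
case: ifP => _.
  rewrite two_mergeE //; last 2 first.
  - by move: uxy; rewrite /= !inE !mem_sort sort_uniq.
  - by rewrite size_sort sT; apply: terminatesP; lia.
  rewrite size_sort sT !rank_sort; congr (_, _ + _).
    by apply: eq_sort_perm; rewrite -!cats1 -catA perm_sym perm_catC /= !perm_cons perm_sym perm_sort.
  have -> : (i - 2).+2 = i by lia.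
  have -> : (i - 2).+1 = i.-1 by lia.
  rewrite /two_merge_cost !rk !ltnn.
  have [h|h] : x < y \/ y < x by lia.
    have m := rank_mono T (ltnW h).
    rewrite (minn_idPl (ltnW h)) (maxn_idPr (ltnW h)) h ltnNge (ltnW h) /= !addn0 addn1.
    by rewrite (minn_idPl _) ?(maxn_idPr _) //; lia.
  have m := rank_mono T (ltnW h).
  rewrite (minn_idPr (ltnW h)) (maxn_idPl (ltnW h)) h ltnNge (ltnW h) /= !addn0 addn1.
  by rewrite (minn_idPr _) ?(maxn_idPl _) //; lia.
rewrite insE ?mem_sort // size_sort sT rank_sort.
have sx : sorted leq (sort leq (x :: sort leq T)) by apply: sort_sorted leq_total _.
rewrite insE //; last by rewrite mem_sort inE mem_sort negb_or eq_sym xy.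
rewrite size_sort /= size_sort sT rank_sort rk ltnn addn0.
rewrite (_ : (i - 2).+1 = i.-1); last by lia.
rewrite (_ : i.-1.+1 = i); last by lia.
rewrite -addnA; congr (_, _ + (_ + _)).
- apply: eq_sort_perm; apply: (@perm_trans _ (y :: x :: T)).
    by rewrite perm_cons perm_sort perm_cons perm_sort.
  by rewrite -!cats1 -catA perm_sym perm_catC; apply/permPl/(perm_catCA [:: x] [:: y] T).
- by congr rcost; rewrite /rank -cats1 count_cat /= ltnn !addn0.
- by congr rcost; rewrite /rank /= addnC; congr (_ + _); apply/seq.permP; rewrite perm_sort.
Qed.

Lemma foldl_cstep (s : seq nat) n' c m : uniq s -> n' + m.*2 <= size s ->
  foldl (cstep s n') (sort leq (take n' s), c) (iota 1 m)
  = (sort leq (take (n' + m.*2) s), c + \sum_(t <- iota 1 m) step_cost s (n' + t.*2)).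
Proof.
move=> us; elim: m => [|m IH] hm; first by rewrite /= big_nil addn0 addn0.
rewrite -(addn1 m) iotaD foldl_cat IH; last by lia.
rewrite add1n big_cat big_seq1.
have := @cstepE s n' m.+1 (c + \sum_(t <- iota 1 m) step_cost s (n' + t.*2)) us isT hm.
have -> : (n' + m.+1.*2).-2 = n' + m.*2 by lia.
rewrite addn1 => E; apply: etrans E _; by rewrite /= addnA.
Qed.

Lemma combined_cost (s : seq nat) : uniq s -> nprime R (size s) <= size s ->
  ~~ ((638%:R / 1000%:R <= pp R (size s)) && (pp R (size s) <= 2%:R / 3%:R))%R ->
  (combined R s).2 = (MergeInsertion (take (nprime R (size s)) s)).2
    + \sum_(t <- iota 1 ((size s - nprime R (size s))./2)) step_cost s (nprime R (size s) + t.*2).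
Proof.
move=> us hn hp; rewrite /combined (negbTE hp); set n' := nprime R (size s) in hn *.
have ut : uniq (take n' s) by rewrite take_uniq.
have E : MergeInsertion (take n' s) = (sort leq (take n' s), (MergeInsertion (take n' s)).2).
  by rewrite -MergeInsertion_sort //; case: (MergeInsertion _).
rewrite E -/(cstep s n') foldl_cstep //; lia.
Qed.

Lemma perm_ranks (U : seq nat) : uniq U ->
  perm_eq [seq rank (nth 0 U p) U | p <- iota 0 (size U)] (iota 0 (size U)).
Proof.
move=> uU; have -> : [seq rank (nth 0 U p) U | p <- iota 0 (size U)] = [seq rank x U | x <- U].
  by rewrite -[X in _ = map _ X]nth_iota_id -map_comp.
apply: (@perm_trans _ [seq rank x U | x <- sort leq U]).
  by apply: perm_map; rewrite perm_sym perm_sort.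
have sU : sorted leq (sort leq U) by apply: sort_sorted leq_total _.
rewrite (_ : map _ _ = iota 0 (size U)) //; apply: (@eq_from_nth _ 0).
  by rewrite size_map size_sort size_iota.
move=> p; rewrite size_map size_sort => pU; rewrite (nth_map 0) ?size_sort // nth_iota //.
by rewrite -(rank_sort _ U) -index_rank ?sort_uniq ?mem_nth ?index_uniq ?size_sort ?sort_uniq.
Qed.

(** The last of the first i elements may be replaced by any other of them without changing the sum.
    Adding over all i choices, every rank occurs once in each ordering. *)
Lemma sum_rank1 (l : seq nat) i (phi : nat -> nat) : uniq l -> 0 < i <= size l ->
  i * \sum_(t <- permutations l) phi (rank (nth 0 t i.-1) (take i t))
  = (size l)`! * \sum_(a <- iota 0 i) phi a.
Proof.
move=> ul /andP[i0 il]; set n := size l in il *.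
set S := \sum_(t <- _) _.
have H p : p \in iota 0 i -> S = \sum_(t <- permutations l) phi (rank (nth 0 t p) (take i t)).
  rewrite mem_iota => pi; pose e := rcons (rem p (iota 0 i)) p ++ iota i (n - i).
  have pe : perm_eq (rcons (rem p (iota 0 i)) p) (iota 0 i).
    by rewrite perm_rcons perm_sym perm_to_rem // mem_iota.
  have pe' : perm_eq e (iota 0 n).
    have -> : iota 0 n = iota 0 i ++ iota i (n - i) by rewrite -iotaD subnKC.
    by rewrite perm_cat2r.
  rewrite /S -(sum_reindex (fun t => phi (rank (nth 0 t i.-1) (take i t))) pe').
  rewrite big_seq [RHS]big_seq; apply: eq_bigr => t; rewrite mem_permutations => pt; congr phi.
  have st := perm_size pt.
  have se : size (rcons (rem p (iota 0 i)) p) = i by rewrite (perm_size pe) size_iota.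
  rewrite map_cat take_size_cat ?size_map // nth_cat size_map se prednK // leqnn.
  rewrite (nth_map 0) ?se ?prednK // nth_rcons.
  have -> : size (rem p (iota 0 i)) = i.-1 by move: se; rewrite size_rcons; lia.
  rewrite ltnn eqxx; apply: perm_rank.
  have -> : take i t = [seq nth 0 t j | j <- iota 0 i] by rewrite map_nth_iota0 // st.
  exact: perm_map.
have -> : i * S = \sum_(p <- iota 0 i) \sum_(t <- permutations l) phi (rank (nth 0 t p) (take i t)).
  transitivity (\sum_(p <- iota 0 i) S); last by apply: eq_big_seq.
  by rewrite big_const_seq count_predT size_iota iter_addn_0 mulnC.
rewrite exchange_big /= -size_permutations // -sum1_size big_distrl /= big_seq [RHS]big_seq.
apply: eq_bigr => t; rewrite mem_permutations mul1n => pt; have st := perm_size pt.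
have uU : uniq (take i t) by rewrite take_uniq // (perm_uniq pt).
have sU : size (take i t) = i by rewrite size_takel // st.
have pr := perm_ranks uU; rewrite sU in pr.
rewrite -[RHS](perm_big _ pr) /= big_map big_seq [RHS]big_seq.
by apply: eq_bigr => p; rewrite mem_iota => pi; rewrite nth_take.
Qed.

(** Same symmetry for two positions: the ranks of the last two elements are uniform over ordered
    pairs of distinct values. *)
Lemma sum_rank2 (l : seq nat) i (phi : nat -> nat -> nat) : uniq l -> 1 < i <= size l ->
  (i * i.-1) * \sum_(t <- permutations l)
     phi (rank (nth 0 t i.-2) (take i t)) (rank (nth 0 t i.-1) (take i t))
  = (size l)`! * \sum_(a <- iota 0 i) \sum_(b <- iota 0 i | b != a) phi a b.
Proof.
move=> ul /andP[i1 il]; set n := size l in il *.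
set S := \sum_(t <- _) _.
have H p q : p \in iota 0 i -> q \in iota 0 i -> q != p ->
  S = \sum_(t <- permutations l) phi (rank (nth 0 t p) (take i t)) (rank (nth 0 t q) (take i t)).
  move=> pi qi qp; pose e0 := rcons (rcons (rem q (rem p (iota 0 i))) p) q.
  have pe : perm_eq e0 (iota 0 i).
    rewrite perm_rcons perm_sym; apply: (perm_trans (perm_to_rem qi)).
    rewrite perm_cons; apply: uniq_perm; rewrite ?rem_uniq ?iota_uniq //.
      rewrite rcons_uniq !rem_uniq ?iota_uniq // andbT mem_rem_uniq ?rem_uniq ?iota_uniq //.
      by rewrite inE mem_rem_uniq ?iota_uniq // !inE eqxx /= andbF.
    move=> z; rewrite mem_rcons inE !mem_rem_uniq ?rem_uniq ?iota_uniq // !inE.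
    rewrite mem_rem_uniq ?iota_uniq // inE.
    by have [->|] := eqVneq z p; rewrite ?andbF ?andbT ?pi // eq_sym qp.
  have pe' : perm_eq (e0 ++ iota i (n - i)) (iota 0 n).
    have -> : iota 0 n = iota 0 i ++ iota i (n - i) by rewrite -iotaD subnKC.
    by rewrite perm_cat2r.
  rewrite /S -(sum_reindex (fun t => phi (rank (nth 0 t i.-2) (take i t)) (rank (nth 0 t i.-1) (take i t))) pe').
  rewrite big_seq [RHS]big_seq; apply: eq_bigr => t; rewrite mem_permutations => pt.
  have st := perm_size pt.
  have se : size e0 = i by rewrite (perm_size pe) size_iota.
  have se2 : size (rem q (rem p (iota 0 i))) = i.-2 by move: se; rewrite /e0 !size_rcons; lia.
  have pr : perm_eq [seq nth 0 t j | j <- e0] (take i t).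
    have -> : take i t = [seq nth 0 t j | j <- iota 0 i] by rewrite map_nth_iota0 // st.
    exact: perm_map.
  rewrite map_cat take_size_cat ?size_map // !(perm_rank _ pr) !nth_cat size_map se.
  rewrite !ifT; [|lia|lia]; rewrite !(nth_map 0) ?se; [|lia|lia].
  rewrite /e0 !nth_rcons size_rcons se2 ltnn eqxx.
  have -> : i.-2 < i.-2.+1 by lia.
  have -> : (i.-1 < i.-2.+1) = false by lia.
  by have -> : i.-1 == i.-2.+1 by lia.
have -> : (i * i.-1) * S = \sum_(p <- iota 0 i) \sum_(q <- iota 0 i | q != p)
   \sum_(t <- permutations l) phi (rank (nth 0 t p) (take i t)) (rank (nth 0 t q) (take i t)).
  transitivity (\sum_(p <- iota 0 i) \sum_(q <- iota 0 i | q != p) S).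
    transitivity (\sum_(p <- iota 0 i) i.-1 * S).
      by rewrite big_const_seq count_predT size_iota iter_addn_0 -mulnA mulnC.
    apply: eq_big_seq => p pi; rewrite big_const_seq iter_addn_0 mulnC; congr (_ * _).
    have <- : size (rem p (iota 0 i)) = i.-1 by rewrite size_rem ?size_iota.
    by rewrite rem_filter ?iota_uniq // size_filter.
  apply: eq_big_seq => p pi; rewrite big_seq_cond [RHS]big_seq_cond.
  by apply: eq_bigr => q /andP[qi qp]; apply: H.
transitivity (\sum_(t <- permutations l) \sum_(p <- iota 0 i) \sum_(q <- iota 0 i | q != p)
   phi (rank (nth 0 t p) (take i t)) (rank (nth 0 t q) (take i t))).
  rewrite [RHS]exchange_big /=; apply: eq_bigr => p _; exact: exchange_big.
rewrite -size_permutations // -sum1_size big_distrl /= big_seq [RHS]big_seq.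
apply: eq_bigr => t; rewrite mem_permutations mul1n => pt; have st := perm_size pt.
have uU : uniq (take i t) by rewrite take_uniq // (perm_uniq pt).
have sU : size (take i t) = i by rewrite size_takel // st.
have pr := perm_ranks uU; rewrite sU in pr.
have ninj p q : p \in iota 0 i -> q \in iota 0 i ->
  (rank (nth 0 (take i t) q) (take i t) != rank (nth 0 (take i t) p) (take i t)) = (q != p).
  move=> pi qi; congr (~~ _); apply/eqP/eqP => [E|-> //].
  have um : uniq [seq rank (nth 0 (take i t) p) (take i t) | p <- iota 0 i].
    by rewrite (perm_uniq pr) iota_uniq.
  apply/eqP; rewrite -(nth_uniq 0 _ _ um) ?size_map ?size_iota; try by move: pi qi; rewrite !mem_iota.
  rewrite !(nth_map 0) ?size_iota; try by move: pi qi; rewrite !mem_iota.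
  by rewrite !nth_iota ?E //; move: pi qi; rewrite !mem_iota.
rewrite -[RHS](perm_big _ pr) /= big_map; apply: eq_big_seq => p pi.
rewrite -[RHS](perm_big _ pr) /= big_map big_seq_cond [RHS]big_seq_cond.
apply: eq_big => [q|q /andP[qi _]].
  by case qi: (q \in _) => //=; rewrite ninj.
by move: pi qi; rewrite !mem_iota => pi qi; rewrite !nth_take.
Qed.
End Combined.

(** * Probe positions and the depth of A between two even probes *)

Lemma minn_lo i f f' Q m : f' = f./2 -> f <= 6 * Q -> 8 * Q <= f.*2 -> f' <= m < f -> f <= i -> 0 < Q ->
 let e := i - f in let o := i - f' - Q in let g := i.-1 - m in
 [/\ minn o i.-1 = o, g <= i - 2, e <= g, g < i - f' & minn (i - f') i.-1 = i - f'].
Proof. move=> D f6 f8 /andP[m1 m2] fi Q0 /=; split; lia. Qed.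
(** Interval arithmetic for p <= 3/4: [e] and [i - f'] are consecutive even probes and [o] the odd
    one between them. The right interval has exactly [Q] slots, the left one at most [2 * Q], and
    its shallow slots are those with [m] near [f]. *)
Lemma slots_lo i f f' Q m : f' = f./2 -> f <= 6 * Q -> 8 * Q <= f.*2 -> f' <= m < f -> f <= i -> 0 < Q ->
 let e := i - f in let o := i - f' - Q in let g := i.-1 - m in
 [/\ o - e <= 2 * Q, (g - e < 2 * Q - (o - e)) = (f <= m + (3 * Q + f' - f)) ,
   o <= g -> (f <= m + (3 * Q + f' - f)) = false & i - f' - o = Q].
Proof. move=> D f6 f8 /andP[m1 m2] fi Q0 /=. 
have [e E] : exists e, i = e + f by exists (i - f); lia.
have [s Es] : exists s, 3 * Q = s + (f - f') by exists (3 * Q + f' - f); lia.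
have [h Eh] : exists h, f = h + f' by exists (f - f'); lia.
have Em : exists g0, m + g0.+1 = f by exists (f - m.+1); lia.
case: Em => g0 Eg.
subst i.
have -> : e + f - f = e by lia.
have -> : (e + f).-1 - m = e + g0 by lia.
have [o Eo] : exists o, o + Q = h by exists (h - Q); lia.
have -> : e + f - f' - Q = e + o by lia.
have -> : 3 * Q + f' - f = s by lia.
rewrite !addKn.
split; lia.
Qed.
Lemma minn_hi i f f' Q m : f' = f./2 -> f <= 4 * Q -> 4 * Q <= f.*2 -> 0 < f' -> f' <= m < f -> f <= i -> 0 < Q -> 2 * Q < f ->
 let e := i - f in let o := i - f + Q in let g := i.-1 - m in
 [/\ minn o i.-1 = o, g <= i - 2, e <= g, g < i - f' & minn (i - f') i.-1 = i - f'].
Proof. move=> D f6 f8 f0 /andP[m1 m2] fi Q0 hh /=; split; lia. Qed.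
(** The mirror situation for p > 3/4: now the left interval has exactly [Q] slots and the right one
    at most [Q], with deep slots where [m] is close to [f']. *)
Lemma slots_hi i f f' Q m : f' = f./2 -> f <= 4 * Q -> 4 * Q <= f.*2 -> f' <= m < f -> f <= i -> 0 < Q -> 
 let e := i - f in let o := i - f + Q in let g := i.-1 - m in
 [/\ o - e = Q, i - f' - o <= Q, 
   o <= g -> (g - o < Q - (i - f' - o)) = ~~ (m < f' + (f.*2 - f'.*2 - 3 * Q)) & true].
Proof. move=> D f6 f8 /andP[m1 m2] fi Q0 /=. 
have [e E] : exists e, i = e + f by exists (i - f); lia.
have [h Eh] : exists h, f = h + f' by exists (f - f'); lia.
have Em : exists g0, m + g0.+1 = f by exists (f - m.+1); lia.
case: Em => g0 Eg.
subst i.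
have -> : e + f - f = e by lia.
have -> : (e + f).-1 - m = e + g0 by lia.
have -> : e + f - f' = e + h by lia.
rewrite subnDl.
split=> //.
- lia.
- lia.
- by rewrite subnDl; lia.
Qed.

Section Apos.
Variable R : realType.

Lemma absz_ceil_eq (m : nat) (x : R) : (m%:R - 1 < x <= m%:R)%R -> `|Num.ceil x|%N = m.
Proof.
move=> h; have -> // : Num.ceil x = Posz m.
by apply: ceil_def; rewrite rmorphB.
Qed.

Lemma divn_real (i d : nat) : 0 < d ->
  ((i %/ d)%:R <= i%:R / d%:R :> R)%R /\ (i%:R / d%:R < (i %/ d)%:R + 1 :> R)%R.
Proof.
move=> d0; have dR : (0 < d%:R :> R)%R by rewrite ltr0n.
rewrite ler_pdivlMr // ltr_pdivrMr // natr1 -!natrM ler_nat ltr_nat.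
by split; [exact: leq_divM | exact: ltn_ceil].
Qed.

Lemma clg_pow_bounds i : 1 < i -> 2 ^ clg i < i.*2 /\ i <= 2 ^ clg i.
Proof.
move=> i1; have /andP[+ ->] := clg_bounds i1; have : 0 < clg i by rewrite up_log_gt0.
by case: (clg i) => // k _; rewrite expnS /= => h; split=> //; lia.
Qed.

Lemma apos_even k i : 1 < i -> apos R k.*2 i = i - i %/ 2 ^ k.
Proof.
move=> i1; case: k => [|k]; first by rewrite expn0 divn1 subnn.
rewrite /apos (_ : (k.+1.*2 == 0) = false) //; apply: absz_ceil_eq.
rewrite /alpha odd_double doubleK natrB ?leq_div //.
have [h1 h2] := @divn_real i (2 ^ k.+1) ltac:(by rewrite expn_gt0).
by rewrite mulrBl mul1r [((_^-1)%R * _)%R]mulrC; apply/andP; split; lra.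
Qed.

(** The reason for the terms with 1 / p_i in [alpha]: after multiplication by i they are exact
    powers of two, so the ceiling only acts on the even part of the position. *)
Lemma pp_inv i : 1 < i -> ((pp R i)^-1 * i%:R = (2 ^ clg i)%N%:R :> R)%R.
Proof.
by move=> i1; rewrite /pp invf_div mulfVK // pnatr_eq0; lia.
Qed.

Lemma apos_odd_lo k j i : 1 < i -> clg i = k + j.+3 -> ~~ (3%:R / 4%:R < pp R i)%R ->
  apos R k.*2.+1 i = i - i %/ 2 ^ k.+1 - 2 ^ j.
Proof.
move=> i1 iK hp; have [b1 b2] := clg_pow_bounds i1.
have j0 : 0 < 2 ^ j by rewrite expn_gt0.
have kE : 2 ^ clg i = 2 ^ k.+3 * 2 ^ j by rewrite -expnD iK; congr (2 ^ _); lia.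
have k1 : 1 <= 2 ^ k by rewrite expn_gt0.
have j4 : 2 ^ j * 4 < i by move: b1; rewrite kE !expnS; nia.
have d2 : i %/ 2 ^ k.+1 * 2 <= i.
  apply: leq_trans (leq_divM i (2 ^ k.+1)); rewrite leq_mul2l expnS; lia.
rewrite /apos /=; apply: absz_ceil_eq.
rewrite /alpha /= odd_double /= (negbTE hp) doubleK.
have [h1 h2] := @divn_real i (2 ^ k.+1) ltac:(by rewrite expn_gt0).
rewrite !natrB //; try lia.
have -> : ((1 - (2 ^ k.+1)%N%:R^-1 - (pp R i * (2 ^ k.+3)%N%:R)^-1) * i%:R
  = i%:R - i%:R / (2 ^ k.+1)%N%:R - (2 ^ j)%N%:R :> R)%R.
  have -> : ((2 ^ j)%N%:R = (2 ^ clg i)%N%:R / (2 ^ k.+3)%N%:R :> R)%R.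
    by rewrite kE natrM mulrC mulKf // pnatr_eq0 expn_eq0.
  by rewrite -(pp_inv i1) invfM; ring.
by apply/andP; split; lra.
Qed.

Lemma apos_odd_hi k j i : 1 < i -> clg i = k + j.+2 -> (3%:R / 4%:R < pp R i)%R ->
  apos R k.*2.+1 i = i - i %/ 2 ^ k + 2 ^ j.
Proof.
move=> i1 iK hp.
have kE : 2 ^ clg i = 2 ^ k.+2 * 2 ^ j by rewrite -expnD iK; congr (2 ^ _); lia.
rewrite /apos /=; apply: absz_ceil_eq.
rewrite /alpha /= odd_double /= hp doubleK.
have [h1 h2] := @divn_real i (2 ^ k) ltac:(by rewrite expn_gt0).
rewrite natrD natrB ?leq_div //=.
have -> : ((1 - (2 ^ k)%N%:R^-1 + (pp R i * (2 ^ k.+2)%N%:R)^-1) * i%:R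
  = i%:R - i%:R / (2 ^ k)%N%:R + (2 ^ j)%N%:R :> R)%R.
  have -> : ((2 ^ j)%N%:R = (2 ^ clg i)%N%:R / (2 ^ k.+2)%N%:R :> R)%R.
    by rewrite kE natrM mulrC mulKf // pnatr_eq0 expn_eq0.
  by rewrite -(pp_inv i1) invfM; ring.
by apply/andP; split; lra.
Qed.

Lemma div2S i k : i %/ 2 ^ k.+1 = (i %/ 2 ^ k)./2.
Proof. by rewrite expnSr divnMA divn2. Qed.

Lemma rfind_unique i g r : 1 < i -> g <= i - 2 -> 0 < r -> g < apos R r i ->
  (forall q, 0 < q < r -> apos R q i <= g) -> rfind R i g = r.
Proof.
move=> i1 gi r0 gr hq; have [f0 _ fr fq] := rfindP (terminatesP R i1) gi i1.
case: (ltngtP (rfind R i g) r) => // h.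
  by have := hq (rfind R i g); rewrite f0 h => /(_ isT); lia.
by have := fq r; rewrite r0 h => /(_ isT); lia.
Qed.

Lemma leq_clg2 a b : a <= b -> clg a <= clg b.
Proof. exact: leq_up_log. Qed.

(** Used only for the few rightmost positions, where the probe formulas break down; at most 2K
    probes and K further comparisons. *)
Lemma depthA_crude i g : 1 < i -> g <= i - 2 -> depthA R i g <= 3 * clg i.
Proof.
move=> i1 gi; have [f0 f1 fr fq] := rfindP (terminatesP R i1) gi i1.
have rK : rfind R i g <= (clg i).*2.
  rewrite leqNgt; apply/negP => h; have := fq (clg i).*2.
  have K0 : 0 < clg i by rewrite up_log_gt0.
  rewrite h andbT apos_even // => /(_ ltac:(lia)).
  have [_ b2] := clg_pow_bounds i1.
  have : i %/ 2 ^ clg i <= 1 by rewrite -(leq_pmul2r (_ : 0 < 2 ^ clg i)) ?expn_gt0 // mul1n (leq_trans (leq_divM _ _)).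
  lia.
rewrite /depthA; set r := rfind R i g in rK *.
have h2 : rcost (minn (apos R r i) i.-1 - apos R r.-1 i) (g - apos R r.-1 i) <= clg i.
  apply: leq_trans (leq_subr _ _) _; apply: leq_clg2; lia.
lia.
Qed.

Lemma apos_le_even q k i : 1 < i -> k + 2 <= clg i -> q <= k.*2 -> apos R q i <= i - i %/ 2 ^ k.
Proof.
move=> i1 kK qk; have [b1 b2] := clg_pow_bounds i1.
have mono a b : a <= b -> i - i %/ 2 ^ a <= i - i %/ 2 ^ b.
  by move=> ab; apply/leq_sub2l/leq_div2l; rewrite ?expn_gt0 // leq_exp2l.
have [[a Eq]|[a Eq]] : (exists a, q = a.*2) \/ (exists a, q = a.*2.+1).
  have := odd_double_half q; case: (odd q) => /= h; [right|left]; exists q./2; lia.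
  rewrite Eq apos_even //; apply: mono; lia.
rewrite Eq; have ak : a < k by lia.
apply: (@leq_trans (i - i %/ 2 ^ a.+1)); last exact: mono.
case hp : (3%:R / 4%:R < pp R i)%R.
  have [j Ej] : exists j, clg i = a + j.+2 by exists (clg i - a - 2); lia.
  rewrite (apos_odd_hi i1 Ej hp) div2S.
  have : 2 ^ j * 2 <= i %/ 2 ^ a.
    rewrite leq_divRL ?expn_gt0 //; move: b1; rewrite Ej expnD !expnS; nia.
  have : i %/ 2 ^ a <= i by apply: leq_div.
  lia.
have [j Ej] : exists j, clg i = a + j.+3 by exists (clg i - a - 3); lia.
rewrite (apos_odd_lo i1 Ej (negbT hp)); exact: leq_subr.
Qed.

Lemma divn_pow_bounds i k j : 1 < i -> clg i = k + j ->
  [/\ i %/ 2 ^ k <= 2 ^ j, 2 ^ j <= (i %/ 2 ^ k).*2 + (j == 0) & 2 ^ j <= (i %/ 2 ^ k).*2.+1].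
Proof.
move=> i1 iK; have [b1 b2] := clg_pow_bounds i1.
have k0 : 0 < 2 ^ k by rewrite expn_gt0.
have h1 : i %/ 2 ^ k <= 2 ^ j.
  by rewrite -(leq_pmul2r k0) -expnD addnC -iK (leq_trans (leq_divM _ _)).
have h2 : 2 ^ j <= (i %/ 2 ^ k).*2 + (j == 0).
  move: b1; rewrite iK; case: (j) => [|j'] b1 /=; first by rewrite addn1.
  rewrite addn0 expnS mul2n leq_double leq_divRL //.
  by move: b1; rewrite expnD expnS mulnCA mul2n ltn_double mulnC => /ltnW.
by split=> //; apply: leq_trans h2 _; case: (j == 0); rewrite ?addn0 ?addn1.
Qed.

Lemma pp_gt34 i : 1 < i -> (3%:R / 4%:R < pp R i)%R = (3 * 2 ^ clg i < 4 * i).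
Proof.
move=> i1; rewrite /pp ltr_pdivlMr ?ltr0n ?expn_gt0 // mulrAC ltr_pdivrMr ?ltr0n //.
by rewrite -!natrM ltr_nat [i * 4]mulnC.
Qed.

(** Left of the odd probe the cost is at most (2k + 1) + (j + 1), right of it exactly (2k + 2) + j;
    both are K + k - 1. Only the shallow slots of the left interval cost one less. *)
Lemma depthA_lo i k j m : 1 < i -> clg i = k + j.+3 -> ~~ (3%:R / 4%:R < pp R i)%R ->
  i %/ 2 ^ k.+1 <= m < i %/ 2 ^ k ->
  depthA R i (i.-1 - m) + (i %/ 2 ^ k <= m + (3 * 2 ^ j + i %/ 2 ^ k.+1 - i %/ 2 ^ k)) < clg i + k.
Proof.
move=> i1 iK hp mb.
have ek := apos_even k i1; have ek1 := apos_even k.+1 i1; have ok := apos_odd_lo i1 iK hp.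
have [F1 F2 _] := divn_pow_bounds i1 iK.
have Fi : i %/ 2 ^ k <= i := leq_div _ _.
have F6 : i %/ 2 ^ k <= 6 * 2 ^ j.
  rewrite pp_gt34 // -leqNgt iK expnD !expnS in hp.
  rewrite -(@leq_pmul2r (2 ^ k)) ?expn_gt0 // (leq_trans (leq_divM _ _)) //.
  by move: hp; clear; move: (2 ^ k) (2 ^ j) => a b; nia.
have D := div2S i k; have Q0 : 0 < 2 ^ j by rewrite expn_gt0.
have kK : k + 2 <= clg i by rewrite iK; clear; lia.
have mo q : 0 < q < k.*2.+1 -> apos R q i <= i - i %/ 2 ^ k.
  by case/andP=> _ hq; apply: apos_le_even.
have F8 : 8 * 2 ^ j <= (i %/ 2 ^ k).*2 by move: F2; rewrite !expnS; clear; lia.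
have [mo1 gi eg ge1 mo2] := minn_lo D F6 F8 mb Fi Q0.
have [L1 L2 L3 L4] := slots_lo D F6 F8 mb Fi Q0.
rewrite doubleS in ek1; set g := i.-1 - m in gi eg ge1 L2 L3 *.
case: (ltnP g (apos R k.*2.+1 i)) => h.
  have rE : rfind R i g = k.*2.+1.
    by apply: rfind_unique => // q /mo hq; apply: leq_trans hq eg.
  rewrite /depthA rE /= ek ok mo1.
  have L1' : i - i %/ 2 ^ k.+1 - 2 ^ j - (i - i %/ 2 ^ k) <= 2 ^ j.+1 by rewrite (expnS 2 j).
  have := rcost_le (g - (i - i %/ 2 ^ k)) L1'; rewrite (expnS 2 j) L2 iK => rc.
  apply: leq_ltn_trans (_ : k.*2.+1 + j.+1 < _); last by clear; lia.
  rewrite -addnA; apply: leq_add; first exact: leq_subr.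
  by move: rc; case: (_ <= m + _) => /=; clear; lia.
have rE : rfind R i g = k.*2.+2.
  apply: rfind_unique => //; first by rewrite ek1.
  move=> q /andP[q0]; rewrite ltnS leq_eqVlt => /orP[/eqP-> //|hq].
  by apply: leq_trans (mo q _) _; rewrite ?q0.
rewrite ok in h.
rewrite /depthA rE /= ek1 ok mo2 L4 rcost_exp L3 // addn0 iK.
by clear; lia.
Qed.

(** Left of the odd probe the cost is (2k + 1) + j = K + k - 1; right of it the deep slots cost one
    more. *)
Lemma depthA_hi i k j m : 1 < i -> clg i = k + j.+2 -> (3%:R / 4%:R < pp R i)%R ->
  i %/ 2 ^ k.+1 <= m < i %/ 2 ^ k ->
  depthA R i (i.-1 - m) < clg i + k + (m < i %/ 2 ^ k.+1 + ((i %/ 2 ^ k).*2 - (i %/ 2 ^ k.+1).*2 - 3 * 2 ^ j)).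
Proof.
move=> i1 iK hp mb.
have ek := apos_even k i1; have ek1 := apos_even k.+1 i1; have ok := apos_odd_hi i1 iK hp.
have [F1 F2 _] := divn_pow_bounds i1 iK.
have Fi : i %/ 2 ^ k <= i := leq_div _ _.
have D := div2S i k; have Q0 : 0 < 2 ^ j by rewrite expn_gt0.
have F3 : 3 * 2 ^ j <= i %/ 2 ^ k.
  rewrite pp_gt34 // iK expnD !expnS in hp; rewrite leq_divRL ?expn_gt0 //.
  by move: hp; clear; move: (2 ^ k) (2 ^ j) => a b; nia.
have kK : k + 2 <= clg i by rewrite iK; clear; lia.
have mo q : 0 < q < k.*2.+1 -> apos R q i <= i - i %/ 2 ^ k.
  by case/andP=> _ hq; apply: apos_le_even.
have F4 : i %/ 2 ^ k <= 4 * 2 ^ j by move: F1; rewrite !expnS; clear; lia.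
have F8 : 4 * 2 ^ j <= (i %/ 2 ^ k).*2 by move: F3; clear; lia.
have f0 : 0 < i %/ 2 ^ k.+1 by rewrite D; move: F3 Q0; clear; lia.
have Q2 : 2 * 2 ^ j < i %/ 2 ^ k by move: F3 Q0; clear; lia.
have [mo1 gi eg ge1 mo2] := minn_hi D F4 F8 f0 mb Fi Q0 Q2.
have [L1 L2 L3 _] := slots_hi D F4 F8 mb Fi Q0.
rewrite doubleS in ek1; set g := i.-1 - m in gi eg ge1 L3 *.
case: (ltnP g (apos R k.*2.+1 i)) => h.
  have rE : rfind R i g = k.*2.+1.
    by apply: rfind_unique => // q /mo hq; apply: leq_trans hq eg.
  rewrite /depthA rE /= ek ok mo1 L1 rcost_exp iK.
  by clear; lia.
have rE : rfind R i g = k.*2.+2.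
  apply: rfind_unique => //; first by rewrite ek1.
  move=> q /andP[q0]; rewrite ltnS leq_eqVlt => /orP[/eqP-> //|hq].
  by apply: leq_trans (mo q _) _; rewrite ?q0.
rewrite ok in h.
rewrite /depthA rE /= ek1 ok mo2.
have := rcost_le (g - (i - i %/ 2 ^ k + 2 ^ j)) L2.
(* With [j = 0] the nonempty interval has a single slot and no shallow one, so the subtraction of 1
   from [j] in [rcost_le] is never truncated. *)
have j0 : g - (i - i %/ 2 ^ k + 2 ^ j) < 2 ^ j - (i - i %/ 2 ^ k.+1 - (i - i %/ 2 ^ k + 2 ^ j)) -> 0 < j.
  by case: (j) h ge1 => // h ge1; rewrite expn0 in h *; move: h ge1; clear; lia.
rewrite L3 // in j0 *; rewrite iK.
by move: j0; case: (m < _) => /=; clear; [|move=> /(_ isT)]; lia.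
Qed.

End Apos.

(** * Summing the depth of A over all pairs of ranks *)

Lemma weighted_sum_saving (c : nat -> nat) f' f s kap : s <= f - f' -> f' <= f ->
  (forall m, f' <= m < f -> c m + (f <= m + s) <= kap) ->
  \sum_(f' <= m < f) m * c m + \sum_(f - s <= m < f) m <= kap * \sum_(f' <= m < f) m.
Proof.
move=> sf ff H; have fs : f' <= f - s by lia.
have -> : \sum_(f - s <= m < f) m = \sum_(f' <= m < f) m * (f <= m + s).
  rewrite [RHS](@big_cat_nat _ _ _ (f - s)) //=; last by lia.
  rewrite [X in _ = X + _]big_nat_cond [X in _ = X + _]big1; last first.
    by move=> m /andP[/andP[_ h] _]; rewrite (_ : f <= m + s = false) ?muln0 //; lia.
  by rewrite big_nat [RHS]big_nat; apply: eq_bigr => m /andP[h _]; rewrite (_ : f <= m + s) ?muln1 //; lia.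
rewrite -big_split /= big_distrr /= big_nat [X in _ <= X]big_nat; apply: leq_sum => m /H h.
by rewrite -mulnDr mulnC leq_mul2r h orbT.
Qed.

Lemma weighted_sum_excess (c : nat -> nat) f' f s kap : s <= f - f' -> f' <= f ->
  (forall m, f' <= m < f -> c m <= kap + (m < f' + s)) ->
  \sum_(f' <= m < f) m * c m <= kap * \sum_(f' <= m < f) m + \sum_(f' <= m < f' + s) m.
Proof.
move=> sf ff H; have fs : f' + s <= f by lia.
have -> : \sum_(f' <= m < f' + s) m = \sum_(f' <= m < f) m * (m < f' + s).
  rewrite [RHS](@big_cat_nat _ _ _ (f' + s)) //=; last by lia.
  rewrite [X in _ = _ + X]big_nat_cond [X in _ = _ + X]big1 ?addn0; last first.
    by move=> m /andP[/andP[h _] _]; rewrite (_ : m < f' + s = false) ?muln0 //; lia.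
  by rewrite big_nat [RHS]big_nat; apply: eq_bigr => m /andP[_ h]; rewrite h muln1.
rewrite big_distrr -big_split /= big_nat [X in _ <= X]big_nat; apply: leq_sum => m /H h.
by rewrite [kap * m]mulnC -mulnDr leq_mul2l h orbT.
Qed.

Section Beta.
Variable R : realType.
Local Open Scope ring_scope.

Definition tri (n : nat) : R := n%:R * (n%:R - 1) / 2%:R.

Lemma sum_id (a b : nat) : (a <= b)%N -> (\sum_(a <= m < b) m)%:R = tri b - tri a :> R.
Proof.
move=> /subnK <-; elim: (b - a)%N => [|k IH].
  by rewrite add0n big_geq // subrr.
by rewrite addSn big_nat_recr /= ?leq_addl // natrD IH /tri -natr1 natrD; field.
Qed.

(* Ranks are counted from the right: the even probes then sit at [i %/ 2 ^ k]. *)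
Definition depth_rev (i m : nat) : nat := depthA R i (i.-1 - m).

(** The weight m is the number of ranks left for B when A has rank i - 1 - m, so these are sums over
    pairs of ranks, cut at even probes. *)
Definition Psum (i k : nat) : nat := (\sum_(i %/ 2 ^ k <= m < i) m * depth_rev i m)%N.

Lemma Psum0 i : Psum i 0 = 0%N.
Proof. by rewrite /Psum expn0 divn1 big_geq. Qed.

Lemma PsumS i k : Psum i k.+1 = (\sum_(i %/ 2 ^ k.+1 <= m < i %/ 2 ^ k) m * depth_rev i m + Psum i k)%N.
Proof.
by rewrite /Psum -big_cat_nat //= ?leq_div // leq_div2l ?expn_gt0 // leq_exp2l.
Qed.

(** The right side is the sum of the s largest integers below f. Replacing f by phi = i / 2^k and s
    by its real counterpart sg, which differs by at most 1/2, costs at most 2 phi. *)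
Lemma segment_saving_lo (f f' s phi sg Q : R) : f <= phi -> phi - 1 <= f -> f / 2%:R <= f - f' -> f - f' <= (f + 1) / 2%:R ->
  s = 3%:R * Q - (f - f') -> 0 <= s -> sg = 3%:R * Q - phi / 2%:R -> 4%:R * Q <= phi -> phi <= 6%:R * Q -> 1 <= Q ->
  sg * phi - sg ^+ 2 / 2%:R - 2%:R * phi <= (2%:R * f * s - s ^+ 2 - s) / 2%:R.
Proof.
move=> h1 h2 h3 h4 hs s0 hg h5 h6 h7.
have e1 : s - sg <= 1 / 2%:R by lra.
have e2 : - (1 / 2%:R) <= s - sg by lra.
have g0 : 0 <= sg by lra.
have g1 : sg <= phi / 4%:R by lra.
have a1 : (phi - 1) * s <= f * s by rewrite ler_wpM2r.
set e := s - sg in e1 e2.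
have -> : s = sg + e by rewrite /e; ring.
have sE : s = sg + e by rewrite /e; ring.
have a2 : - (1 / 2%:R) * (phi - sg) <= e * (phi - sg) by rewrite ler_wpM2r //; lra.
have a3 : e ^+ 2 <= 1 / 4%:R by nra.
have -> : (2%:R * f * (sg + e) - (sg + e) ^+ 2 - (sg + e)) / 2%:R
   = f * s - (sg ^+ 2 + 2%:R * sg * e + e ^+ 2 + s) / 2%:R by rewrite sE; field.
have a4 : (phi - 1) * s = phi * sg + phi * e - s by rewrite sE; ring.
nra.
Qed.

(** The left side is the sum of the s integers from f' on. The alternative s = 0 is the truncated
    subtraction in the number of deep slots. *)
Lemma segment_excess_hi (f f' s phi sg Q : R) : f <= phi -> f' <= phi / 2%:R -> 0 <= f' -> f - f' <= (f + 1) / 2%:R ->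
  (s = 0 \/ s = 2%:R * (f - f') - 3%:R * Q) -> 0 <= s -> sg = phi - 3%:R * Q -> 0 <= sg -> sg <= phi ->
  (2%:R * f' * s + s ^+ 2 - s) / 2%:R <= sg * phi / 2%:R + sg ^+ 2 / 2%:R + phi.
Proof.
move=> h1 h2 h3 h4 hs s0 hg g0 g1.
have sl : s <= sg + 1 by case: hs => ->; lra.
have a1 : f' * s <= phi / 2%:R * (sg + 1) by apply: ler_pM.
have a2 : s * (s - 1) <= (sg + 1) * sg.
  have : 0 <= (sg + 1 - s) * (sg + s) by apply: mulr_ge0; lra.
  nra.
rewrite -subr_ge0; have -> : sg * phi / 2%:R + sg ^+ 2 / 2%:R + phi - (2%:R * f' * s + s ^+ 2 - s) / 2%:R
  = (phi / 2%:R * (sg + 1) - f' * s) + ((sg + 1) * sg - s * (s - 1)) / 2%:R + (phi - sg) / 2%:R by field.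
lra.
Qed.

Lemma tri_half (f' phi : R) : 0 <= f' -> f' <= phi / 2%:R -> f' * (f' - 1) / 2%:R <= phi ^+ 2 / 8%:R.
Proof. by move=> h1 h2; nra. Qed.

Definition ix (k : nat) : R := ((2 ^ k)%N%:R)^-1.

Lemma ixS k : ix k.+1 = ix k / 2%:R.
Proof. by rewrite /ix expnSr natrM invfM. Qed.

Lemma ix_gt0 k : 0 < ix k.
Proof. by rewrite invr_gt0 ltr0n expn_gt0. Qed.

Definition pw (i : nat) : R := (2 ^ clg i)%N%:R.

Lemma pw_ix i k j : clg i = (k + j)%N -> (2 ^ j)%N%:R = pw i * ix k :> R.
Proof.
by move=> E; rewrite /pw E /ix expnD natrM mulrAC mulfV ?mul1r // pnatr_eq0 expn_eq0.
Qed.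

Section Fixed.
Variable i : nat.
Hypothesis i1 : (1 < i)%N.
Local Notation K := (clg i).
Local Notation N := (pw i).
Local Notation x := ix.

(** Continuous weight of the segment at scale 1, which scales by 4^-k: i^2 / 8 is the triangular
    number of i/2, and the rest is the saved part with s = 3N/8 - i/2. In [whi] the excess part has
    s = i - 3N/4. *)
Definition wlo : R := i%:R ^+ 2 / 8%:R
  - ((3%:R / 8%:R * N - i%:R / 2%:R) * i%:R - (3%:R / 8%:R * N - i%:R / 2%:R) ^+ 2 / 2%:R).
Definition whi : R := i%:R ^+ 2 / 8%:R
  + ((i%:R - 3%:R / 4%:R * N) * i%:R / 2%:R + (i%:R - 3%:R / 4%:R * N) ^+ 2 / 2%:R).

(** Summation by parts: the segment costs K + k - 1 per unit of weight, and the terms in [tri] are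
    placed so that consecutive inequalities telescope. The surplus triangular number of i / 2^(k+1)
    is the i^2 / 8 in [wlo]. *)
Lemma Psum_step_lo k : ~~ (3%:R / 4%:R < pp R i) -> (k + 3 <= K)%N ->
  (Psum i k.+1)%:R + (K + k)%:R * tri (i %/ 2 ^ k.+1)
  <= (Psum i k)%:R + ((K + k)%:R - 1) * tri (i %/ 2 ^ k) + wlo * (x k) ^+ 2 + 2%:R * i%:R * x k.
Proof.
move=> hp kK; have [j Kj] : exists j, K = (k + j.+3)%N by exists (K - k - 3)%N; lia.
have [F1 F2 F3] := divn_pow_bounds i1 Kj.
have D := div2S i k.
set f := (i %/ 2 ^ k)%N in F1 F2 F3 D *; set f' := (i %/ 2 ^ k.+1)%N in D *.
have F6 : (f <= 6 * 2 ^ j)%N.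
  rewrite pp_gt34 // -leqNgt -/K Kj expnD !expnS in hp.
  rewrite -(@leq_pmul2r (2 ^ k)) ?expn_gt0 // (leq_trans (leq_divM _ _)) //.
  by move: hp; clear; move: (2 ^ k)%N (2 ^ j)%N => a b; nia.
have F8 : (4 * 2 ^ j <= f)%N by move: F2; rewrite !expnS /= addn0; clear; lia.
have ff : (f' <= f)%N by move: D; clear; lia.
set s := (3 * 2 ^ j + f' - f)%N.
have sf : (s <= f - f')%N by rewrite /s; move: D F8; clear; lia.
have H m : (f' <= m < f)%N -> (depth_rev i m + (f <= m + s) <= (K + k).-1)%N.
  by move=> mb; have := depthA_lo i1 Kj hp mb; rewrite -/f -/f' -/s -/(depth_rev i m) -/K; clear; lia.
have S := weighted_sum_saving sf ff H.
have {}S : (\sum_(f' <= m < f) m * depth_rev i m)%:R + (tri f - tri (f - s)) <= ((K + k)%:R - 1) * (tri f - tri f').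
  rewrite -(sum_id ff) -(@sum_id (f - s) f) ?leq_subr //.
  have -> : (K + k)%:R - 1 = (K + k).-1%:R :> R.
    by rewrite -[X in X%:R - 1](@prednK (K + k)) -?natr1 ?addrK //; move: Kj; clear; lia.
  by rewrite -natrM -natrD ler_nat.
rewrite PsumS -/f -/f' natrD.
have [d1 d2] := @divn_real R i (2 ^ k) ltac:(by rewrite expn_gt0).
have [d1' d2'] := @divn_real R i (2 ^ k.+1) ltac:(by rewrite expn_gt0).
rewrite -/f -/f' -/(x k) -/(x k.+1) ixS in d1 d2 d1' d2'.
have Qx := pw_ix Kj; rewrite !expnS !natrM in Qx.
have sE : s%:R = 3%:R * (2 ^ j)%N%:R - (f%:R - f'%:R) :> R.
  have h : (s + f = 3 * 2 ^ j + f')%N by rewrite /s; move: D F6; clear; lia.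
  have : s%:R + f%:R = 3%:R * (2 ^ j)%N%:R + f'%:R :> R by rewrite -natrM -!natrD h.
  lra.
have C := @segment_saving_lo f%:R f'%:R s%:R (i%:R * x k) (3%:R * (2 ^ j)%N%:R - i%:R * x k / 2%:R) (2 ^ j)%N%:R.
have h2 : f%:R <= 2%:R * (f%:R - f'%:R) :> R.
  have : f%:R + 2%:R * f'%:R <= 2%:R * f%:R :> R by rewrite -!natrM -natrD ler_nat; move: D; clear; lia.
  lra.
have h3 : 2%:R * f%:R <= f%:R + 1 + 2%:R * f'%:R :> R.
  by rewrite -!natrM natr1 -natrD ler_nat; move: D; clear; lia.
have Nb : N <= 2%:R * i%:R.
  by rewrite -natrM ler_nat /pw; have [+ _] := clg_pow_bounds i1; rewrite -/K; clear; lia.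
have Ni : 4%:R * i%:R <= 3%:R * N.
  by rewrite /pw -!natrM ler_nat; move: hp; rewrite pp_gt34 // -leqNgt.
have xk := ix_gt0 k.
have Nbx : N * x k <= 2%:R * i%:R * x k by rewrite ler_pM2r.
have Nix : 4%:R * i%:R * x k <= 3%:R * N * x k by rewrite ler_pM2r.
have {}C : (3%:R * (2 ^ j)%N%:R - i%:R * x k / 2%:R) * (i%:R * x k)
   - (3%:R * (2 ^ j)%N%:R - i%:R * x k / 2%:R) ^+ 2 / 2%:R - 2%:R * (i%:R * x k)
   <= (2%:R * f%:R * s%:R - s%:R ^+ 2 - s%:R) / 2%:R.
  apply: C => //; try lra.
  by rewrite ler1n expn_gt0.
have T' : tri f' <= (i%:R * x k) ^+ 2 / 8%:R by apply: tri_half => //; lra.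
have Cs : tri f - tri (f - s) = (2%:R * f%:R * s%:R - s%:R ^+ 2 - s%:R) / 2%:R.
  by rewrite /tri natrB; [field | move: sf; clear; lia].
have wE : wlo * x k ^+ 2 = (i%:R * x k) ^+ 2 / 8%:R - ((3%:R * (2 ^ j)%N%:R - i%:R * x k / 2%:R) * (i%:R * x k)
   - (3%:R * (2 ^ j)%N%:R - i%:R * x k / 2%:R) ^+ 2 / 2%:R).
  have -> : 3%:R * (2 ^ j)%N%:R = 3%:R / 8%:R * (N * x k) by rewrite -Qx; field.
  by rewrite /wlo; field.
rewrite wE; rewrite Cs in S.
move: S T' C; move: (tri f) (tri f') => a b.
move: (\sum_(_ <= m < _) _)%N%:R (Psum i k)%:R (_ - _ ^+ 2 - _) => p q r.
lra.
Qed.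

Lemma pw_le2 : N <= 2%:R * i%:R.
Proof.
by rewrite -natrM ler_nat; have [+ _] := clg_pow_bounds i1; clear; lia.
Qed.

Lemma le_pw : i%:R <= N.
Proof. by rewrite ler_nat; have [_] := clg_pow_bounds i1. Qed.

Lemma Psum_step_hi k : 3%:R / 4%:R < pp R i -> (k + 2 <= K)%N ->
  (Psum i k.+1)%:R + (K + k)%:R * tri (i %/ 2 ^ k.+1)
  <= (Psum i k)%:R + ((K + k)%:R - 1) * tri (i %/ 2 ^ k) + whi * (x k) ^+ 2 + 2%:R * i%:R * x k.
Proof.
move=> hp kK; have [j Kj] : exists j, K = (k + j.+2)%N by exists (K - k - 2)%N; lia.
have [F1 F2 F3] := divn_pow_bounds i1 Kj.
have D := div2S i k.
set f := (i %/ 2 ^ k)%N in F1 F2 F3 D *; set f' := (i %/ 2 ^ k.+1)%N in D *.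
have F4 : (f <= 4 * 2 ^ j)%N by move: F1; rewrite !expnS; clear; lia.
have ff : (f' <= f)%N by move: D; clear; lia.
set s := (f.*2 - f'.*2 - 3 * 2 ^ j)%N.
have sf : (s <= f - f')%N by rewrite /s; move: D F4; clear; lia.
have H m : (f' <= m < f)%N -> (depth_rev i m <= (K + k).-1 + (m < f' + s))%N.
  by move=> mb; have := depthA_hi i1 Kj hp mb; rewrite -/f -/f' -/s -/(depth_rev i m); move: Kj; clear; lia.
have S := weighted_sum_excess sf ff H.
have {}S : (\sum_(f' <= m < f) m * depth_rev i m)%:R <= ((K + k)%:R - 1) * (tri f - tri f') + (tri (f' + s) - tri f').
  rewrite -(sum_id ff) -(@sum_id f' (f' + s)) ?leq_addr //.
  have -> : (K + k)%:R - 1 = (K + k).-1%:R :> R.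
    by rewrite -[X in X%:R - 1](@prednK (K + k)) -?natr1 ?addrK //; move: Kj; clear; lia.
  by rewrite -natrM -natrD ler_nat.
rewrite PsumS -/f -/f' natrD.
have [d1 d2] := @divn_real R i (2 ^ k) ltac:(by rewrite expn_gt0).
have [d1' d2'] := @divn_real R i (2 ^ k.+1) ltac:(by rewrite expn_gt0).
rewrite -/f -/f' -/(x k) -/(x k.+1) ixS in d1 d2 d1' d2'.
have Qx := pw_ix Kj; rewrite !expnS !natrM in Qx.
have sE : s%:R = 0 :> R \/ s%:R = 2%:R * (f%:R - f'%:R) - 3%:R * (2 ^ j)%N%:R :> R.
  have [h|h] : s = 0%N \/ (s + 2 * f' + 3 * 2 ^ j = 2 * f)%N by rewrite /s; move: D; clear; lia.
    by left; rewrite h.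
  right; have : s%:R + 2%:R * f'%:R + 3%:R * (2 ^ j)%N%:R = 2%:R * f%:R :> R by rewrite -!natrM -!natrD h.
  lra.
have C := @segment_excess_hi f%:R f'%:R s%:R (i%:R * x k) (i%:R * x k - 3%:R * (2 ^ j)%N%:R) (2 ^ j)%N%:R.
have h3 : 2%:R * f%:R <= f%:R + 1 + 2%:R * f'%:R :> R.
  by rewrite -!natrM natr1 -natrD ler_nat; move: D; clear; lia.
have Ni : 3%:R * N <= 4%:R * i%:R.
  by rewrite /pw -!natrM ler_nat; move: hp; rewrite pp_gt34 //; exact: ltnW.
have xk := ix_gt0 k.
have Nix : 3%:R * N * x k <= 4%:R * i%:R * x k by rewrite ler_pM2r.
have N0 : 0 <= N * x k by rewrite mulr_ge0 // ?ler0n // ltW.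
have {}C : (2%:R * f'%:R * s%:R + s%:R ^+ 2 - s%:R) / 2%:R <= (i%:R * x k - 3%:R * (2 ^ j)%N%:R) * (i%:R * x k) / 2%:R
  + (i%:R * x k - 3%:R * (2 ^ j)%N%:R) ^+ 2 / 2%:R + i%:R * x k.
  by apply: C => //; lra.
have T' : tri f' <= (i%:R * x k) ^+ 2 / 8%:R by apply: tri_half => //; lra.
have Cs : tri (f' + s) - tri f' = (2%:R * f'%:R * s%:R + s%:R ^+ 2 - s%:R) / 2%:R.
  by rewrite /tri natrD; field.
have wE : whi * x k ^+ 2 = (i%:R * x k) ^+ 2 / 8%:R + ((i%:R * x k - 3%:R * (2 ^ j)%N%:R) * (i%:R * x k) / 2%:R
   + (i%:R * x k - 3%:R * (2 ^ j)%N%:R) ^+ 2 / 2%:R).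
  have -> : 3%:R * (2 ^ j)%N%:R = 3%:R / 4%:R * (N * x k) by rewrite -Qx; field.
  by rewrite /whi; field.
rewrite wE; rewrite Cs in S.
have ip : 0 <= i%:R * x k by rewrite mulr_ge0 // ltW.
move: S T' C ip; move: (tri f) (tri f') => a b.
move: (\sum_(_ <= m < _) _)%N%:R (Psum i k)%:R (_ + _ ^+ 2 - _) => p q r.
lra.
Qed.

(** The remaining terms are the geometric series of ratios 1/4 and 1/2, whence 4/3 and the factor
    4. *)
Lemma Psum_bound (w : R) k0 :
  (forall k, (k < k0)%N ->
   (Psum i k.+1)%:R + (K + k)%:R * tri (i %/ 2 ^ k.+1)
   <= (Psum i k)%:R + ((K + k)%:R - 1) * tri (i %/ 2 ^ k) + w * (x k) ^+ 2 + 2%:R * i%:R * x k) ->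
  (Psum i k0)%:R + ((K + k0)%:R - 1) * tri (i %/ 2 ^ k0)
   <= (K%:R - 1) * tri i + 4%:R / 3%:R * w * (1 - x k0 ^+ 2) + 4%:R * i%:R * (1 - x k0).
Proof.
elim: k0 => [|k0 IH] H.
  by rewrite Psum0 expn0 divn1 addn0 /ix expn0 invr1 expr1n; lra.
have {}IH := IH (fun k hk => H k (ltnW hk)); have := H k0 (leqnn _).
have -> : (K + k0.+1)%:R - 1 = (K + k0)%:R :> R by rewrite addnS -natr1 addrK.
rewrite ixS; move: IH; move: (Psum i k0.+1)%:R (tri _) => a b.
move: (Psum i k0)%:R (tri (i %/ 2 ^ k0)) (tri i) => c d e; lra.
Qed.

(** Only m < 4 remains, of total weight 0 + 1 + 2 + 3 = 6, at the crude cost 3K each. *)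
Lemma Psum_tail : (4 <= K)%N -> (\sum_(0 <= m < i) m * depth_rev i m <= Psum i (K - 2) + 18 * K)%N.
Proof.
move=> K4; rewrite (@big_cat_nat _ _ _ (i %/ 2 ^ (K - 2))) ?leq_div //= addnC leq_add2l.
have [F _ _] := @divn_pow_bounds i (K - 2) 2 i1 ltac:(lia).
apply: (@leq_trans (\sum_(0 <= m < i %/ 2 ^ (K - 2)) m * (3 * K))).
  rewrite big_nat [X in (_ <= X)%N]big_nat; apply: leq_sum => m /andP[_ hm].
  by case: m {hm} => // m; rewrite leq_mul2l depthA_crude ?orbT //; clear - i1; lia.
rewrite -big_distrl /= [X in (_ <= X)%N](_ : _ = 6 * (3 * K))%N; last by rewrite mulnA.
rewrite leq_mul2r; apply/orP; right.
move: F; rewrite expnS expn1 => F.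
apply: leq_trans (_ : \sum_(0 <= m < 4) m <= _)%N; last by rewrite !big_nat_recr //= big_geq.
by rewrite [X in (_ <= X)%N](@big_cat_nat _ _ _ (i %/ 2 ^ (K - 2))) //= leq_addr.
Qed.

(** At level K - 2 one has N / 2^(K-2) = 4, so the lower bound on [w] makes the cut-off end of the
    geometric series O(1). *)
Lemma sum_depth_le (w : R) k0 : (4 <= K)%N -> k0 = (K - 2)%N ->
  - (N ^+ 2 / 8%:R) <= w ->
  (forall k, (k < k0)%N ->
   (Psum i k.+1)%:R + (K + k)%:R * tri (i %/ 2 ^ k.+1)
   <= (Psum i k)%:R + ((K + k)%:R - 1) * tri (i %/ 2 ^ k) + w * (x k) ^+ 2 + 2%:R * i%:R * x k) ->
  (\sum_(0 <= m < i) m * depth_rev i m)%:R <= (K%:R - 1) * tri i + 4%:R / 3%:R * w + 25%:R * i%:R.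
Proof.
move=> K4 k0E hw H; have Z := Psum_bound H.
have T : (\sum_(0 <= m < i) m * depth_rev i m)%:R <= (Psum i k0)%:R + 18%:R * K%:R :> R.
  by rewrite -natrM -natrD ler_nat k0E Psum_tail.
have Ki : K%:R <= i%:R :> R by rewrite ler_nat; apply/clg_min/ltnW/ltn_expl.
have tri0 n : 0 <= tri n.
  case: n => [|n]; first by rewrite /tri mul0r mul0r.
  by rewrite /tri divr_ge0 // mulr_ge0 // subr_ge0 ler1n.
have t0 : 0 <= ((K + k0)%:R - 1) * tri (i %/ 2 ^ k0).
  by rewrite mulr_ge0 // subr_ge0 ler1n; move: K4; clear; lia.
have xN : N * x k0 = 4%:R.
  by rewrite -(@pw_ix i k0 2) //; rewrite k0E; move: K4; clear; lia.
have wx : - 2%:R <= w * x k0 ^+ 2.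
  have : - (N ^+ 2 / 8%:R) * x k0 ^+ 2 <= w * x k0 ^+ 2 by rewrite ler_wpM2r // sqr_ge0.
  have -> : - (N ^+ 2 / 8%:R) * x k0 ^+ 2 = - ((N * x k0) ^+ 2 / 8%:R) by field.
  by rewrite xN; lra.
have i2 : 2%:R <= i%:R :> R by rewrite ler_nat.
have ixp : 0 <= i%:R * x k0 by rewrite mulr_ge0 // ltW // ix_gt0.
move: Z T t0 Ki wx i2 ixp; move: (tri i) (_ * tri _) (Psum i k0)%:R => a b c; lra.
Qed.

Lemma sum_depth_lo : (4 <= K)%N -> ~~ (3%:R / 4%:R < pp R i) ->
  (\sum_(0 <= m < i) m * depth_rev i m)%:R <= (K%:R - 1) * tri i + 4%:R / 3%:R * wlo + 25%:R * i%:R.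
Proof.
move=> K4 hp; apply: (sum_depth_le K4 erefl) => [|k hk]; last by apply: Psum_step_lo => //; lia.
have := le_pw; have := pw_le2; rewrite /wlo; have : 0 <= i%:R :> R by [].
move: (i%:R) N => u v h0 h1 h2; nra.
Qed.

Lemma sum_depth_hi : (4 <= K)%N -> 3%:R / 4%:R < pp R i ->
  (\sum_(0 <= m < i) m * depth_rev i m)%:R <= (K%:R - 1) * tri i + 4%:R / 3%:R * whi + 25%:R * i%:R.
Proof.
move=> K4 hp; apply: (sum_depth_le K4 erefl) => [|k hk]; last by apply: Psum_step_hi => //; lia.
have Ni : 3%:R * N <= 4%:R * i%:R.
  by rewrite /pw -!natrM ler_nat; move: hp; rewrite pp_gt34 //; exact: ltnW.
rewrite /whi; have : 0 <= i%:R :> R by [].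
move: Ni; move: (i%:R) N => u v h0 h1; nra.
Qed.

End Fixed.

Definition bsum (m : nat) : nat := (\sum_(0 <= k < m) rcost m k)%N.

Lemma bsumE m : (0 < m)%N -> (bsum m)%:R = m%:R * ((clg m)%:R + 1) - pw m :> R.
Proof.
move=> m0; have := sum_rcost m; rewrite -/(bsum m) (_ : (m == 0) = false)%N ?addn0; last by lia.
by move=> /(congr1 (fun n => n%:R : R)); rewrite natrD natrM -natr1 => <-; rewrite /pw addrK.
Qed.

(** Within an octave K and N are constant; the terms N^2 / 6 + N / 2 + 1/3 are those that make the
    formulas of neighbouring octaves agree at powers of two. *)
Lemma sum_bsum i : (0 < i)%N -> (\sum_(0 <= m < i) bsum m)%:R
  = ((clg i)%:R + 1) * tri i - pw i * i%:R + pw i ^+ 2 / 6%:R + pw i / 2%:R + 1 / 3%:R :> R.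
Proof.
elim: i => // -[|i] IH _.
  by rewrite big_nat1 /bsum big_geq // /tri /pw /clg up_log1 expn0; field.
rewrite big_nat_recr //= natrD IH // bsumE //.
set n := i.+1; have Tn : tri n.+1 = tri n + n%:R by rewrite /tri -natr1; field.
have [h|h] : (n.+1 <= 2 ^ clg n)%N \/ n = (2 ^ clg n)%N.
  by have := leq_clg n; rewrite leq_eqVlt => /orP[/eqP h|h]; [right|left].
  have -> : clg n.+1 = clg n.
    by apply/eqP; rewrite eqn_leq clg_min // leq_clg2.
  by rewrite /pw (_ : clg n.+1 = clg n) ?Tn -?(natr1 n); [ring | apply/eqP; rewrite eqn_leq clg_min // leq_clg2].
have E : clg n.+1 = (clg n).+1.
  by apply: clg_eq; rewrite ?expnS -?h // /n; clear; lia.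
rewrite /pw E Tn expnS natrM -h -(natr1 n) -(natr1 (clg n)) /tri.
by move: (n%:R : R) ((clg n)%:R : R) => a b; field.
Qed.

End Beta.

(** * Average cost of inserting one pair *)

Section Step.
Variable R : realType.

Lemma two_merge_costC i a b : two_merge_cost R i a b = two_merge_cost R i b a.
Proof. by rewrite /two_merge_cost minnC maxnC. Qed.

Lemma sum_two_merge_cost_row i a : a < i ->
  \sum_(a.+1 <= b < i) two_merge_cost R i a b = (i.-1 - a) + (i.-1 - a) * depthA R i a + bsum (i.-1 - a).
Proof.
move=> ai; rewrite -{1}[a.+1]add0n big_addn.
have -> : i - a.+1 = i.-1 - a by lia.
rewrite (eq_big_nat _ _ (F2 := fun k => (1 + depthA R i a) + rcost (i.-1 - a) k)); last first.
  move=> k /andP[_ hk]; rewrite /two_merge_cost (minn_idPl _); last by lia.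
  rewrite (maxn_idPr _); last by lia.
  by congr (_ + rcost _ _); lia.
by rewrite big_split /= sum_nat_const_nat subn0 mulnDr muln1.
Qed.

(** The cost is symmetric in the two ranks, so only a < b has to be counted; reversing a gives the
    weights m. *)
Lemma sum_two_merge_cost i : 0 < i ->
  \sum_(a <- iota 0 i) \sum_(b <- iota 0 i | b != a) two_merge_cost R i a b
  = 2 * \sum_(0 <= m < i) (m + m * depth_rev R i m + bsum m).
Proof.
move=> i0.
have -> : \sum_(0 <= m < i) (m + m * depth_rev R i m + bsum m) = \sum_(0 <= a < i) \sum_(a.+1 <= b < i) two_merge_cost R i a b.
  rewrite big_nat_rev /= add0n big_nat [RHS]big_nat; apply: eq_bigr => a /andP[_ ai].
  have -> : i - a.+1 = i.-1 - a by lia.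
  by rewrite sum_two_merge_cost_row // /depth_rev; have -> : i.-1 - (i.-1 - a) = a by lia.
have E (a : nat) : a < i -> \sum_(b <- iota 0 i | b != a) two_merge_cost R i a b
   = \sum_(0 <= b < a) two_merge_cost R i a b + \sum_(a.+1 <= b < i) two_merge_cost R i a b.
  move=> ai; have -> : iota 0 i = index_iota 0 a ++ a :: index_iota a.+1 i.
    rewrite /index_iota subn0 -[a :: _]/(iota a (i - a.+1).+1) -[in iota a _](add0n a) -iotaD.
    by congr iota; lia.
  rewrite big_cat big_cons eqxx /=; congr (_ + _).
    rewrite big_nat_cond [RHS]big_nat_cond; apply: eq_bigl => b.
    by clear; lia.
  rewrite big_nat_cond [RHS]big_nat_cond; apply: eq_bigl => b.
  by clear - ai; lia.
transitivity (\sum_(0 <= a < i) (\sum_(0 <= b < a) two_merge_cost R i a b + \sum_(a.+1 <= b < i) two_merge_cost R i a b)).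
  by rewrite /index_iota subn0; apply: eq_big_seq => a; rewrite mem_iota => /E.
rewrite big_split /= mul2n -addnn; congr (_ + _).
transitivity (\sum_(0 <= j < i) \sum_(j.+1 <= a < i) two_merge_cost R i a j); last first.
  by apply: eq_bigr => a _; apply: eq_bigr => b _; apply: two_merge_costC.
transitivity (\sum_(0 <= a < i) \sum_(0 <= b < i) if b < a then two_merge_cost R i a b else 0).
  rewrite big_nat [RHS]big_nat; apply: eq_bigr => a /andP[_ ai].
  rewrite -big_mkcond /= (big_nat_widen 0 a i) //; last exact: ltnW.
rewrite exchange_big /= big_nat [RHS]big_nat; apply: eq_bigr => j /andP[_ ji].
by rewrite -big_mkcond /= [RHS](big_nat_widenl j.+1 0 i).
Qed.

Local Open Scope ring_scope.

Definition avg_ins (m : nat) : R := (clg m)%:R + 1 - pw R m / m%:R.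

Definition avg_two_merge (i : nat) : R :=
  1 + ((\sum_(0 <= m < i) m * depth_rev R i m)%N%:R + (\sum_(0 <= m < i) bsum m)%N%:R) / tri R i.

Definition avg_step (i : nat) : R :=
  if in_2merge_range (pp R i) then avg_two_merge i else avg_ins i.-1 + avg_ins i.

Lemma bsum_avg_ins m : (0 < m)%N -> (bsum m)%:R = m%:R * avg_ins m.
Proof.
move=> m0; have m1 : m%:R != 0 :> R by rewrite pnatr_eq0 -lt0n.
by rewrite bsumE // /avg_ins mulrBr mulrCA mulfV // mulr1.
Qed.

Lemma avg_rank1 (l : seq nat) i : uniq l -> (0 < i <= size l)%N ->
  (\sum_(t <- permutations l) rcost i (rank (nth 0 t i.-1) (take i t)))%:R
  = (size l)`!%:R * avg_ins i :> R.
Proof.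
move=> ul /andP[i0 il]; have hi : (0 < i <= size l)%N by rewrite i0 il.
have := sum_rank1 (rcost i) ul hi.
have -> : (\sum_(a <- iota 0 i) rcost i a = bsum i)%N by rewrite /bsum /index_iota subn0.
move=> /(congr1 (fun n => n%:R : R)); rewrite !natrM bsum_avg_ins // mulrCA => /mulfI; apply.
by rewrite pnatr_eq0 -lt0n.
Qed.

Lemma avg_step_cost (l : seq nat) i : uniq l -> (2 <= i <= size l)%N ->
  (\sum_(t <- permutations l) step_cost R t i)%:R = (size l)`!%:R * avg_step i.
Proof.
move=> ul /andP[i1 il]; rewrite /step_cost /avg_step.
case: ifP => _.
  have hi : (1 < i <= size l)%N by rewrite i1 il.
  have := sum_rank2 (two_merge_cost R i) ul hi; rewrite sum_two_merge_cost; last by lia.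
  have -> : (\sum_(0 <= m < i) (m + m * depth_rev R i m + bsum m)
     = \sum_(0 <= m < i) m + \sum_(0 <= m < i) m * depth_rev R i m + \sum_(0 <= m < i) bsum m)%N.
    by rewrite -!big_split.
  move=> /(congr1 (fun n => n%:R : R)).
  rewrite natrM (natrM _ i) (natrM _ (size l)`!) (natrM _ 2) natrD (natrD _ (\sum_(_ <= m < _) m)%N) sum_id //.
  have T0 : tri R i != 0.
    by rewrite /tri mulf_neq0 ?invr_neq0 ?mulf_neq0 ?pnatr_eq0 // ?subr_eq0 ?pnatr_eq1; lia.
  have TE : i%:R * i.-1%:R = 2%:R * tri R i.
    by rewrite /tri -subn1 natrB ?(ltnW i1) //; field.
  rewrite TE /avg_two_merge.
  have -> : tri R 0 = 0 by rewrite /tri mul0r mul0r.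
  move: (\sum_(t <- _) _)%N%:R (\sum_(0 <= m < i) m * _)%N%:R (\sum_(0 <= m < i) bsum m)%N%:R => u v w h.
  have T2 : 2%:R * tri R i != 0 by rewrite mulf_neq0 // pnatr_eq0.
  by apply: (mulfI T2); rewrite h; field.
have h1 : (0 < i.-1 <= size l)%N by clear - i1 il; lia.
have h2 : (0 < i <= size l)%N by clear - i1 il; lia.
have a1 := avg_rank1 ul h1; have a2 := avg_rank1 ul h2.
by rewrite big_split natrD mulrDr -a2 -a1.
Qed.

(** Dividing by i (i - 1) / 2 instead of i^2 / 2 changes the quotient by O(1/i). The constant 120 is
    large enough already at i = 2, where 60 (i - 1) has to cover 29.5 i. *)
Lemma ratio_bound (i X E : R) : 2%:R <= i -> X <= 3%:R / 2%:R * i ^+ 2 -> E <= X + 28%:R * i ->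
  E / (i * (i - 1) / 2%:R) <= 2%:R * X / i ^+ 2 + 120%:R / i.
Proof.
move=> i2 hX hE; have i0 : 0 < i by lra.
have T0 : 0 < i * (i - 1) / 2%:R by rewrite divr_gt0 // mulr_gt0 //; lra.
rewrite ler_pdivrMr //.
have -> : (2%:R * X / i ^+ 2 + 120%:R / i) * (i * (i - 1) / 2%:R) = X - X / i + 60%:R * (i - 1).
  by field; lra.
have : X / i <= 3%:R / 2%:R * i.
  by rewrite ler_pdivrMr // (_ : 3%:R / 2%:R * i * i = 3%:R / 2%:R * i ^+ 2) //; ring.
lra.
Qed.

Section Bounds.
Variable i : nat.
Hypothesis i1 : (1 < i)%N.
Hypothesis K4 : (4 <= clg i)%N.
Local Notation K := ((clg i)%:R : R).
Local Notation N := (pw R i).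

Let i2 : 2%:R <= i%:R :> R. Proof. by rewrite ler_nat. Qed.
Let Ni2 : N <= 2%:R * i%:R. Proof. exact: pw_le2. Qed.
Let iN : i%:R <= N. Proof. exact: le_pw. Qed.

Lemma tri_gt0 : 0 < tri R i.
Proof. by rewrite /tri divr_gt0 // mulr_gt0 //; move: i2; lra. Qed.

Lemma avg_ins2_le : avg_ins i.-1 + avg_ins i <= 2%:R * K + 2%:R - 2%:R * (N / i%:R).
Proof.
have ip : 0 < i%:R :> R by move: i2; lra.
have i3 : (2 < i)%N by case: (i) K4 i1 => [|[|[|n]]] //; rewrite /clg up_lognn.
have j0 : 0 < i.-1%:R :> R by rewrite ltr0n; lia.
have jE : i.-1%:R = i%:R - 1 :> R by rewrite -subn1 natrB // ltnW.
have h : avg_ins i.-1 <= K + 1 - N / i.-1%:R.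
  (* If i - 1 is a power of two it belongs to the previous octave, but m -> clg m + 1 - 2^(clg m) /
     m extends continuously: both formulas give K - 1. *)
  have [E|[E1 E2]] : clg i.-1 = clg i \/ i.-1 = (2 ^ (clg i).-1)%N /\ clg i.-1 = (clg i).-1.
    have [b1 b2] := clg_pow_bounds i1.
    have Kp : (clg i).-1.+1 = clg i by apply: prednK; apply: leq_trans K4.
    have b3 : (2 ^ (clg i).-1 <= i.-1)%N by move: b1; rewrite -Kp expnS /=; lia.
    move: b3; rewrite leq_eqVlt => /orP[/eqP E|b3].
      by right; split=> //; rewrite -E clg_exp.
    by left; rewrite -Kp; apply: clg_eq => //; rewrite Kp; lia.
  - by rewrite /avg_ins /pw E.
  - rewrite /avg_ins /pw E2 E1.
    have Kp : (clg i).-1.+1 = clg i by apply: prednK; apply: leq_trans K4.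
    have KE : K = (clg i).-1%:R + 1 by rewrite natr1 Kp.
    rewrite KE -{5}Kp expnS natrM mulfK ?mulfV ?pnatr_eq0 ?expn_eq0 //; lra.
have h2 : N / i%:R <= N / i.-1%:R.
  by rewrite ler_wpM2l ?ler0n // lef_pV2 ?posrE //; rewrite jE; lra.
rewrite /avg_ins in h *; lra.
Qed.

Lemma avg_two_merge_le (w X : R) : X = 4%:R / 3%:R * w - N * i%:R + N ^+ 2 / 6%:R -> X <= 3%:R / 2%:R * i%:R ^+ 2 ->
  (\sum_(0 <= m < i) m * depth_rev R i m)%N%:R <= (K - 1) * tri R i + 4%:R / 3%:R * w + 25%:R * i%:R ->
  avg_two_merge i <= 2%:R * K + 1 + 2%:R * X / i%:R ^+ 2 + 120%:R / i%:R.
Proof.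
move=> XE hX hd; rewrite /avg_two_merge sum_bsum; last by lia.
have T0 := tri_gt0.
set a := (\sum_(0 <= m < i) _)%N%:R in hd *.
set E := a + _.
have : (E - 2%:R * K * tri R i) / tri R i <= 2%:R * X / i%:R ^+ 2 + 120%:R / i%:R.
  apply: ratio_bound => //; rewrite /E XE; move: hd Ni2 i2; lra.
rewrite mulrBl mulfK ?gt_eqF //; lra.
Qed.

Let p := pp R i.
Let pE : p = i%:R / N. Proof. by []. Qed.
Let N0 : 0 < N. Proof. by rewrite ltr0n expn_gt0. Qed.
Let p0 : 0 < p. Proof. by rewrite pE divr_gt0 // ltr0n ltnW. Qed.

Lemma avg_two_merge_lo : p <= 3%:R / 4%:R ->
  avg_two_merge i <= 2%:R * K + 3%:R - 7%:R / 2%:R * (N / i%:R) + 25%:R / 48%:R * (N / i%:R) ^+ 2 + 120%:R / i%:R.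
Proof.
move=> hp; have ip : 0 < i%:R :> R by move: i2; lra.
have hp' : ~~ (3%:R / 4%:R < pp R i) by rewrite -leNgt.
apply: le_trans (avg_two_merge_le erefl _ (sum_depth_lo i1 K4 hp')) _.
  by rewrite /wlo; move: Ni2 iN ip; move: (i%:R : R) N => u v; nra.
rewrite /wlo le_eqVlt; apply/orP; left; apply/eqP; field.
by rewrite gt_eqF.
Qed.

Lemma avg_two_merge_hi : 3%:R / 4%:R < p ->
  avg_two_merge i <= 2%:R * K + 4%:R - 5%:R * (N / i%:R) + 13%:R / 12%:R * (N / i%:R) ^+ 2 + 120%:R / i%:R.
Proof.
move=> hp; have ip : 0 < i%:R :> R by move: i2; lra.
apply: le_trans (avg_two_merge_le erefl _ (sum_depth_hi i1 K4 hp)) _.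
  by rewrite /whi; move: Ni2 iN ip; move: (i%:R : R) N => u v; nra.
rewrite /whi le_eqVlt; apply/orP; left; apply/eqP; field.
by rewrite gt_eqF.
Qed.

Let yE : N / i%:R = p^-1. Proof. by rewrite pE invf_div. Qed.

(** The difference of the two costs is p^-2 (p^2 - 3p/2 + 25/48), with roots 3/4 -+ sqrt 6 / 12: the
    lower end of the 2Merge range is the smaller root. *)
Lemma cross_lo : p <= 3%:R / 4%:R ->
  if in_2merge_range p then 3%:R - 7%:R / 2%:R * p^-1 + 25%:R / 48%:R * p^-1 ^+ 2 <= 2%:R - 2%:R * p^-1
  else 2%:R - 2%:R * p^-1 <= 3%:R - 7%:R / 2%:R * p^-1 + 25%:R / 48%:R * p^-1 ^+ 2.
Proof.
move=> hp; have s3 : 0 <= Num.sqrt (3%:R : R) := sqrtr_ge0 _.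
have s6 : 0 <= Num.sqrt (6%:R : R) := sqrtr_ge0 _.
have e6 : Num.sqrt (6%:R : R) ^+ 2 = 6%:R by rewrite sqr_sqrtr.
have D : (3%:R - 7%:R / 2%:R * p^-1 + 25%:R / 48%:R * p^-1 ^+ 2) - (2%:R - 2%:R * p^-1)
  = p^-1 ^+ 2 * (p ^+ 2 - 3%:R / 2%:R * p + 25%:R / 48%:R) by field; rewrite gt_eqF.
have y2 : 0 <= p^-1 ^+ 2 by rewrite sqr_ge0.
rewrite /in_2merge_range (_ : p <= _ + _ = true) ?andbT; last by lra.
case: leP => h.
  rewrite -subr_le0 D mulr_ge0_le0 //; nra.
rewrite -subr_ge0 D mulr_ge0 //; nra.
Qed.

(** Here the quadratic is 2p^2 - 3p + 13/12, with roots 3/4 -+ sqrt 3 / 12; the larger root is the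
    upper end of the 2Merge range. *)
Lemma cross_hi : 3%:R / 4%:R < p ->
  if in_2merge_range p then 4%:R - 5%:R * p^-1 + 13%:R / 12%:R * p^-1 ^+ 2 <= 2%:R - 2%:R * p^-1
  else 2%:R - 2%:R * p^-1 <= 4%:R - 5%:R * p^-1 + 13%:R / 12%:R * p^-1 ^+ 2.
Proof.
move=> hp; have s3 : 0 <= Num.sqrt (3%:R : R) := sqrtr_ge0 _.
have s6 : 0 <= Num.sqrt (6%:R : R) := sqrtr_ge0 _.
have e3 : Num.sqrt (3%:R : R) ^+ 2 = 3%:R by rewrite sqr_sqrtr.
have D : (4%:R - 5%:R * p^-1 + 13%:R / 12%:R * p^-1 ^+ 2) - (2%:R - 2%:R * p^-1)
  = p^-1 ^+ 2 * (2%:R * p ^+ 2 - 3%:R * p + 13%:R / 12%:R) by field; rewrite gt_eqF.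
have y2 : 0 <= p^-1 ^+ 2 by rewrite sqr_ge0.
rewrite /in_2merge_range (_ : _ - _ <= p = true) ?andTb; last by lra.
case: leP => h.
  rewrite -subr_le0 D mulr_ge0_le0 //; nra.
rewrite -subr_ge0 D mulr_ge0 //; nra.
Qed.

Lemma avg_step_lo : p <= 3%:R / 4%:R ->
  avg_step i <= 2%:R * K + 3%:R - 7%:R / 2%:R * (N / i%:R) + 25%:R / 48%:R * (N / i%:R) ^+ 2 + 120%:R / i%:R
  /\ avg_step i <= 2%:R * K + 2%:R - 2%:R * (N / i%:R) + 120%:R / i%:R.
Proof.
move=> hp; have := cross_lo hp; have := avg_two_merge_lo hp; have := avg_ins2_le.
have : 0 <= 120%:R / i%:R :> R by rewrite divr_ge0.
rewrite /avg_step -/p yE; move: (120%:R / i%:R) (p^-1 ^+ 2) => e y2.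
by case: ifP => _ h1 h2 h3 h4; split; lra.
Qed.

Lemma avg_step_hi : 3%:R / 4%:R < p ->
  avg_step i <= 2%:R * K + 4%:R - 5%:R * (N / i%:R) + 13%:R / 12%:R * (N / i%:R) ^+ 2 + 120%:R / i%:R
  /\ avg_step i <= 2%:R * K + 2%:R - 2%:R * (N / i%:R) + 120%:R / i%:R.
Proof.
move=> hp; have := cross_hi hp; have := avg_two_merge_hi hp; have := avg_ins2_le.
have : 0 <= 120%:R / i%:R :> R by rewrite divr_ge0.
rewrite /avg_step -/p yE; move: (120%:R / i%:R) (p^-1 ^+ 2) => e y2.
by case: ifP => _ h1 h2 h3 h4; split; lra.
Qed.

End Bounds.
End Step.

Local Open Scope ring_scope.

(** * Rational bounds for logarithms and numerical values *)

Section Artanh.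
Variable R : realType.

Definition artpoly (a b : R) : {poly R} := 2%:R *: 'X + a *: 'X^3 + b *: 'X^5.

Definition artdiff (a b : R) : R -> R :=
  (@ln R \o (cst 1 + id)) - (@ln R \o (cst 1 - id)) - horner (artpoly a b).

Lemma artdiffE a b y : artdiff a b y = ln (1 + y) - ln (1 - y) - (2%:R * y + a * y ^+ 3 + b * y ^+ 5).
Proof. by rewrite /artdiff /artpoly /= !(fctE, hornerE). Qed.

Lemma is_derive_artdiff (a b y : R) : -1 < y < 1 ->
  is_derive y 1 (artdiff a b) ((1 + y)^-1 + (1 - y)^-1 - (2%:R + 3%:R * a * y ^+ 2 + 5%:R * b * y ^+ 4)).
Proof.
move=> /andP[h1 h2].
have p1 : 0 < 1 + y by lra.
have p2 : 0 < 1 - y by lra.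
have d1 : is_derive y 1 (@ln R \o (cst 1 + id)) ((1 + y)^-1 * (0 + 1)).
  by apply: is_derive1_comp; exact: is_derive1_ln.
have d2 : is_derive y 1 (@ln R \o (cst 1 - id)) ((1 - y)^-1 * (0 - 1)).
  by apply: is_derive1_comp; exact: is_derive1_ln.
have d3 : is_derive y 1 (horner (artpoly a b)) (2%:R + 3%:R * a * y ^+ 2 + 5%:R * b * y ^+ 4).
  apply: is_derive_eq; rewrite /artpoly.
  have -> : (deriv (2%:R *: 'X + a *: 'X^3 + b *: 'X^5)).[y]
    = 2%:R + a * (y ^+ 2 *+ 3) + b * (y ^+ 4 *+ 5).
    by rewrite !derivD !derivZ derivX !derivXn !(hornerD, hornerZ, hornerMn, hornerXn) hornerC mulr1.
  by ring.
rewrite /artdiff; apply: is_derive_eq (is_deriveB (is_deriveB d1 d2) d3) _; ring.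
Qed.

Lemma artdiff_mvt (a b y : R) : 0 < y < 1 -> exists2 c, 0 < c < y &
  ln (1 + y) - ln (1 - y) - (2%:R * y + a * y ^+ 3 + b * y ^+ 5)
  = ((1 + c)^-1 + (1 - c)^-1 - (2%:R + 3%:R * a * c ^+ 2 + 5%:R * b * c ^+ 4)) * y.
Proof.
move=> /andP[y0 y1].
have [||c] := @MVT R (artdiff a b) (fun c => (1 + c)^-1 + (1 - c)^-1 - (2%:R + 3%:R * a * c ^+ 2 + 5%:R * b * c ^+ 4)) 0 y y0.
- move=> x; rewrite in_itv /= => /andP[x0 xy]; apply: is_derive_artdiff; lra.
- apply: derivable_within_continuous => x; rewrite in_itv /= => /andP[x0 xy].
  have hx : -1 < x < 1 by lra.
  by case: (is_derive_artdiff a b hx).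
rewrite in_itv /= => cy E; exists c => //; rewrite -artdiffE.
have F0 : artdiff a b 0 = 0 by rewrite artdiffE !expr0n /= addr0 subr0 ln1; ring.
by rewrite -[LHS]subr0 -[X in _ - X]F0 E subr0.
Qed.

Lemma artanh_ge (y : R) : 0 <= y < 1 -> 2%:R * y + 2%:R / 3%:R * y ^+ 3 <= ln (1 + y) - ln (1 - y).
Proof.
move=> /andP[]; rewrite le_eqVlt => /orP[/eqP <- _|y0 y1].
  by rewrite addr0 subr0 subrr expr0n /=; lra.
have hy : 0 < y < 1 by rewrite y0.
have [c /andP[c0 cy]] := artdiff_mvt (2%:R / 3%:R) 0 hy.
rewrite mul0r addr0 => E; rewrite -subr_ge0 E; apply: mulr_ge0; last exact: ltW.
have c1 : 0 < 1 + c by lra.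
have c2 : 0 < 1 - c by lra.
have -> : (1 + c)^-1 + (1 - c)^-1 - (2%:R + 3%:R * (2%:R / 3%:R) * c ^+ 2 + 5%:R * 0 * c ^+ 4)
  = 2%:R * c ^+ 4 * ((1 + c)^-1 * (1 - c)^-1) by field; rewrite !gt_eqF.
by rewrite !mulr_ge0 ?invr_ge0 ?exprn_even_ge0 // ltW.
Qed.

(** For c <= 1/2 one has 1 / (1 - c^2) <= 4/3, so the derivative 2 c^4 / (1 - c^2) of the remainder
    is at most 8/3 c^4; this gives the coefficient 8/15. *)
Lemma artanh_le (y : R) : 0 <= y <= 1 / 2%:R ->
  ln (1 + y) - ln (1 - y) <= 2%:R * y + 2%:R / 3%:R * y ^+ 3 + 8%:R / 15%:R * y ^+ 5.
Proof.
move=> /andP[]; rewrite le_eqVlt => /orP[/eqP <- _|y0 y1].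
  by rewrite addr0 subr0 subrr !expr0n /=; lra.
have hy : 0 < y < 1 by rewrite y0; lra.
have [c /andP[c0 cy] E] := artdiff_mvt (2%:R / 3%:R) (8%:R / 15%:R) hy.
rewrite -subr_le0 E mulr_le0_ge0 //; last exact: ltW.
have c1 : 0 < 1 + c by lra.
have c2 : 0 < 1 - c by lra.
have -> : (1 + c)^-1 + (1 - c)^-1 - (2%:R + 3%:R * (2%:R / 3%:R) * c ^+ 2 + 5%:R * (8%:R / 15%:R) * c ^+ 4)
  = (2%:R * c ^+ 4 * ((1 + c)^-1 * (1 - c)^-1)) * ((4%:R * c ^+ 2 - 1) / 3%:R) by field; rewrite !gt_eqF.
rewrite mulr_ge0_le0 //; first by rewrite !mulr_ge0 ?invr_ge0 ?exprn_even_ge0 // ltW.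
by nra.
Qed.

Lemma ln_ratio (x t : R) : 0 < x -> 0 < t ->
  ln x - ln t = ln (1 + (x - t) / (x + t)) - ln (1 - (x - t) / (x + t)).
Proof.
move=> x0 t0; have xt : 0 < x + t by lra.
have -> : 1 + (x - t) / (x + t) = (2%:R / (x + t)) * x by field; rewrite gt_eqF.
have -> : 1 - (x - t) / (x + t) = (2%:R / (x + t)) * t by field; rewrite gt_eqF.
have c0 : 0 < 2%:R / (x + t) by rewrite divr_gt0.
rewrite (@lnM _ (_ / _) x) ?(@lnM _ (_ / _) t) ?posrE //; ring.
Qed.

Lemma ln_ge_up (x t : R) : 0 < t -> t <= x ->
  ln t + 2%:R * (x - t) / (x + t) <= ln x.
Proof.
move=> t0 tx; have x0 : 0 < x by lra.
have xt : 0 < x + t by lra.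
have y0 : 0 <= (x - t) / (x + t) by rewrite divr_ge0 //; lra.
have hy : 0 <= (x - t) / (x + t) < 1 by rewrite y0 /= ltr_pdivrMr // mul1r; lra.
have := artanh_ge hy; rewrite -ln_ratio //.
rewrite (_ : 2%:R * (x - t) / (x + t) = 2%:R * ((x - t) / (x + t))); last by rewrite mulrA.
have : 0 <= ((x - t) / (x + t)) ^+ 3 by rewrite exprn_ge0.
by move: ((x - t) / (x + t)) => y; lra.
Qed.

Lemma artanh_le_aux (y : R) : 0 <= y <= 1 / 2%:R ->
  ln (1 + y) - ln (1 - y) <= 2%:R * y / (1 - y ^+ 2).
Proof.
move=> hy; apply: le_trans (artanh_le hy) _; case/andP: hy => y0 y1.
have y2 : 0 < 1 - y ^+ 2 by nra.
rewrite ler_pdivlMr // -subr_ge0.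
have -> : 2%:R * y - (2%:R * y + 2%:R / 3%:R * y ^+ 3 + 8%:R / 15%:R * y ^+ 5) * (1 - y ^+ 2)
  = y ^+ 3 * (4%:R / 3%:R + 2%:R / 15%:R * y ^+ 2 + 8%:R / 15%:R * y ^+ 4) by field.
have h2 : 0 <= y ^+ 2 by rewrite exprn_ge0.
have h4 : 0 <= y ^+ 4 by rewrite exprn_ge0.
by rewrite mulr_ge0 ?exprn_ge0 //; lra.
Qed.

(** With y = (t - x) / (t + x), the bound 2y / (1 - y^2) equals (t^2 - x^2) / (2xt), whose only
    denominators are x and t; [t <= 3%:R * x] means y <= 1/2. *)
Lemma ln_ge_down (x t : R) : 0 < x -> x <= t -> t <= 3%:R * x ->
  ln t + (x ^+ 2 - t ^+ 2) / (2%:R * x * t) <= ln x.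
Proof.
move=> x0 xt tx; have t0 : 0 < t by lra.
have tx0 : 0 < t + x by lra.
have hy : 0 <= (t - x) / (t + x) <= 1 / 2%:R.
  by apply/andP; split; [rewrite divr_ge0 //; lra | rewrite ler_pdivrMr //; lra].
have := artanh_le_aux hy; rewrite -ln_ratio //.
have -> : 2%:R * ((t - x) / (t + x)) / (1 - ((t - x) / (t + x)) ^+ 2) = - ((x ^+ 2 - t ^+ 2) / (2%:R * x * t)).
  field; rewrite !gt_eqF //= ?mulr_gt0 //.
  by have -> : (t + x) ^+ 2 - (t - x) ^+ 2 = 4%:R * (x * t); [ring | rewrite !mulr_gt0].
lra.
Qed.

End Artanh.

Section Numerics.
Variable R : realType.
Local Notation ln := (@ln R).
(** Decimals to ten places, split in two so that the [nat] literals stay below one million. *)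
Local Notation dec a b := (a%:R / 100000%:R + b%:R / (100000%:R * 100000%:R)).

Lemma ln_quot_bounds (a b y : R) : 0 < b -> b <= a -> a <= 3%:R * b -> y * (a + b) = a - b ->
  2%:R * y + 2%:R / 3%:R * y ^+ 3 <= ln a - ln b
   <= 2%:R * y + 2%:R / 3%:R * y ^+ 3 + 8%:R / 15%:R * y ^+ 5.
Proof.
move=> b0 ba ab yE; have a0 : 0 < a by lra.
have ab0 : 0 < a + b by lra.
have {}yE : y = (a - b) / (a + b) by rewrite -yE mulfK // gt_eqF.
have y0 : 0 <= y by rewrite yE divr_ge0 //; lra.
have y1 : y <= 1 / 2%:R by rewrite yE ler_pdivrMr //; lra.
rewrite ln_ratio // -yE artanh_ge ?artanh_le //; first by rewrite y0 y1.
by rewrite y0 /=; lra.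
Qed.

(* The logarithms of 126/125, 225/224, 2401/2400, 4375/4374 determine ln 2, ln 3, ln 5, ln 7;
   then 57/56 gives ln 57. *)
Lemma ln_values : [/\ dec 69314 71793 <= ln 2%:R <= dec 69314 71818,
  dec 109861 22874 <= ln 3%:R <= dec 109861 22899,
  dec 160943 79112 <= ln 5%:R <= dec 160943 79137,
  dec 194590 101478 <= ln 7%:R <= dec 194590 101503 &
  dec 404305 12608 <= ln 57%:R <= dec 404305 12749].
Proof.
have p2 : 0 < 2%:R :> R by lra.
have p3 : 0 < 3%:R :> R by lra.
have p5 : 0 < 5%:R :> R by lra.
have p7 : 0 < 7%:R :> R by lra.
have X (x : R) n : 0 < x -> ln (x ^+ n) = n%:R * ln x by move=> x0; rewrite lnXn // mulr_natl.
have S (a b : R) : 0 < a -> 0 < b -> ln (a * b) = ln a + ln b by move=> a0 b0; rewrite lnM.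
have := @ln_quot_bounds (2%:R * 3%:R ^+ 2 * 7%:R) (5%:R ^+ 3) (1 / 251%:R)
  ltac:(clear; lra) ltac:(clear; lra) ltac:(clear; lra) ltac:(clear; lra).
have -> : ln (2%:R * 3%:R ^+ 2 * 7%:R) = ln 2%:R + 2%:R * ln 3%:R + ln 7%:R :> R by rewrite ?S ?X ?mulr_gt0 ?exprn_gt0 //; ring.
have -> : ln (5%:R ^+ 3) = 3%:R * ln 5%:R :> R by rewrite ?S ?X ?mulr_gt0 ?exprn_gt0 //; ring.
move=> q1.
have {q1} /andP[a1 b1] :
  79681%:R / (100000%:R * 100%:R) + 69648%:R / (100000%:R * 100000%:R * 100%:R) <= ln 2%:R + 2%:R * ln 3%:R + ln 7%:R - 3%:R * ln 5%:R
   <= 79681%:R / (100000%:R * 100%:R) + 69650%:R / (100000%:R * 100000%:R * 100%:R).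
  by case/andP: q1; clear; move: (ln 2%:R) (ln 3%:R) (ln 5%:R) (ln 7%:R) (ln 57%:R) => ? ? ? ? ? ? ?; apply/andP; split; lra.
have := @ln_quot_bounds (3%:R ^+ 2 * 5%:R ^+ 2) (2%:R ^+ 5 * 7%:R) (1 / 449%:R)
  ltac:(clear; lra) ltac:(clear; lra) ltac:(clear; lra) ltac:(clear; lra).
have -> : ln (3%:R ^+ 2 * 5%:R ^+ 2) = 2%:R * ln 3%:R + 2%:R * ln 5%:R :> R by rewrite ?S ?X ?mulr_gt0 ?exprn_gt0 //; ring.
have -> : ln (2%:R ^+ 5 * 7%:R) = 5%:R * ln 2%:R + ln 7%:R :> R by rewrite ?S ?X ?mulr_gt0 ?exprn_gt0 //; ring.
move=> q2.
have {q2} /andP[a2 b2] :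
  44543%:R / (100000%:R * 100%:R) + 50349%:R / (100000%:R * 100000%:R * 100%:R) <= 2%:R * ln 3%:R + 2%:R * ln 5%:R - (5%:R * ln 2%:R + ln 7%:R)
   <= 44543%:R / (100000%:R * 100%:R) + 50350%:R / (100000%:R * 100000%:R * 100%:R).
  by case/andP: q2; clear; move: (ln 2%:R) (ln 3%:R) (ln 5%:R) (ln 7%:R) (ln 57%:R) => ? ? ? ? ? ? ?; apply/andP; split; lra.
have := @ln_quot_bounds (7%:R ^+ 4) (2%:R ^+ 5 * 3%:R * 5%:R ^+ 2) (10%:R / 48010%:R)
  ltac:(clear; lra) ltac:(clear; lra) ltac:(clear; lra) ltac:(clear; lra).
have -> : ln (7%:R ^+ 4) = 4%:R * ln 7%:R :> R by rewrite ?S ?X ?mulr_gt0 ?exprn_gt0 //; ring.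
have -> : ln (2%:R ^+ 5 * 3%:R * 5%:R ^+ 2) = 5%:R * ln 2%:R + ln 3%:R + 2%:R * ln 5%:R :> R by rewrite ?S ?X ?mulr_gt0 ?exprn_gt0 //; ring.
move=> q3.
have {q3} /andP[a3 b3] :
  41650%:R / (100000%:R * 1000%:R) + 79885%:R / (100000%:R * 100000%:R * 100%:R) <= 4%:R * ln 7%:R - (5%:R * ln 2%:R + ln 3%:R + 2%:R * ln 5%:R)
   <= 41650%:R / (100000%:R * 1000%:R) + 79886%:R / (100000%:R * 100000%:R * 100%:R).
  by case/andP: q3; clear; move: (ln 2%:R) (ln 3%:R) (ln 5%:R) (ln 7%:R) (ln 57%:R) => ? ? ? ? ? ? ?; apply/andP; split; lra.
have := @ln_quot_bounds (5%:R ^+ 4 * 7%:R) (2%:R * 3%:R ^+ 7) (10%:R / 87490%:R)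
  ltac:(clear; lra) ltac:(clear; lra) ltac:(clear; lra) ltac:(clear; lra).
have -> : ln (5%:R ^+ 4 * 7%:R) = 4%:R * ln 5%:R + ln 7%:R :> R by rewrite ?S ?X ?mulr_gt0 ?exprn_gt0 //; ring.
have -> : ln (2%:R * 3%:R ^+ 7) = ln 2%:R + 7%:R * ln 3%:R :> R by rewrite ?S ?X ?mulr_gt0 ?exprn_gt0 //; ring.
move=> q4.
have {q4} /andP[a4 b4] :
  22850%:R / (100000%:R * 1000%:R) + 97555%:R / (100000%:R * 100000%:R * 100%:R) <= 4%:R * ln 5%:R + ln 7%:R - (ln 2%:R + 7%:R * ln 3%:R)
   <= 22850%:R / (100000%:R * 1000%:R) + 97556%:R / (100000%:R * 100000%:R * 100%:R).
  by case/andP: q4; clear; move: (ln 2%:R) (ln 3%:R) (ln 5%:R) (ln 7%:R) (ln 57%:R) => ? ? ? ? ? ? ?; apply/andP; split; lra.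
have := @ln_quot_bounds (57%:R) (2%:R ^+ 3 * 7%:R) (1 / 113%:R)
  ltac:(clear; lra) ltac:(clear; lra) ltac:(clear; lra) ltac:(clear; lra).
have -> : ln (2%:R ^+ 3 * 7%:R) = 3%:R * ln 2%:R + ln 7%:R :> R by rewrite ?S ?X ?mulr_gt0 ?exprn_gt0 //; ring.
move=> q5.
have {q5} /andP[a5 b5] :
  176995%:R / (100000%:R * 100%:R) + 77077%:R / (100000%:R * 100000%:R * 100%:R) <= ln 57%:R - (3%:R * ln 2%:R + ln 7%:R)
   <= 176995%:R / (100000%:R * 100%:R) + 77107%:R / (100000%:R * 100000%:R * 100%:R).
  by case/andP: q5; clear; move: (ln 2%:R) (ln 3%:R) (ln 5%:R) (ln 7%:R) (ln 57%:R) => ? ? ? ? ? ? ?; apply/andP; split; lra.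
move: a1 b1 a2 b2 a3 b3 a4 b4 a5 b5; clear.
move: (ln 2%:R) (ln 3%:R) (ln 5%:R) (ln 7%:R) (ln 57%:R) => l2 l3 l5 l7 l57.
set L1 := l2 + 2%:R * l3 + l7 - 3%:R * l5.
set L2 := 2%:R * l3 + 2%:R * l5 - (5%:R * l2 + l7).
set L3 := 4%:R * l7 - (5%:R * l2 + l3 + 2%:R * l5).
set L4 := 4%:R * l5 + l7 - (l2 + 7%:R * l3).
(* The matrix of exponents of 2, 3, 5, 7 in the four quotients is unimodular; the coefficients in
   these four lines are its inverse. *)
have e2 : l2 = 72%:R * L1 + 27%:R * L2 - 19%:R * L3 + 31%:R * L4 by rewrite /L1 /L2 /L3 /L4; ring.
have e3 : l3 = 114%:R * L1 + 43%:R * L2 - 30%:R * L3 + 49%:R * L4 by rewrite /L1 /L2 /L3 /L4; ring.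
have e5 : l5 = 167%:R * L1 + 63%:R * L2 - 44%:R * L3 + 72%:R * L4 by rewrite /L1 /L2 /L3 /L4; ring.
have e7 : l7 = 202%:R * L1 + 76%:R * L2 - 53%:R * L3 + 87%:R * L4 by rewrite /L1 /L2 /L3 /L4; ring.
move: e2 e3 e5 e7; move: L1 L2 L3 L4 => L1 L2 L3 L4 e2 e3 e5 e7 a1 b1 a2 b2 a3 b3 a4 b4 a5 b5.
have h2 : dec 69314 71793 <= l2 <= dec 69314 71818 by rewrite e2; clear - a1 b1 a2 b2 a3 b3 a4 b4; apply/andP; split; lra.
have h7 : dec 194590 101478 <= l7 <= dec 194590 101503 by rewrite e7; clear - a1 b1 a2 b2 a3 b3 a4 b4; apply/andP; split; lra.
split.
- exact: h2.
- by rewrite e3; clear - a1 b1 a2 b2 a3 b3 a4 b4; apply/andP; split; lra.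
- by rewrite e5; clear - a1 b1 a2 b2 a3 b3 a4 b4; apply/andP; split; lra.
- exact: h7.
- move: h2 h7 a5 b5; clear => /andP[? ?] /andP[? ?] ? ?; apply/andP; split; lra.
Qed.
End Numerics.

(** * The potential lies below p lg p - 1.41064 p on every range *)

Section Pieces.
Variable R : realType.
Local Notation ln := (@ln R).

Local Notation dec a b := (a%:R / 100000%:R + b%:R / (100000%:R * 100000%:R)).

Definition lin_cst : R := 141064%:R / 100000%:R.

(* Antiderivative of the average cost per element (less k), a - b/p + d/p^2. *)
Definition phi (a b d p : R) : R := a * p - b * ln p - d / p.
(** Half the coefficients of the pair costs, since a step inserts two elements: 2Merge for p <= 3/4,
    then 2Merge for p > 3/4, then RHBS. *)
Definition phi1 : R -> R := phi (3%:R / 2%:R) (7%:R / 4%:R) (25%:R / 96%:R).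
Definition phi2 : R -> R := phi 2%:R (5%:R / 2%:R) (13%:R / 24%:R).
Definition phi3 : R -> R := phi 1 1 0.

(* [offset1] makes offset1 + phi1 equal to -4/3 at 2/3, the worst case of MergeInsertion; the others
   continue it through the cut points, and [offset4] passes from N/2 to N. *)
Definition offset1 : R := - (7%:R / 3%:R) + 7%:R / 4%:R * ln (2%:R / 3%:R) + 25%:R / 64%:R.
Definition offset2 : R := offset1 + phi1 (3%:R / 4%:R) - phi2 (3%:R / 4%:R).
Definition offset3 : R := offset2 + phi2 (57%:R / 64%:R) - phi3 (57%:R / 64%:R).
Definition offset4 : R := - (1 / 2%:R) + (offset3 + phi3 1) / 2%:R - phi3 (1 / 2%:R).
Definition offset5 : R := offset4 + phi3 (35%:R / 64%:R) - phi1 (35%:R / 64%:R).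

Lemma ln_fracs : [/\ ln (2%:R / 3%:R) = ln 2%:R - ln 3%:R, ln (3%:R / 4%:R) = ln 3%:R - 2%:R * ln 2%:R,
  ln (57%:R / 64%:R) = ln 57%:R - 6%:R * ln 2%:R, ln (1 / 2%:R) = - ln 2%:R
  & ln (35%:R / 64%:R) = ln 5%:R + ln 7%:R - 6%:R * ln 2%:R] /\
  [/\ ln (25%:R / 27%:R) = 2%:R * ln 5%:R - 3%:R * ln 3%:R, ln (4%:R / 5%:R) = 2%:R * ln 2%:R - ln 5%:R,
  ln (3%:R / 5%:R) = ln 3%:R - ln 5%:R & ln (16%:R / 25%:R) = 4%:R * ln 2%:R - 2%:R * ln 5%:R].
Proof.
have D (a b : R) : 0 < a -> 0 < b -> ln (a / b) = ln a - ln b by move=> a0 b0; rewrite ln_div.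
have X n k : (0 < n)%N -> ln (n%:R ^+ k) = k%:R * ln n%:R by move=> n0; rewrite lnXn ?ltr0n // mulr_natl.
have e4 : ln 4%:R = 2%:R * ln 2%:R by rewrite -X // -natrX.
have e64 : ln 64%:R = 6%:R * ln 2%:R by rewrite -X // -natrX.
have e25 : ln 25%:R = 2%:R * ln 5%:R by rewrite -X // -natrX.
have e27 : ln 27%:R = 3%:R * ln 3%:R by rewrite -X // -natrX.
have e16 : ln 16%:R = 4%:R * ln 2%:R by rewrite -X // -natrX.
have e35 : ln 35%:R = ln 5%:R + ln 7%:R by rewrite -lnM ?posrE // -natrM.
by split; split; rewrite D // ?e4 ?e64 ?e25 ?e27 ?e16 ?e35 ?ln1 ?sub0r.
Qed.

Lemma offset_le : [/\ offset1 <= - (dec 265227 22500),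
  offset2 <= - (dec 286803 38000),
  offset3 <= - (dec 241184 82100),
  offset4 <= - (dec 239907 12700) &
  offset5 <= - (dec 264896 95600)].
Proof.
have [[q1 q2 q3 q4 q5] _] := ln_fracs; have [v2 v3 v5 v7 v57] := ln_values R.
have e1 : offset1 = - (7%:R / 3%:R) + 7%:R / 4%:R * (ln 2%:R - ln 3%:R) + 25%:R / 64%:R by rewrite /offset1 q1.
have e2 : offset2 = offset1 - 3%:R / 8%:R + 3%:R / 4%:R * (ln 3%:R - 2%:R * ln 2%:R) + 3%:R / 8%:R.
  by rewrite /offset2 /phi1 /phi2 /phi q2; field.
have e3 : offset3 = offset2 + 57%:R / 64%:R - 3%:R / 2%:R * (ln 57%:R - 6%:R * ln 2%:R) - 104%:R / 171%:R.
  by rewrite /offset3 /phi2 /phi3 /phi q3; field.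
have e4 : offset4 = - (1 / 2%:R) + (offset3 + 1) / 2%:R - (1 / 2%:R + ln 2%:R).
  by rewrite /offset4 /phi3 /phi q4 ln1; field.
have e5 : offset5 = offset4 - 35%:R / 128%:R + 3%:R / 4%:R * (ln 5%:R + ln 7%:R - 6%:R * ln 2%:R) + 10%:R / 21%:R.
  by rewrite /offset5 /phi1 /phi3 /phi q5; field.
move: v2 v3 v5 v7 v57 e1 e2 e3 e4 e5; clear.
move: offset1 offset2 offset3 offset4 offset5 (ln 2%:R) (ln 3%:R) (ln 5%:R) (ln 7%:R) (ln 57%:R) => o1 o2 o3 o4 o5 l2 l3 l5 l7 l57.
move=> /andP[? ?] /andP[? ?] /andP[? ?] /andP[? ?] /andP[? ?] -> -> -> -> ->; split; lra.
Qed.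

Definition inv_ln2_ub : R := dec 144269 51000.

(** As ln p <= 0, an upper bound for 1 / ln 2 yields a lower bound for lg p. *)
Lemma lg_ge (p : R) : 0 < p <= 1 -> inv_ln2_ub * (p * ln p) <= p * lg p.
Proof.
move=> /andP[p0 p1]; have [/andP[v2 _] _ _ _ _] := ln_values R.
have l0 : 0 < ln 2%:R by apply: lt_le_trans v2; lra.
have -> : p * lg p = p * ln p / ln 2%:R by rewrite /lg mulrA.
rewrite ler_pdivlMr // -subr_ge0.
have -> : p * ln p - inv_ln2_ub * (p * ln p) * ln 2%:R = (p * - ln p) * (inv_ln2_ub * ln 2%:R - 1) by ring.
apply: mulr_ge0; first by rewrite mulr_ge0 ?oppr_ge0 ?ln_le0 // ltW.
rewrite subr_ge0 /inv_ln2_ub.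
move: v2; clear; move: (ln 2%:R) => l2 v2; lra.
Qed.

Lemma ln_grid : [/\ - dec 28768 21000 <= ln (3%:R / 4%:R), - dec 22314 35800 <= ln (4%:R / 5%:R),
  - dec 11583 18400 <= ln (57%:R / 64%:R) & - dec 7696 10700 <= ln (25%:R / 27%:R)] /\
  [/\ - dec 60353 50500 <= ln (35%:R / 64%:R), - dec 51082 56500 <= ln (3%:R / 5%:R)
  & - dec 44628 71300 <= ln (16%:R / 25%:R)].
Proof.
have [[_ q2 q3 _ q5] [r1 r2 r3 r4]] := ln_fracs; have [v2 v3 v5 v7 v57] := ln_values R.
rewrite q2 q3 q5 r1 r2 r3 r4; move: v2 v3 v5 v7 v57; clear.
move: (ln 2%:R) (ln 3%:R) (ln 5%:R) (ln 7%:R) (ln 57%:R) => l2 l3 l5 l7 l57.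
move=> /andP[? ?] /andP[? ?] /andP[? ?] /andP[? ?] /andP[? ?]; split; split; lra.
Qed.

(** The cubic products are the Bernstein basis of the interval; once they are given as nonnegative,
    [lra] only has to find a nonnegative combination equal to [q]. *)
Lemma cubic_ge0 (p u v q : R) : u <= p <= v ->
  (0 <= p - u -> 0 <= v - p -> 0 <= (p - u) * (p - u) * (p - u) -> 0 <= (p - u) * (p - u) * (v - p) ->
   0 <= (p - u) * (v - p) * (v - p) -> 0 <= (v - p) * (v - p) * (v - p) -> 0 <= q) -> 0 <= q.
Proof.
by move=> /andP[pu pv]; rewrite -subr_ge0 in pu; rewrite -subr_ge0 in pv; apply; rewrite ?mulr_ge0.
Qed.

(* [ln p] is bounded below by an expression that agrees with it to second order at [t];
   the factor [p] (resp. [p + t]) clears the denominators and leaves a polynomial in [p]. *)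
Lemma potential_le_below (p t r a b d o O : R) : 0 < p <= 1 -> p <= t <= 3%:R * p -> 0 <= b ->
  r <= ln t -> o <= O ->
  0 <= (inv_ln2_ub * p + b) * (r * p + (p ^+ 2 - t ^+ 2) / (2%:R * t)) - (lin_cst + a) * p ^+ 2 - O * p + d ->
  o + phi a b d p <= p * lg p - lin_cst * p.
Proof.
move=> p01 /andP[pt tp] b0 hr ho hq; have /andP[p0 _] := p01; have t0 : 0 < t by exact: lt_le_trans pt.
have g0 : 0 <= inv_ln2_ub * p + b by rewrite addr_ge0 // mulr_ge0 ?(ltW p0) // /inv_ln2_ub; clear; lra.
have hw : r + (p ^+ 2 - t ^+ 2) / (2%:R * p * t) <= ln p.
  by apply: le_trans (ln_ge_down p0 pt tp); rewrite lerD2r.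
have := ler_wpM2l g0 hw; have := divr_ge0 hq (ltW p0).
have -> : ((inv_ln2_ub * p + b) * (r * p + (p ^+ 2 - t ^+ 2) / (2%:R * t)) - (lin_cst + a) * p ^+ 2 - O * p + d) / p
 = (inv_ln2_ub * p + b) * (r + (p ^+ 2 - t ^+ 2) / (2%:R * p * t)) - (lin_cst + a) * p - O + d / p.
  by move: inv_ln2_ub lin_cst => L c; field; rewrite !gt_eqF.
have := lg_ge p01; rewrite /phi; move: ho; clear.
move: (ln p) (lg p) (_ / (_ * t)) (d / p) inv_ln2_ub lin_cst => w g e i L c; lra.
Qed.

Lemma potential_le_above (p t r a b o O : R) : 0 < p <= 1 -> 0 < t <= p -> 0 <= b ->
  r <= ln t -> o <= O ->
  0 <= (inv_ln2_ub * p + b) * (r * (p + t) + 2%:R * (p - t)) - ((lin_cst + a) * p + O) * (p + t) ->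
  o + phi a b 0 p <= p * lg p - lin_cst * p.
Proof.
move=> p01 /andP[t0 tp] b0 hr ho hq; have /andP[p0 _] := p01; have pt : 0 < p + t by exact: addr_gt0.
have g0 : 0 <= inv_ln2_ub * p + b by rewrite addr_ge0 // mulr_ge0 ?(ltW p0) // /inv_ln2_ub; clear; lra.
have hw : r + 2%:R * (p - t) / (p + t) <= ln p.
  by apply: le_trans (ln_ge_up t0 tp); rewrite lerD2r.
have := ler_wpM2l g0 hw; have := divr_ge0 hq (ltW pt).
have -> : ((inv_ln2_ub * p + b) * (r * (p + t) + 2%:R * (p - t)) - ((lin_cst + a) * p + O) * (p + t)) / (p + t)
  = (inv_ln2_ub * p + b) * (r + 2%:R * (p - t) / (p + t)) - (lin_cst + a) * p - O.
  by move: inv_ln2_ub lin_cst => L c; field; rewrite !gt_eqF.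
have := lg_ge p01; rewrite /phi mul0r subr0; move: ho; clear.
move: (ln p) (lg p) (_ / (p + t)) inv_ln2_ub lin_cst => w g e L c; lra.
Qed.

Lemma offset1_phi1_le (p : R) : 2%:R / 3%:R <= p <= 3%:R / 4%:R -> offset1 + phi1 p <= p * lg p - lin_cst * p.
Proof.
move=> hp; have [[g _ _ _] _] := ln_grid; have [o _ _ _ _] := offset_le; have /andP[pu pv] := hp.
apply: (potential_le_below _ _ _ g o); [lra|lra|lra|].
by apply: (cubic_ge0 hp); rewrite /inv_ln2_ub /lin_cst; clear; lra.
Qed.

Lemma offset2_phi2_le_left (p : R) : 3%:R / 4%:R <= p <= 4%:R / 5%:R -> offset2 + phi2 p <= p * lg p - lin_cst * p.
Proof.
move=> hp; have [[_ g _ _] _] := ln_grid; have [_ o _ _ _] := offset_le; have /andP[pu pv] := hp.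
apply: (potential_le_below _ _ _ g o); [lra|lra|lra|].
by apply: (cubic_ge0 hp); rewrite /inv_ln2_ub /lin_cst; clear; lra.
Qed.

Lemma offset2_phi2_le_right (p : R) : 4%:R / 5%:R <= p <= 57%:R / 64%:R -> offset2 + phi2 p <= p * lg p - lin_cst * p.
Proof.
move=> hp; have [[_ _ g _] _] := ln_grid; have [_ o _ _ _] := offset_le; have /andP[pu pv] := hp.
apply: (potential_le_below _ _ _ g o); [lra|lra|lra|].
by apply: (cubic_ge0 hp); rewrite /inv_ln2_ub /lin_cst; clear; lra.
Qed.

(** The worst p is close to 25/27, where the two sides differ by about 6 * 10^-6. The bound for ln p
    is therefore centred there from both sides. *)
Lemma offset3_phi3_le_left (p : R) : 57%:R / 64%:R <= p <= 23%:R / 25%:R -> offset3 + phi3 p <= p * lg p - lin_cst * p.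
Proof.
move=> hp; have [[_ _ _ g] _] := ln_grid; have [_ _ o _ _] := offset_le; have /andP[pu pv] := hp.
apply: (potential_le_below _ _ _ g o); [lra|lra|lra|].
by apply: (cubic_ge0 hp); rewrite /inv_ln2_ub /lin_cst; clear; lra.
Qed.

Lemma offset3_phi3_le_mid (p : R) : 23%:R / 25%:R <= p <= 25%:R / 27%:R -> offset3 + phi3 p <= p * lg p - lin_cst * p.
Proof.
move=> hp; have [[_ _ _ g] _] := ln_grid; have [_ _ o _ _] := offset_le; have /andP[pu pv] := hp.
apply: (potential_le_below _ _ _ g o); [lra|lra|lra|].
by apply: (cubic_ge0 hp); rewrite /inv_ln2_ub /lin_cst; clear; lra.
Qed.

Lemma offset3_phi3_le_right (p : R) : 25%:R / 27%:R <= p <= 1 -> offset3 + phi3 p <= p * lg p - lin_cst * p.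
Proof.
move=> hp; have [[_ _ _ g] _] := ln_grid; have [_ _ o _ _] := offset_le; have /andP[pu pv] := hp.
apply: (potential_le_above _ _ _ g o); [lra|lra|lra|].
by apply: (cubic_ge0 hp); rewrite /inv_ln2_ub /lin_cst; clear; lra.
Qed.

Lemma offset4_phi3_le (p : R) : 1 / 2%:R <= p <= 35%:R / 64%:R -> offset4 + phi3 p <= p * lg p - lin_cst * p.
Proof.
move=> hp; have [_ [g _ _]] := ln_grid; have [_ _ _ o _] := offset_le; have /andP[pu pv] := hp.
apply: (potential_le_below _ _ _ g o); [lra|lra|lra|].
by apply: (cubic_ge0 hp); rewrite /inv_ln2_ub /lin_cst; clear; lra.
Qed.

Lemma offset5_phi1_le_left (p : R) : 35%:R / 64%:R <= p <= 3%:R / 5%:R -> offset5 + phi1 p <= p * lg p - lin_cst * p.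
Proof.
move=> hp; have [_ [_ g _]] := ln_grid; have [_ _ _ _ o] := offset_le; have /andP[pu pv] := hp.
apply: (potential_le_below _ _ _ g o); [lra|lra|lra|].
by apply: (cubic_ge0 hp); rewrite /inv_ln2_ub /lin_cst; clear; lra.
Qed.

Lemma offset5_phi1_le_right (p : R) : 3%:R / 5%:R <= p <= 638%:R / 1000%:R -> offset5 + phi1 p <= p * lg p - lin_cst * p.
Proof.
move=> hp; have [_ [_ _ g]] := ln_grid; have [_ _ _ _ o] := offset_le; have /andP[pu pv] := hp.
apply: (potential_le_below _ _ _ g o); [lra|lra|lra|].
by apply: (cubic_ge0 hp); rewrite /inv_ln2_ub /lin_cst; clear; lra.
Qed.

(** The left side is [MergeInsertion_avg] for k = K - 1, divided by N, less K p: the factor k leaves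
    - p, and 2^(k+2) / 3 is 2N/3. *)
Lemma merge_insertion_le_left (p : R) : 638%:R / 1000%:R <= p <= 16%:R / 25%:R ->
  - p - 2%:R / 3%:R - saving_rate R * (2%:R / 3%:R - p) <= p * lg p - lin_cst * p.
Proof.
move=> hp; have [_ [_ _ g]] := ln_grid; have /andP[pu pv] := hp.
have -> : - p - 2%:R / 3%:R - saving_rate R * (2%:R / 3%:R - p)
  = - (2%:R / 3%:R) * (1 + saving_rate R) + phi (saving_rate R - 1) 0 0 p by rewrite /phi !mul0r; ring.
apply: (potential_le_below _ _ _ g (lexx _)); [lra|lra|by []|].
by apply: (cubic_ge0 hp); rewrite /inv_ln2_ub /lin_cst /saving_rate; clear; lra.
Qed.

Lemma merge_insertion_le_right (p : R) : 16%:R / 25%:R <= p <= 2%:R / 3%:R ->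
  - p - 2%:R / 3%:R - saving_rate R * (2%:R / 3%:R - p) <= p * lg p - lin_cst * p.
Proof.
move=> hp; have [_ [_ _ g]] := ln_grid; have /andP[pu pv] := hp.
have -> : - p - 2%:R / 3%:R - saving_rate R * (2%:R / 3%:R - p)
  = - (2%:R / 3%:R) * (1 + saving_rate R) + phi (saving_rate R - 1) 0 0 p by rewrite /phi !mul0r; ring.
apply: (potential_le_above _ _ _ g (lexx _)); [lra|lra|by []|].
by apply: (cubic_ge0 hp); rewrite /inv_ln2_ub /lin_cst /saving_rate; clear; lra.
Qed.

End Pieces.

(** * From the step costs to the potential by a Riemann sum *)

Section Assembly.
Variable R : realType.

Definition step_sum (x y : nat) : R := \sum_(t <- iota 1 (y - x)./2) avg_step R (x + t.*2).

Lemma step_sum0 x : step_sum x x = 0.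
Proof. by rewrite /step_sum subnn big_nil. Qed.

Lemma step_sum_cat x y z : ~~ odd x -> ~~ odd y -> (x <= y <= z)%N -> step_sum x z = step_sum x y + step_sum y z.
Proof.
move=> ox oy /andP[xy yz]; rewrite /step_sum.
have -> : ((z - x)./2 = (y - x)./2 + (z - y)./2)%N by lia.
rewrite iotaD big_cat /=; congr (_ + _); rewrite addnC iotaDl big_map.
by apply: eq_bigr => t _; congr (avg_step R _); lia.
Qed.

Lemma ln_le_sub (x z : R) : 0 < z -> z <= x -> ln x - ln z <= (x - z) / z.
Proof.
move=> z0 zx; have x0 : 0 < x by exact: lt_le_trans zx.
rewrite -ln_div ?posrE //; have -> : x / z = 1 + (x - z) / z by field; rewrite gt_eqF.
by apply: le_ln1Dx; apply: lt_le_trans (_ : 0 <= _); rewrite ?ltrN10 // divr_ge0 ?subr_ge0 // ltW.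
Qed.

(** The rate at the right end i is compared with the increment over [i - 2, i]. The term in d errs
    on the safe side; the logarithm loses 4 b N / (i (i - 2)), at most 24 / i by b <= 3 and N <= 2
    (i - 2). *)
Lemma phi_step (a b d N i : R) : 0 < N -> 4%:R <= i -> N <= 2%:R * (i - 2%:R) -> 0 <= b <= 3%:R -> 0 <= d ->
  2%:R * a - 2%:R * b * (N / i) + 2%:R * d * (N / i) ^+ 2 <=
  N * (phi a b d (i / N) - phi a b d ((i - 2%:R) / N)) + 24%:R / i.
Proof.
move=> N0 i4 Ni /andP[b0 b3] d0; rewrite /phi.
have i0 : 0 < i by lra.
have j0 : 0 < i - 2%:R by lra.
have hl : ln (i / N) - ln ((i - 2%:R) / N) <= 2%:R / (i - 2%:R).
  have := @ln_le_sub (i / N) ((i - 2%:R) / N) (divr_gt0 j0 N0).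
  have -> : (i / N - (i - 2%:R) / N) / ((i - 2%:R) / N) = 2%:R / (i - 2%:R) by field; rewrite !gt_eqF.
  by apply; rewrite ler_pM2r ?invr_gt0 //; lra.
have h1 : N * b * (ln (i / N) - ln ((i - 2%:R) / N)) <= N * b * (2%:R / (i - 2%:R)).
  by rewrite ler_wpM2l // mulr_ge0 // ltW.
have h2 : N * b * (2%:R / (i - 2%:R)) <= 2%:R * b * (N / i) + 24%:R / i.
  rewrite -subr_ge0; have -> : 2%:R * b * (N / i) + 24%:R / i - N * b * (2%:R / (i - 2%:R))
     = (24%:R * (i - 2%:R) - 4%:R * b * N) / (i * (i - 2%:R)) by field; rewrite !gt_eqF.
  rewrite divr_ge0 // ?mulr_ge0 ?(ltW i0) ?(ltW j0) //.
  have : b * N <= 3%:R * (2%:R * (i - 2%:R)) by apply: ler_pM => //; exact: ltW.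
  lra.
have h3 : 2%:R * d * (N / i) ^+ 2 <= N * (d / ((i - 2%:R) / N) - d / (i / N)).
  rewrite -subr_ge0; have -> : N * (d / ((i - 2%:R) / N) - d / (i / N)) - 2%:R * d * (N / i) ^+ 2
    = 4%:R * d * N ^+ 2 / (i ^+ 2 * (i - 2%:R)) by field; rewrite !gt_eqF.
  by rewrite divr_ge0 ?mulr_ge0 ?exprn_ge0 // ltW.
have h4 : N * (a * (i / N) - a * ((i - 2%:R) / N)) = 2%:R * a by field; rewrite gt_eqF.
move: h1 h2 h3 h4; set p := i / N; set q := (i - 2%:R) / N.
move: (ln p) (ln q) (d / p) (d / q) => u v w z.
move: p q ((N / i) ^+ 2) (24%:R / i) => p q r s.
have -> : N * (a * p - b * u - w - (a * q - b * v - z)) = N * (a * p - a * q) - N * b * (u - v) + N * (z - w) by ring.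
lra.
Qed.

(** Per step the errors 120 / i and 24 / i are together at most 288 / N, and there are at most N
    steps. *)
Lemma step_sum_le_phi K (a b d : R) x y : ~~ odd x -> ~~ odd y -> (x <= y)%N -> (y <= 2 ^ K)%N ->
  (2 ^ K <= x.*2)%N -> (2 <= x)%N -> 0 <= b <= 3%:R -> 0 <= d ->
  (forall i, (x < i <= y)%N ->
     avg_step R i <= 2%:R * K%:R + 2%:R * a - 2%:R * b * ((2 ^ K)%N%:R / i%:R)
       + 2%:R * d * ((2 ^ K)%N%:R / i%:R) ^+ 2 + 120%:R / i%:R) ->
  step_sum x y <= K%:R * (y%:R - x%:R)
    + (2 ^ K)%N%:R * (phi a b d (y%:R / (2 ^ K)%N%:R) - phi a b d (x%:R / (2 ^ K)%N%:R)) + 288%:R.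
Proof.
move=> ox oy xy yN Nx x2 hb hd H; set N : R := (2 ^ K)%N%:R.
have N0 : 0 < N by rewrite ltr0n expn_gt0.
suff I t : (x + t.*2 <= y)%N -> step_sum x (x + t.*2) <= K%:R * (2%:R * t%:R)
    + N * (phi a b d ((x + t.*2)%:R / N) - phi a b d (x%:R / N)) + 288%:R / N * t%:R.
  have yE : y = (x + (y - x)./2.*2)%N by lia.
  rewrite {1}yE; apply: le_trans (I _ _) _; first by lia.
  rewrite -yE; have -> : y%:R - x%:R = 2%:R * ((y - x)./2)%:R :> R.
    by rewrite -natrB // -natrM; congr (_%:R); lia.
  rewrite lerD2l mulrAC ler_pdivrMr // ler_pM2l // ler_nat; lia.
elim: t => [|t IH] hy; first by rewrite addn0 step_sum0 subrr !mulr0 !addr0.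
have {}IH := IH ltac:(lia).
rewrite (@step_sum_cat x (x + t.*2)) //; [|lia|lia].
set i := (x + t.+1.*2)%N.
have -> : step_sum (x + t.*2) i = avg_step R i.
  rewrite /step_sum; have -> : ((i - (x + t.*2))./2 = 1)%N by lia.
  by rewrite big_seq1; congr (avg_step R _); lia.
have hi := H i ltac:(lia).
have iE : (x + t.*2)%:R = i%:R - 2%:R :> R by rewrite -natrB; [congr (_%:R); lia | lia].
have i4 : 4%:R <= i%:R :> R by rewrite ler_nat; lia.
have Ni : N <= 2%:R * (i%:R - 2%:R) by rewrite -iE -natrM ler_nat; lia.
have S := phi_step a N0 i4 Ni hb hd; rewrite -iE in S.
have e : 144%:R / i%:R <= 288%:R / N.
  rewrite ler_pdivrMr ?ltr_pdivlMr //; last by lra.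
  by rewrite mulrAC ler_pdivlMr //; lra.
rewrite -/N in hi; rewrite -(natr1 t); clear H iE.
move: S IH hi e.
move: (phi a b d (i%:R / N)) (phi a b d ((x + t.*2)%:R / N)) (phi a b d (x%:R / N)) => u v w.
move: (N / i%:R) => Y.
have -> : 144%:R / i%:R = 120%:R / i%:R + 24%:R / i%:R :> R by rewrite -mulrDl; congr (_ * _); ring.
move: (120%:R / i%:R) (24%:R / i%:R) (288%:R / N) (Y ^+ 2) => e1 e2 e3 Y2.
have -> : N * (u - w) = N * (v - w) + N * (u - v) by ring.
lra.
Qed.
End Assembly.

(** * Gluing the ranges, starting from two thirds of a power of two *)

Section Regions.
Variable R : realType.
Variables (K : nat) (K4 : (4 <= K)%N).
Local Notation Nn := (2 ^ K)%N.
Local Notation N := (Nn%:R : R).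

Lemma clg_octave i : (Nn < i.*2)%N -> (i <= Nn)%N -> clg i = K.
Proof.
case: K K4 => // k _; rewrite expnS => h1 h2; apply: clg_eq; last by rewrite expnS.
by lia.
Qed.

Lemma octave_ge2 x : (Nn <= x.*2)%N -> (2 <= x)%N.
Proof.
have : (2 ^ 4 <= Nn)%N by rewrite leq_exp2l.
by rewrite -[(2 ^ 4)%N]/16%N; lia.
Qed.

Section XY.
Variables x y : nat.
Hypotheses (ox : ~~ odd x) (oy : ~~ odd y) (xy : (x <= y)%N) (Nx : (Nn <= x.*2)%N) (yN : (y <= Nn)%N).

Lemma step_sum_phi1 : (4 * y <= 3 * Nn)%N ->
  step_sum R x y <= K%:R * (y%:R - x%:R) + N * (phi1 (y%:R / N) - phi1 (x%:R / N)) + 288%:R.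
Proof.
move=> hy; apply: step_sum_le_phi => //; rewrite ?octave_ge2 //; [lra|lra|move=> i hi].
have ci : clg i = K by apply: clg_octave; lia.
have i1 : (1 < i)%N by have := octave_ge2 Nx; lia.
have p34 : pp R i <= 3%:R / 4%:R by rewrite leNgt pp_gt34 // ci; lia.
have [+ _] := avg_step_lo i1 ltac:(by rewrite ci) p34; rewrite /pw ci.
move: (N / i%:R) (120%:R / i%:R) => u v; lra.
Qed.

Lemma step_sum_phi2 : (3 * Nn <= 4 * x)%N ->
  step_sum R x y <= K%:R * (y%:R - x%:R) + N * (phi2 (y%:R / N) - phi2 (x%:R / N)) + 288%:R.
Proof.
move=> hy; apply: step_sum_le_phi => //; rewrite ?octave_ge2 //; [lra|lra|move=> i hi].
have ci : clg i = K by apply: clg_octave; lia.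
have i1 : (1 < i)%N by have := octave_ge2 Nx; lia.
have p34 : 3%:R / 4%:R < pp R i by rewrite pp_gt34 // ci; lia.
have [+ _] := avg_step_hi i1 ltac:(by rewrite ci) p34; rewrite /pw ci.
move: (N / i%:R) (120%:R / i%:R) => u v; lra.
Qed.

Lemma step_sum_phi3 :
  step_sum R x y <= K%:R * (y%:R - x%:R) + N * (phi3 (y%:R / N) - phi3 (x%:R / N)) + 288%:R.
Proof.
apply: step_sum_le_phi => //; rewrite ?octave_ge2 //; [lra|move=> i hi].
have ci : clg i = K by apply: clg_octave; lia.
have i1 : (1 < i)%N by have := octave_ge2 Nx; lia.
have : avg_step R i <= 2%:R * K%:R + 2%:R - 2%:R * (N / i%:R) + 120%:R / i%:R.
  have c4 : (4 <= clg i)%N by rewrite ci.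
  by case: (leP (pp R i) (3%:R / 4%:R)) => hp; [have [_] := avg_step_lo i1 c4 hp | have [_] := avg_step_hi i1 c4 hp];
    rewrite /pw ci.
move: (N / i%:R) (120%:R / i%:R) => u v; lra.
Qed.
End XY.

Section Core.
Variables (n' : nat) (c : R).
Hypotheses (on : ~~ odd n') (n2 : (2 * Nn <= 3 * n' <= 2 * Nn + 5)%N).
Hypothesis hc : 3%:R * c + 2%:R * N <= 3%:R * (K%:R - 1) * n'%:R + 8%:R * K%:R + 11%:R.

Lemma pow_gt0 : 0 < N. Proof. by rewrite ltr0n expn_gt0. Qed.

(** At q = 2/3 the potential equals the worst case - q - 2/3 of MergeInsertion. As n' exceeds 2N/3
    by at most 5/3, a linear estimate of the logarithm shows that the deviation costs less than
    1. *)
Lemma cost_start : c <= K%:R * n'%:R + N * (offset1 R + phi1 (n'%:R / N)) + 3%:R * K%:R + 6%:R.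
Proof.
have N0 := pow_gt0; set q := n'%:R / N.
have nq : n'%:R = N * q by rewrite /q mulrC divfK // gt_eqF.
move/andP: n2 => [hl hu].
have q0 : 2%:R / 3%:R <= q.
  rewrite /q ler_pdivlMr // mulrAC ler_pdivrMr // -!natrM ler_nat; lia.
have q1 : N * q <= 2%:R / 3%:R * N + 5%:R / 3%:R.
  rewrite -nq; have : 3%:R * n'%:R <= 2%:R * N + 5%:R by rewrite -!natrM -natrD ler_nat.
  by move: (n'%:R) N => a b; lra.
have lq : ln q - ln (2%:R / 3%:R) <= (q - 2%:R / 3%:R) * (3%:R / 2%:R).
  by rewrite -[3%:R / 2%:R]invf_div; apply: ln_le_sub q0; lra.
have vq : q^-1 <= 3%:R / 2%:R.
  by rewrite -[leRHS]invrK lef_pV2 ?posrE ?invf_div //; lra.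
have h : N * (- q - 2%:R / 3%:R) <= N * (offset1 R + phi1 q) + 1.
  have : N * (7%:R / 4%:R * (ln q - ln (2%:R / 3%:R))) <= N * (7%:R / 4%:R * ((q - 2%:R / 3%:R) * (3%:R / 2%:R))).
    by rewrite ler_pM2l // ler_pM2l // divr_gt0.
  have : N * (25%:R / 96%:R * q^-1) <= N * (25%:R / 96%:R * (3%:R / 2%:R)).
    by rewrite ler_pM2l // ler_pM2l // divr_gt0.
  rewrite /offset1 /phi1 /phi; move: q1; clear.
  move: (ln q) (ln (2%:R / 3%:R)) (q^-1) => u v w; move: q N => r n.
  lra.
rewrite -/q; move: hc h; rewrite nq; move: (offset1 R + phi1 q) => g.
move: (K%:R : R) (ler0n R K) N => k k0 n; lra.
Qed.

Variable M : nat.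
Hypotheses (NM : Nn = (64 * M)%N) (oM : ~~ odd M).

Lemma M_gt0 : (0 < M)%N.
Proof. by have := expn_gt0 2 K; rewrite NM muln_gt0. Qed.

Lemma frac_N (a : nat) : (a * M)%N%:R / N = a%:R / 64%:R :> R.
Proof.
have M0 : M%:R != 0 :> R by rewrite pnatr_eq0 -lt0n M_gt0.
by rewrite NM !natrM; field.
Qed.

Section Y.
Variable y : nat.
Hypotheses (oy : ~~ odd y) (yN : (y <= Nn)%N).

Lemma cost_phi1 : (n' <= y)%N -> (4 * y <= 3 * Nn)%N ->
  c + step_sum R n' y <= K%:R * y%:R + N * (offset1 R + phi1 (y%:R / N)) + 3%:R * K%:R + 294%:R.
Proof.
move=> ny y34; have B := cost_start; have E := @step_sum_phi1 n' y on oy ny ltac:(lia) yN y34.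
move: B E; move: (phi1 (y%:R / N)) (phi1 (n'%:R / N)) (offset1 R) => a b d; lra.
Qed.
End Y.

(** At a cut point the two potentials agree by the choice of the offsets, so the only price of
    changing the range is another additive 288. *)
Lemma cost_at_34 : c + step_sum R n' (48 * M) <=
   K%:R * (48 * M)%N%:R + N * (offset2 R + phi2 (3%:R / 4%:R)) + 3%:R * K%:R + 294%:R.
Proof.
have e : (48 * M)%N%:R / N = 3%:R / 4%:R :> R by rewrite frac_N; field.
have -> : offset2 R + phi2 (3%:R / 4%:R) = offset1 R + phi1 ((48 * M)%N%:R / N) by rewrite e /offset2 subrK.
by apply: cost_phi1; move: NM oM n2 M_gt0; clear; rewrite ?oddM; lia.
Qed.

Lemma cost_phi2 y : ~~ odd y -> (y <= Nn)%N -> (3 * Nn <= 4 * y)%N ->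
  c + step_sum R n' y <= K%:R * y%:R + N * (offset2 R + phi2 (y%:R / N)) + 3%:R * K%:R + 582%:R.
Proof.
move=> oy yN y34; have B := cost_at_34.
have o48 : ~~ odd (48 * M) by rewrite oddM.
have b48 : (n' <= 48 * M)%N by move: NM n2 M_gt0; clear; lia.
have y48 : (48 * M <= y)%N by move: NM y34; clear; lia.
rewrite (@step_sum_cat R n' (48 * M)) ?b48 //.
have := @step_sum_phi2 (48 * M) y o48 oy y48 ltac:(move: NM; clear; lia) yN ltac:(move: NM; clear; lia).
rewrite frac_N (_ : 48%:R / 64%:R = 3%:R / 4%:R); last by field.
move: B; move: (phi2 (y%:R / N)) (phi2 (3%:R / 4%:R)) (offset2 R) => a b d; lra.
Qed.

Lemma cost_at_57_64 : c + step_sum R n' (57 * M) <=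
   K%:R * (57 * M)%N%:R + N * (offset3 R + phi3 (57%:R / 64%:R)) + 3%:R * K%:R + 582%:R.
Proof.
have -> : offset3 R + phi3 (57%:R / 64%:R) = offset2 R + phi2 ((57 * M)%N%:R / N) by rewrite frac_N /offset3 subrK.
by apply: cost_phi2; move: NM oM M_gt0; clear; rewrite ?oddM; lia.
Qed.

Lemma cost_phi3 y : ~~ odd y -> (y <= Nn)%N -> (57 * Nn <= 64 * y)%N ->
  c + step_sum R n' y <= K%:R * y%:R + N * (offset3 R + phi3 (y%:R / N)) + 3%:R * K%:R + 870%:R.
Proof.
move=> oy yN y57; have B := cost_at_57_64.
have o57 : ~~ odd (57 * M) by rewrite oddM (negbTE oM) andbF.
have b57 : (n' <= 57 * M)%N by move: NM n2 M_gt0; clear; lia.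
have y57' : (57 * M <= y)%N by move: NM y57; clear; lia.
rewrite (@step_sum_cat R n' (57 * M)) ?b57 //.
have := @step_sum_phi3 (57 * M) y o57 oy y57' ltac:(move: NM; clear; lia) yN.
rewrite frac_N.
move: B; move: (phi3 (y%:R / N)) (phi3 (57%:R / 64%:R)) (offset3 R) => a b d; lra.
Qed.

End Core.
End Regions.

Lemma pow_even e : (0 < e)%N -> ~~ odd (2 ^ e).
Proof. by rewrite oddX /= => /lt0n_neq0 /negbTE ->. Qed.

(** Makes all cut points even integers, so that they are reached from the even n' in steps of
    two. *)
Lemma pow_div64 k : (7 <= k)%N -> (2 ^ k)%N = (64 * 2 ^ (k - 6))%N /\ ~~ odd (2 ^ (k - 6)).
Proof.
move=> k7; split; last by apply: pow_even; rewrite subn_gt0.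
by rewrite -[64%N]/(2 ^ 6)%N -expnD; congr (2 ^ _)%N; lia.
Qed.

(** * Averages over permutations and their splitting into steps *)

Section Average.
Variable R : realType.

(** Both lists are duplicate-free of length n!, so an inclusion suffices. *)
Lemma perm_images n :
  perm_eq [seq [seq nat_of_ord (sigma i) | i <- enum 'I_n] | sigma : 'S_n] (permutations (iota 0 n)).
Proof.
have inj : injective (fun sigma : 'S_n => [seq nat_of_ord (sigma i) | i <- enum 'I_n]).
  move=> s1 s2 /eq_in_map E; apply/permP => i; apply: val_inj.
  by apply: E; rewrite mem_enum.
have u1 : uniq [seq [seq nat_of_ord (sigma i) | i <- enum 'I_n] | sigma : 'S_n].
  by rewrite map_inj_uniq ?enum_uniq.
have [||_ e] := uniq_min_size u1 (s2 := permutations (iota 0 n)).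
- move=> _ /mapP[s _ ->]; rewrite mem_permutations; apply: uniq_perm.
  + by rewrite map_inj_uniq ?enum_uniq // => i j /val_inj /perm_inj.
  + exact: iota_uniq.
  move=> k; rewrite mem_iota /= add0n; apply/mapP/idP => [[i _ ->] //|kn].
  by exists ((s^-1)%g (Ordinal kn)); rewrite ?mem_enum // permKV.
- rewrite size_permutations ?iota_uniq // size_iota size_map -cardE.
  by rewrite card_Sn.
by apply: uniq_perm => //; exact: permutations_uniq.
Qed.

Lemma avg_complexityE n : avg_complexity R n =
  (\sum_(t <- permutations (iota 0 n)) (combined R t).2)%:R / n`!%:R.
Proof.
rewrite /avg_complexity -(perm_big _ (perm_images n)) /= big_map big_enum /= natr_sum.
by [].
Qed.

Lemma avg_complexity_ge0 n : 0 <= avg_complexity R n.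
Proof. by rewrite avg_complexityE divr_ge0. Qed.

Lemma avg_complexity_merge n (c : R) : (nprime R n <= n)%N -> ~~ odd n -> (0 < nprime R n)%N ->
  ~~ ((638%:R / 1000%:R <= pp R n) && (pp R n <= 2%:R / 3%:R)) ->
  (forall s, uniq s -> size s = nprime R n -> (MergeInsertion s).2%:R <= c) ->
  avg_complexity R n <= c + step_sum R (nprime R n) n.
Proof.
move=> nn on n0 hp hc; set n' := nprime R n in nn n0 hc *.
set l := iota 0 n; have ul : uniq l by exact: iota_uniq.
have sl : size l = n by exact: size_iota.
rewrite avg_complexityE ler_pdivrMr ?ltr0n ?fact_gt0 //.
have -> : (\sum_(t <- permutations l) (combined R t).2 = \sum_(t <- permutations l) (MergeInsertion (take n' t)).2
   + \sum_(j <- iota 1 ((n - n')./2)) \sum_(t <- permutations l) step_cost R t (n' + j.*2))%N.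
  rewrite exchange_big -big_split /= big_seq [RHS]big_seq; apply: eq_bigr => t.
  rewrite mem_permutations => pt; have st : size t = n by rewrite (perm_size pt).
  by rewrite combined_cost ?st //; rewrite (perm_uniq pt).
rewrite natrD mulrDl; apply: lerD.
  rewrite [leRHS]mulrC -[n in n`!]sl; apply: sum_permutations_le => // t pt.
  apply: hc; last by rewrite size_takel // (perm_size pt) sl.
  by rewrite take_uniq // (perm_uniq pt).
rewrite natr_sum /step_sum mulr_suml big_seq [leRHS]big_seq; apply: ler_sum => j; rewrite mem_iota => hj.
have hi : (1 < n' + j.*2 <= size l)%N by rewrite sl; move: hj nn n0; clear; lia.
by rewrite avg_step_cost // sl mulrC.
Qed.

Lemma MergeInsertion_worstR k (s : seq nat) : uniq s -> (2 ^ k <= size s)%N -> (3 * size s <= 2 ^ k.+2 + 9)%N ->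
  (MergeInsertion s).2%:R <= k%:R * (size s)%:R + (8%:R * k%:R + 19%:R) / 3%:R - (2 ^ k.+2)%N%:R / 3%:R :> R.
Proof.
move=> us h1 h2; have := MergeInsertion_worst us h1 h2.
move: (MergeInsertion s).2 (size s) (2 ^ k.+2)%N => c m d.
rewrite -(ler_nat R) !natrD !natrM; lra.
Qed.
End Average.

(** * The three ranges of p and the conclusion *)

Section Final.
Variables (R : realType) (n : nat).
Hypotheses (on : ~~ odd n) (K8 : (8 <= clg n)%N).
Local Notation K := (clg n).
Local Notation N := ((2 ^ clg n)%N%:R : R).

Let N0 : 0 < N. Proof. by rewrite ltr0n expn_gt0. Qed.

Lemma clg_gt1 : (1 < n)%N.
Proof. by have := leq_ltn_trans (leq0n 7) K8; rewrite up_log_gt0. Qed.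

Lemma n_ppN : n%:R = pp R n * N.
Proof. by rewrite /pp divfK // gt_eqF. Qed.

Lemma pp_frac (a b : nat) : (0 < b)%N -> (a%:R / b%:R <= pp R n) = (a * 2 ^ K <= b * n)%N.
Proof.
move=> b0; rewrite /pp ler_pdivlMr // mulrAC ler_pdivrMr ?ltr0n // -!natrM ler_nat.
by rewrite [(n * b)%N]mulnC.
Qed.

Lemma clg_ltn : (2 ^ K < n.*2)%N /\ (n <= 2 ^ K)%N.
Proof. exact: clg_pow_bounds clg_gt1. Qed.

(** In 3n' the rounding adds at most 2 and the parity correction 3, whence 5. *)
Lemma nprime_hi : 2%:R / 3%:R <= pp R n ->
  [/\ ~~ odd (nprime R n), (nprime R n <= n)%N & (2 * 2 ^ K <= 3 * nprime R n <= 2 * 2 ^ K + 5)%N].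
Proof.
move=> hp; rewrite /nprime hp; move: hp; rewrite pp_frac // expnS.
move: (2 ^ K)%N on => m o h.
by case: ifP => ho; split; lia.
Qed.

Lemma nprime_lo : pp R n < 638%:R / 1000%:R ->
  [/\ ~~ odd (nprime R n), (nprime R n <= n)%N & (2 ^ K <= 3 * nprime R n <= 2 ^ K + 5)%N].
Proof.
move=> hp; rewrite /nprime leNgt (lt_trans hp) /=; last by lra.
have [h _] := clg_ltn; move: (2 ^ K)%N on h => m o h.
by case: ifP => ho; split; lia.
Qed.

Definition avg_bound (e : R) := avg_complexity R n <= K%:R * n%:R + N * (pp R n * lg (pp R n) - lin_cst R * pp R n) + e.

End Final.

Section Final.
Variables (R : realType) (n : nat).
Hypotheses (on : ~~ odd n) (K8 : (8 <= clg n)%N).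
Local Notation K := (clg n).
Local Notation N := ((2 ^ clg n)%N%:R : R).
Local Notation p := (pp R n).

Lemma Npos : 0 < N. Proof. by rewrite ltr0n expn_gt0. Qed.
Lemma p_div : p = n%:R / N. Proof. by []. Qed.

(** Used with k = K when n' is about 2N/3 and with k = K - 1 when it is about N/3, which is again
    two thirds of 2^k. *)
Lemma avg_worst_core k : (0 < k <= K)%N -> ~~ odd (nprime R n) -> (nprime R n <= n)%N ->
  (2 * 2 ^ k <= 3 * nprime R n <= 2 * 2 ^ k + 5)%N ->
  ~~ ((638%:R / 1000%:R <= p) && (p <= 2%:R / 3%:R)) ->
  exists2 c : R, 3%:R * c + 2%:R * (2 ^ k)%N%:R <= 3%:R * (k%:R - 1) * (nprime R n)%:R + 8%:R * k%:R + 11%:R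
  & avg_complexity R n <= c + step_sum R (nprime R n) n.
Proof.
case: k => // k _; set n' := nprime R n => on' nn n2 hp.
have n0 : (0 < n')%N by have := expn_gt0 2 k.+1; move: n2; clear; lia.
exists (k%:R * n'%:R + (8%:R * k%:R + 19%:R) / 3%:R - (2 ^ k.+2)%N%:R / 3%:R).
  rewrite (expnS 2 k.+1) natrM -(natr1 k).
  move: k%:R n'%:R (2 ^ k.+1)%N%:R => a b d; lra.
apply: avg_complexity_merge => // s us; rewrite -/n' => ss; rewrite -ss; apply: MergeInsertion_worstR => //.
  by rewrite ss; move: n2; rewrite expnS; clear; lia.
by rewrite ss expnS; move: n2; clear; lia.
Qed.

Lemma bound_hi : 2%:R / 3%:R < p -> @avg_bound R n (3%:R * K%:R + 870%:R).
Proof.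
move=> hp; have [on' nn n2] := nprime_hi on K8 (ltW hp).
have n1 := clg_gt1 K8; have [nl nu] := clg_ltn K8.
have [||c hc A] := avg_worst_core _ on' nn n2.
- by rewrite leqnn andbT; move: K8; clear; lia.
- by rewrite negb_and -!ltNge hp orbT.
set n' := nprime R n in on' nn n2 hc A.
have [NM oM] := pow_div64 (ltnW K8).
have K4 : (4 <= K)%N by move: K8; clear; lia.
have [pl p1] : 1 / 2%:R <= p /\ p <= 1 by rewrite pp_le1 //; split=> //; lra.
rewrite /avg_bound; apply: le_trans A _.
have fin (o : R) e : e <= 870%:R -> o <= p * lg p - lin_cst R * p -> 
  c + step_sum R n' n <= K%:R * n%:R + N * o + 3%:R * K%:R + e ->
  c + step_sum R n' n <= K%:R * n%:R + N * (p * lg p - lin_cst R * p) + (3%:R * K%:R + 870%:R).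
  move=> he ho h; apply: le_trans h _.
  have := ler_wpM2l (ltW Npos) ho; move: (N * o) (N * _) => a b; lra.
have cut (a b : nat) : (0 < b)%N -> (p <= a%:R / b%:R) = (b * n <= a * 2 ^ K)%N.
  move=> b0; rewrite p_div ler_pdivrMr ?Npos // mulrAC ler_pdivlMr ?ltr0n // -!natrM ler_nat.
  by rewrite mulnC.
case: (leP p (3%:R / 4%:R)) => h1.
  apply: fin (cost_phi1 K4 on' n2 hc NM oM on nu nn _); [lra| |by rewrite -cut].
  by apply: offset1_phi1_le; rewrite h1 (ltW hp).
case: (leP p (57%:R / 64%:R)) => h2.
  apply: fin (cost_phi2 K4 on' n2 hc NM oM on nu _); [lra| |by rewrite -(pp_frac R) ?ltW].
  by case: (leP p (4%:R / 5%:R)) => h3; [apply: offset2_phi2_le_left | apply: offset2_phi2_le_right]; rewrite ?h2 ?h3 ltW.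
apply: fin (cost_phi3 K4 on' n2 hc NM oM on nu _); [lra| |by rewrite -(pp_frac R) ?ltW].
case: (leP p (25%:R / 27%:R)) => h3; last by apply: offset3_phi3_le_right; rewrite ltW.
by case: (leP p (23%:R / 25%:R)) => h4; [apply: offset3_phi3_le_left | apply: offset3_phi3_le_mid]; rewrite ?h3 ?h4 ltW.
Qed.

Lemma bound_mi : 638%:R / 1000%:R <= p <= 2%:R / 3%:R -> @avg_bound R n (6%:R * K%:R + 7%:R).
Proof.
move=> hp; have /andP[hl hu] := hp.
have n1 := clg_gt1 K8; have [nl nu] := clg_ltn K8.
have K1 : K = (K - 1).+1 by move: K8; clear; lia.
set l := iota 0 n; have ul : uniq l by exact: iota_uniq.
have sl : size l = n by exact: size_iota.
have np : n%:R = p * N by rewrite -n_ppN.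
have n3 : 3%:R * n%:R <= 2%:R * N.
  by rewrite np; move: hu Npos; move: p N => a b ha hb; nra.
have := @MergeInsertion_avg R (K - 1) l ul; rewrite sl.
have e2 : (2 ^ (K - 1).+2 = 2 * 2 ^ K)%N by rewrite -K1 expnS.
rewrite e2 -K1 (natrM R 2 _) => H.
rewrite /avg_bound avg_complexityE ler_pdivrMr ?ltr0n ?fact_gt0 //.
have -> : (\sum_(t <- permutations l) (combined R t).2 = \sum_(t <- permutations l) (MergeInsertion t).2)%N.
  rewrite big_seq [RHS]big_seq; apply: eq_bigr => t; rewrite mem_permutations => pt.
  by rewrite /combined (perm_size pt) sl hp.
apply: le_trans (H _ _ _) _.
- by move: nl; rewrite {1}K1 expnS; clear; lia.
- by move: n3; rewrite -!natrM ler_nat; clear; lia.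
- by rewrite np; move: hl Npos; move: p N => a b ha hb; nra.
rewrite mulrC ler_pM2r ?ltr0n ?fact_gt0 //.
have P : - p - 2%:R / 3%:R - saving_rate R * (2%:R / 3%:R - p) <= p * lg p - lin_cst R * p.
  by case: (leP p (16%:R / 25%:R)) => h; [apply: merge_insertion_le_left | apply: merge_insertion_le_right]; rewrite ?h ?hu ?andbT; lra.
have := ler_wpM2l (ltW Npos) P.
rewrite [K%:R](_ : _ = (K - 1)%N%:R + 1); last by rewrite natr1 -K1.
rewrite np; have := Npos; move: (ler0n R (K - 1)); move: (K - 1)%N%:R (saving_rate R) (p * lg p - lin_cst R * p) p N.
move=> a b d r m; lra.
Qed.

(** The only case that crosses a power of two: the steps first fill the octave ending at N/2 and
    then enter that of n. Five ranges contribute 288 each to the constant. *)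
Lemma bound_lo : p < 638%:R / 1000%:R -> @avg_bound R n (3%:R * K%:R + 1446%:R).
Proof.
move=> hp; have [on' nn n2'] := nprime_lo on K8 hp.
have n1 := clg_gt1 K8; have [nl nu] := clg_ltn K8.
have [k Kk] : exists k, K = k.+1 by exists (K - 1)%N; move: K8; clear; lia.
have e2 : (2 ^ K = 2 * 2 ^ k)%N by rewrite Kk expnS.
have k7 : (7 <= k)%N by move: K8; rewrite Kk.
have n2 : (2 * 2 ^ k <= 3 * nprime R n <= 2 * 2 ^ k + 5)%N by rewrite -e2.
have [||c hc A] := avg_worst_core _ on' nn n2.
- by rewrite Kk leqnSn andbT; move: k7; clear; lia.
- by rewrite negb_and -!ltNge hp.
set n' := nprime R n in on' nn n2 hc A.
have [NM oM] := pow_div64 k7.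
have [NM' oM'] := pow_div64 (ltnW K8).
set M := (2 ^ (k - 6))%N in NM oM; set M' := (2 ^ (K - 6))%N in NM' oM'.
have k4 : (4 <= k)%N by move: k7; clear; lia.
have K4 : (4 <= K)%N by rewrite Kk ltnW.
have ok : ~~ odd (2 ^ k) by apply: pow_even; move: k7; clear; lia.
have N0 := Npos; have k0 : 0 < (2 ^ k)%N%:R :> R by rewrite ltr0n expn_gt0.
have NE : N = 2%:R * (2 ^ k)%N%:R by rewrite e2 natrM.
have B : c + step_sum R n' (2 ^ k) <= k%:R * (2 ^ k)%N%:R + (2 ^ k)%N%:R * (offset3 R + phi3 1) + 3%:R * k%:R + 870%:R.
  have := cost_phi3 k4 on' n2 hc NM oM ok (leqnn _); rewrite divff ?gt_eqF //; apply.
  by rewrite leq_mul2r orbT.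
have kn : (2 ^ k <= n)%N by move: nl e2; clear; lia.
have nk : (n' <= 2 ^ k)%N by move: n2 k4 (leq_pexp2l (isT : 0 < 2) k4)%N; rewrite -[(2 ^ 4)%N]/16%N; clear; lia.
have half : (2 ^ k)%N%:R / N = 1 / 2%:R by rewrite NE; field; rewrite gt_eqF.
have KkR : k%:R = K%:R - 1 :> R by rewrite Kk -(natr1 k) addrK.
(* Changing the octave replaces k by K - 1 in k 2^k; the lost 2^k = N/2 is the - 1/2 in [offset4],
   and the old potential is halved because N doubles. *)
have S4 y : ~~ odd y -> (2 ^ k <= y)%N -> (y <= 2 ^ K)%N ->
   c + step_sum R n' y <= K%:R * y%:R + N * (offset4 R + phi3 (y%:R / N)) + 3%:R * K%:R + 1158%:R.
  move=> oy ky yN; rewrite (@step_sum_cat R n' (2 ^ k)) ?nk //.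
  have := @step_sum_phi3 R K K4 (2 ^ k) y ok oy ky ltac:(move: e2; clear; lia) yN.
  rewrite half /offset4; move: B; move: (phi3 (y%:R / N)) => b; rewrite KkR NE.
  move: (phi3 1) (phi3 (1 / 2%:R)) (offset3 R) ((2 ^ k)%N%:R : R) (K%:R : R) => d e f m a.
  lra.
have pl : 1 / 2%:R <= p by rewrite (pp_frac R n 1) //; move: e2 kn; clear; lia.
rewrite /avg_bound; apply: le_trans A _.
case: (leP p (35%:R / 64%:R)) => h.
  apply: le_trans (S4 n on kn nu) _.
  have P : offset4 R + phi3 p <= p * lg p - lin_cst R * p by apply: offset4_phi3_le; rewrite pl.
  have := ler_wpM2l (ltW N0) P; rewrite -p_div.
  move: (N * _) (N * _) => a b; clear; lra.
have o35 : ~~ odd (35 * M') by rewrite oddM (negbTE oM') andbF.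
have n35 : (35 * M' <= n)%N.
  have := ltW h; rewrite pp_frac // NM'; clear; lia.
have e35 : (35 * M')%N%:R / N = 35%:R / 64%:R.
  by rewrite NM' !natrM; field; rewrite pnatr_eq0 expn_eq0.
have S35 := S4 (35 * M')%N o35 ltac:(move: e2 NM'; clear; lia) ltac:(move: NM'; clear; lia).
have := @step_sum_phi1 R K K4 (35 * M') n o35 on n35 ltac:(move: NM'; clear; lia) nu.
have E : step_sum R n' n = step_sum R n' (35 * M') + step_sum R (35 * M') n.
  by apply: step_sum_cat => //; rewrite n35 andbT; move: nk e2 NM'; clear; lia.
rewrite E; rewrite e35 in S35 *.
have P : offset5 R + phi1 p <= p * lg p - lin_cst R * p.
  by case: (leP p (3%:R / 5%:R)) => h3; [apply: offset5_phi1_le_left | apply: offset5_phi1_le_right]; rewrite ?h3 ?(ltW h) ?(ltW h3) ?(ltW hp).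
move: (ler_wpM2l (ltW N0) P) S35; rewrite -p_div /offset5.
have n34 : (4 * n <= 3 * 2 ^ K)%N.
  have p34 : p <= 3%:R / 4%:R by move: hp; move: p => r hr; lra.
  by move: p34; rewrite p_div ler_pdivrMr // mulrAC ler_pdivlMr ?ltr0n // -!natrM ler_nat; clear; lia.
move=> hP S /(_ n34) H.
move: hP S H; move: (phi1 p) (phi1 (35%:R / 64%:R)) (phi3 (35%:R / 64%:R)) (offset4 R) (p * lg p - lin_cst R * p) => a b d e f.
move: (step_sum R n' (35 * M')) (step_sum R (35 * M') n) => s1 s2; clear; lra.
Qed.

(** Writing n = pN turns n lg n into K n + N p lg p. From K <= lg n + 1 the error 6K + 1446 is at
    most 6 lg n + 1452, hence at most 1458 lg n. *)
Lemma avg_le_large : avg_complexity R n <= n%:R * lg n%:R - lin_cst R * n%:R + 1458%:R * lg (n%:R : R).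
Proof.
have T : @avg_bound R n (6%:R * K%:R + 1446%:R).
  have hK := ler0n R K.
  have mono e : e <= 6%:R * K%:R + 1446%:R -> @avg_bound R n e -> @avg_bound R n (6%:R * K%:R + 1446%:R).
    by move=> he h; apply: le_trans h _; rewrite lerD2l.
  case: (ltP p (638%:R / 1000%:R)) => h1; first by apply: mono (bound_lo h1); lra.
  case: (leP p (2%:R / 3%:R)) => h2; last by apply: mono (bound_hi h2); lra.
  by apply: (mono _ _ (bound_mi _)); [lra | rewrite h1].
have n1 := clg_gt1 K8; have [nl _] := clg_ltn K8.
have l2 : 0 < ln 2%:R :> R by rewrite ln_gt0 // ltr1n.
have p0 : 0 < p by rewrite divr_gt0 ?Npos // ltr0n ltnW.
have lgn : lg (n%:R : R) = K%:R + lg p.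
  rewrite {1}(n_ppN R n) /lg lnM ?posrE ?Npos // mulrDl addrC; congr (_ + _).
  by rewrite natrX lnXn ?ltr0n // -(mulr_natl (ln _)) mulfK ?gt_eqF.
have Kl : K%:R - 1 <= lg (n%:R : R).
  rewrite lgn lerD2l /lg ler_pdivlMr // mulN1r -lnV ?posrE // ler_ln ?posrE ?invr_gt0 //.
  rewrite p_div ler_pdivlMr ?Npos // ler_pdivrMl // -natrM ler_nat; move: nl; clear; lia.
apply: le_trans T _.
have -> : n%:R * lg (n%:R : R) = K%:R * n%:R + N * (p * lg p).
  rewrite lgn mulrDr [n%:R * K%:R]mulrC; congr (_ + _).
  by rewrite {1}(n_ppN R n) [p * N]mulrC mulrA.
have K8R : 8%:R <= K%:R :> R by rewrite ler_nat.
have nE : N * (lin_cst R * p) = lin_cst R * n%:R by rewrite (n_ppN R n) mulrCA [N * p]mulrC.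
rewrite mulrBr nE; move: (lg n%:R) Kl K8R (N * _) (lin_cst R * _) => a.
move: (K%:R : R) => b h1 h2 d e; lra.
Qed.
End Final.

(* The combined algorithm sorts n (even) distinct inputs with at most
   n lg n - 1.41064 n + O(log n) comparisons on average. *)
Theorem theorem3 (R : realType) :
  exists C : R, forall n : nat, ~~ odd n -> (2 <= n)%N ->
    avg_complexity R n <=
      n%:R * lg (n%:R) - (141064%:R / 100000%:R) * n%:R + C * lg (n%:R : R).
Proof.
(* The finitely many n < 256 are absorbed into C; the summand 2m dominates the negative linear term
   1.41064 m. *)
pose A m : R := avg_complexity R m + 2%:R * m%:R.
have A0 m : 0 <= A m by rewrite addr_ge0 ?avg_complexity_ge0 ?mulr_ge0.
exists (1458%:R + \sum_(m < 256) A m) => n on n2; rewrite -/(lin_cst R).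
have S0 : 0 <= \sum_(m < 256) A m by apply: sumr_ge0.
have l2 : 0 < ln 2%:R :> R by rewrite ln_gt0 // ltr1n.
have lg1 : 1 <= lg (n%:R : R).
  by rewrite /lg ler_pdivlMr // mul1r ler_ln ?posrE ?ltr0n ?ler_nat // ltnW.
have [K8|K8] := leqP 8 (clg n).
  apply: le_trans (avg_le_large R on K8) _.
  by rewrite lerD2l ler_wpM2r ?lerDl // (le_trans ler01 lg1).
have n256 : (n < 256)%N.
  apply: leq_ltn_trans (leq_clg n) _; apply: leq_ltn_trans (_ : 2 ^ 7 < 256)%N => //.
  by rewrite leq_exp2l.
have An : A n <= \sum_(m < 256) A m.
  by rewrite (bigD1 (Ordinal n256)) //= lerDl sumr_ge0.
have n0 : 0 <= n%:R :> R by [].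
have cn : lin_cst R * n%:R <= 2%:R * n%:R 
  by apply: ler_wpM2r; [exact: n0 | rewrite /lin_cst; lra].
have h1 : 0 <= n%:R * lg (n%:R : R) by rewrite mulr_ge0 // (le_trans ler01 lg1).
have h2 : 1458%:R + \sum_(m < 256) A m <= (1458%:R + \sum_(m < 256) A m) * lg (n%:R : R).
  by rewrite ler_peMr // addr_ge0.
move: An h2; rewrite /A; move: (\sum_(m < _) _) => S; move: h1 cn.
move: (n%:R * lg _) (lin_cst R * _) (2%:R * _) => a b d h1 cn h3 h2.
have : 0 <= 1458%:R :> R by [].
move: (1458%:R : R) h2 => e h2 h4; move: h2; move: ((e + S) * _) => f; lra.
Qed.
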